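(* Consider cut and project schemes $\mathcal{S}=(\mathbb{R}^2,\mathbb{E}_\vee,\mathbb{E}_<,\mathbb{Z}^2)$ with $k=2$, $d=1$, $\Gamma=\mathbb{Z}^2$ and $\mathbb{E}_\vee=\langle(1,\alpha)\rangle_{\mathbb{R}}$ for some irrational $\alpha\in\mathbb{R}$. If the cut and project sets of $\Omega=\Omega(\mathcal{S},W)$ are $L$-sub with $L$ expansive, for some $\mathbb{E}_<$ and $W$, then $\alpha$ must be a quadratic irrational. Conversely, if $\alpha$ is a quadratic irrational, there is a unique choice of $\mathbb{E}_<$, and there are choices of windows $W$, for which the elements of $\Omega$ are $L$-Sub with $L$ expansive. In this latter case (for that $\mathbb{E}_<$), $W$ may be taken, for example, to be any non-empty finite union of closed non-degenerate intervals in $\mathbb{E}_<$ with rational endpoints (i.e. endpoints in $\mathbb{Q}\Gamma_<$). In this case, $\Lambda\in\Omega$ is pseudo self-affine with respect to some expansive linear map, fixed by some (expansive) substitution map $\sigma\colon\Omega\to\Omega$, if and only if $\tau(\Lambda)=[u]$ for some $u$ with $u_<\in\mathbb{Q}\Gamma_<$.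
   Context: **Patterns.** A Delone multiset in a finite-dimensional real normed space $E$ is a tuple $\Lambda=(\Lambda_1,\dots,\Lambda_\ell)$ of subsets of $E$ whose union is uniformly discrete and relatively dense. Translates $\Lambda+x$ and linear images $L\Lambda$ are taken componentwise. A patch of $\Lambda$ is a tuple $(\Lambda_i\cap U)_i$ with $U$ bounded. With $B(x,r)$ the closed ball, $\Lambda[x,r]:=((\Lambda_i\cap B(x,r))-x)_i$. $\mathcal{Q}$ is locally derivable (LD) from $\mathcal{P}$ if there is $c\ge0$ such that for all $x,y\in E$, $\mathcal{P}[x,c]=\mathcal{P}[y,c]$ implies $\mathcal{Q}[x,0]=\mathcal{Q}[y,0]$; MLD if each is LD from the other. $\mathcal{P}$ is locally indistinguishable (LI) from $\mathcal{Q}$ if every patch of $\mathcal{P}$ occurs, up to translation, in $\mathcal{Q}$; locally isomorphic if each is LI from the other. The hull $\Omega_{\mathcal{P}}$ is the set of all patterns LI from $\mathcal{P}$, with the local topology (two patterns are close if they agree on a large ball about the origin up to a small translation). For a linear automorphism $L$ of $E$: $\mathcal{P}$ is $L$-sub if there is $\mathcal{P}'$, LI from $\mathcal{P}$, such that $\mathcal{P}$ is LD from $L\mathcal{P}'$; $L$-Sub if there is $\mathcal{P}'$, locally isomorphic to $\mathcal{P}$, with $L\mathcal{P}'$ and $\mathcal{P}$ MLD; pseudo self-affine with respect to $L$ if $\mathcal{P}$ is LD from $L\mathcal{P}$. A linear map is expansive if all its eigenvalues have modulus $>1$. A substitution map with inflation $L$ is $\sigma=S\circ L\colon\Omega\to\Omega$,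 where $S\colon L\Omega\to\Omega$ is a local derivation map: there is $c\ge0$ such that $\mathcal{U}[x,c]=\mathcal{V}[y,c]$ implies $S(\mathcal{U})[x,0]=S(\mathcal{V})[y,0]$ for all $\mathcal{U},\mathcal{V}\in L\Omega$, $x,y\in E$; it is expansive if $L$ is. **Cut and project.** Here $\mathbb{E}=\mathbb{R}^2$ and $\mathbb{E}_<$ (the internal space) is a line complementary to the line $\mathbb{E}_\vee$; $x_\vee,x_<$ are the projections of $x$ to $\mathbb{E}_\vee,\mathbb{E}_<$ along $\mathbb{E}=\mathbb{E}_\vee\oplus\mathbb{E}_<$. In a cut and project scheme it is required that $\gamma\mapsto\gamma_\vee$, $\gamma\mapsto\gamma_<$ are injective on $\Gamma$ and $\Gamma_<$ is dense in $\mathbb{E}_<$. A window is a finite tuple $W=(W_i)_{i=1}^\ell$ of compact subsets of $\mathbb{E}_<$, each equal to the closure of its interior, not all empty (identified with a set if $\ell=1$). It is non-singular if $\Gamma_<\cap\partial W_i=\emptyset$ for all $i$; then $\Lambda(\mathcal{S},W)=(\Lambda_i)_i$, $\Lambda_i=\{\gamma_\vee:\gamma\in\Gamma,\gamma_<\in W_i\}$. For arbitrary $W$, $\Omega(\mathcal{S},W):=\Omega_{\Lambda(\mathcal{S},W+s)}$ for any $s\in\mathbb{E}_<$ with $W+s$ non-singular (independent of $s$). A point $x\in\mathbb{E}$ is non-singular if $x_<\notin\bigcup_i\bigcup_{g\in\Gamma_<}(\partial W_i+g)$. The torus parametrisation $\tau\colon\Omega(\mathcal{S},W)\to\mathbb{E}/\Gamma$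 is the unique continuous map with $\tau(\Lambda_x)=[x]$ for all non-singular $x$, where $\Lambda_x$ has $i$th component $\{(\gamma+x)_\vee:\gamma\in\Gamma,(\gamma+x)_<\in W_i\}$. $\mathbb{Q}\Gamma_<=\bigcup_{N\ge1}\frac1N\Gamma_<$. *)

(* Defs.v *)
From HB Require Import structures.
From mathcomp Require Import all_boot all_order all_algebra.
From mathcomp Require Import all_classical all_reals all_analysis.
From mathcomp Require Import generic_quotient complex.

Set Implicit Arguments.
Unset Strict Implicit.
Unset Printing Implicit Defensive.

Import Order.TTheory GRing.Theory Num.Theory.
Import numFieldNormedType.Exports.

Local Open Scope classical_set_scope.
Local Open Scope ring_scope.

(* The finite-dimensional real spaces in which patterns live are the linear    *)
(* subspaces E : {vspace 'rV[R]_n}, with the norm of 'rV[R]_n restricted to E; *)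
(* none of the notions below depends on the choice of the norm.                *)

Section Patterns.
Variables (R : realType) (n : nat).
Notation V := 'rV[R]_n.
Implicit Types E : {vspace V}.

Definition pattern (l : nat) : Type := 'I_l -> set V.

Definition translate l (P : pattern l) (x : V) : pattern l :=
  fun i => [set y + x | y in P i].

Definition lin_image l (L : 'End(V)) (P : pattern l) : pattern l :=
  fun i => [set L y | y in P i].

(* Λ[x,r] *)
Definition ball_patch l (P : pattern l) (x : V) (r : R) : pattern l :=
  translate (fun i => P i `&` closed_ball_ Num.norm x r) (- x).

Definition delone E l (P : pattern l) : Prop :=
  [/\ forall i x, P i x -> x \in E,
      exists r : R, 0 < r /\
        forall x y, (\bigcup_i P i) x -> (\bigcup_i P i) y -> x != y ->
          r <= `|x - y|
    & exists r : R, forall x, x \in E ->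
        exists2 y, (\bigcup_i P i) y & `|x - y| <= r].

(* [ld E P Q]: Q is locally derivable from P *)
Definition ld E l m (P : pattern l) (Q : pattern m) : Prop :=
  exists c : R, 0 <= c /\ forall x y, x \in E -> y \in E ->
    ball_patch P x c = ball_patch P y c -> ball_patch Q x 0 = ball_patch Q y 0.

Definition mld E l m (P : pattern l) (Q : pattern m) : Prop :=
  ld E P Q /\ ld E Q P.

(* [li E P Q]: P is locally indistinguishable from Q.  A patch P ∩ U occurs   *)
(* in Q if some translate of it is the part of Q inside the translated region *)
(* U + t: agreement of the point sets alone, without the region, would make   *)
(* every sub-pattern of Q locally indistinguishable from Q.                   *)
Definition li E l (P Q : pattern l) : Prop :=
  forall U : set V, bounded_set U -> exists2 t, t \in E &
    translate (fun i => P i `&` U) t =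
    (fun i => Q i `&` [set u + t | u in U]).

Definition locally_isomorphic E l (P Q : pattern l) : Prop :=
  li E P Q /\ li E Q P.

Definition hull E l (P : pattern l) : set (pattern l) :=
  [set Q | delone E Q /\ li E Q P].

(* Q agrees with a translate of P by t, |t| <= e, on the ball of radius 1/e. *)
Definition local_close E l (P : pattern l) (e : R) : set (pattern l) :=
  [set Q | exists t, [/\ t \in E, `|t| <= e &
     forall i, Q i `&` closed_ball_ Num.norm 0 e^-1 =
               translate P t i `&` closed_ball_ Num.norm 0 e^-1]].

Definition local_nbhs E l (P : pattern l) : set_system (pattern l) :=
  [set A | exists2 e : R, 0 < e & local_close E P e `<=` A].

(* A linear automorphism of E is represented by an endomorphism of 'rV[R]_n   *)
(* mapping E onto E; only its restriction to E matters.                       *)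
Definition lin_aut E (L : 'End(V)) : Prop := (L @: E)%VS = E.

Definition restr_end E (L : 'End(V)) : 'End(subvs_of E) :=
  linfun (fun u : subvs_of E => vsproj E (L (vsval u))).

(* Complex eigenvalues of the restriction of L to E. *)
Definition expansive E (L : 'End(V)) : Prop :=
  let e := vbasis {: subvs_of E} in
  forall z : R[i],
    eigenvalue (map_mx (real_complex R) (passmx.mxof e e (restr_end E L))) z ->
    1 < `|z|.

Definition L_sub E (L : 'End(V)) l (P : pattern l) : Prop :=
  exists P', [/\ delone E P', li E P' P & ld E (lin_image L P') P].

Definition L_Sub E (L : 'End(V)) l (P : pattern l) : Prop :=
  exists P', [/\ delone E P', locally_isomorphic E P' P
               & mld E (lin_image L P') P].

Definition pseudo_self_affine E (L : 'End(V)) l (P : pattern l) : Prop :=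
  ld E (lin_image L P) P.

Definition local_derivation_map E l (D D' : set (pattern l))
    (S : pattern l -> pattern l) : Prop :=
  (forall P, D P -> D' (S P)) /\
  exists c : R, 0 <= c /\ forall P Q x y, D P -> D Q -> x \in E -> y \in E ->
    ball_patch P x c = ball_patch Q y c ->
    ball_patch (S P) x 0 = ball_patch (S Q) y 0.

Definition substitution_map E (L : 'End(V)) l (Omega : set (pattern l))
    (sigma : pattern l -> pattern l) : Prop :=
  exists S, local_derivation_map E (lin_image L @` Omega) Omega S /\
    forall P, Omega P -> sigma P = S (lin_image L P).

End Patterns.

Section Torus.
Variables (R : realType) (n : nat).

Definition int_lattice : set 'rV[R]_n :=
  [set x | forall j, x 0 j \is a Num.int].

Definition lattice_eqv : rel 'rV[R]_n := fun x y => `[< int_lattice (x - y) >].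

Lemma lattice_eqv_refl : reflexive lattice_eqv.
Proof. by move=> x; apply/asboolP => j; rewrite subrr mxE. Qed.

Lemma lattice_eqv_sym : symmetric lattice_eqv.
Proof.
suff h x y : lattice_eqv x y -> lattice_eqv y x.
  by move=> x y; apply/idP/idP; exact: h.
by move=> /asboolP xy; apply/asboolP => j; rewrite -opprB mxE rpredN; exact: xy.
Qed.

Lemma lattice_eqv_trans : transitive lattice_eqv.
Proof.
move=> y x z /asboolP xy /asboolP yz; apply/asboolP => j.
by rewrite -(subrKA y) mxE rpredD.
Qed.

Canonical lattice_equiv :=
  EquivRel lattice_eqv lattice_eqv_refl lattice_eqv_sym lattice_eqv_trans.

Definition torus : Type := quotient_topology {eq_quot lattice_equiv}%qT.
HB.instance Definition _ := Topological.on torus.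

Definition torus_class (x : 'rV[R]_n) : torus := (\pi_(quotient_topology {eq_quot lattice_equiv}) x)%qT.

End Torus.

Section CutAndProject.
Variables (R : realType) (n : nat).
Notation V := 'rV[R]_n.
Variables Ev Ei : {vspace V}.

Definition prv (x : V) : V := daddv_pi Ev Ei x.
Definition pri (x : V) : V := daddv_pi Ei Ev x.

Notation Gamma := (@int_lattice R n).

Definition cut_and_project_scheme : Prop :=
  [/\ (Ev :&: Ei)%VS = 0%VS, (Ev + Ei)%VS = fullv,
      {in Gamma &, injective prv}, {in Gamma &, injective pri}
    & [set` Ei] `<=` closure (pri @` Gamma)].

(* Interior, closure and boundary are taken in the internal space Ei. *)
Definition int_interior (A : set V) : set V :=
  @interior (subspace [set` Ei]) A.
Definition int_closure (A : set V) : set V :=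
  @closure (subspace [set` Ei]) A.
Definition int_boundary (A : set V) : set V :=
  int_closure A `\` int_interior A.

Definition window l (W : 'I_l -> set V) : Prop :=
  (forall i, [/\ W i `<=` [set` Ei], compact (W i)
               & W i = int_closure (int_interior (W i))]) /\
  exists i, W i !=set0.

Definition nonsingular_window l (W : 'I_l -> set V) : Prop :=
  forall i, pri @` Gamma `&` int_boundary (W i) = set0.

Definition cp_set l (W : 'I_l -> set V) : pattern R n l :=
  fun i => [set prv g | g in Gamma `&` [set g | W i (pri g)]].

(* Ω(S,W) *)
Definition cp_hull l (W : 'I_l -> set V) : set (pattern R n l) :=
  [set P | exists s, [/\ s \in Ei, nonsingular_window (translate W s)
                       & hull Ev (cp_set (translate W s)) P]].

Definition nonsingular_point l (W : 'I_l -> set V) (x : V) : Prop :=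
  ~ (\bigcup_i \bigcup_(g in pri @` Gamma)
       [set y + g | y in int_boundary (W i)]) (pri x).

(* Λ_x *)
Definition cp_set_at l (W : 'I_l -> set V) (x : V) : pattern R n l :=
  fun i => [set prv (g + x) | g in Gamma `&` [set g | W i (pri (g + x))]].

Definition torus_parametrisation l (W : 'I_l -> set V)
    (tau : pattern R n l -> torus R n) : Prop :=
  (forall P, cp_hull W P ->
     tau @ within (cp_hull W) (local_nbhs Ev P) --> tau P) /\
  (forall x, nonsingular_point W x -> tau (cp_set_at W x) = torus_class x).

Definition rational_pri : set V :=
  [set x | exists N : nat, (0 < N)%N /\
     exists2 g, Gamma g & x = N%:R^-1 *: pri g].

Definition segment (a b : V) : set V :=
  [set (1 - t) *: a + t *: b | t in `[0, 1]].

Definition rational_interval_union (A : set V) : Prop :=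
  exists s : seq (V * V),
    [/\ s <> [::],
        forall p, p \in s ->
          [/\ rational_pri p.1, rational_pri p.2 & p.1 != p.2]
      & A = \bigcup_(p in [set` s]) segment p.1 p.2].

End CutAndProject.

Section Planar.
Variable R : realType.

Definition slope_vector (alpha : R) : 'rV[R]_2 :=
  \row_j (if j == ord0 then 1 else alpha).

Definition slope_line (alpha : R) : {vspace 'rV[R]_2} :=
  <[ slope_vector alpha ]>%VS.

Definition quadratic_irrational (alpha : R) : Prop :=
  irrational alpha /\
  exists p : {poly int}, size p = 3%N /\ root (map_poly intr p) alpha.

End Planar.

(* Main.v *)
Require Import Defs.
From HB Require Import structures.
From mathcomp Require Import all_boot all_order all_algebra.
From mathcomp Require Import all_classical all_reals all_analysis.
From mathcomp Require Import ring lra zify complex generic_quotient.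
Import Order.TTheory GRing.Theory Num.Theory.
Import numFieldNormedType.Exports.
Local Open Scope classical_set_scope.
Local Open Scope ring_scope.

Set Implicit Arguments.
Unset Strict Implicit.
Unset Printing Implicit Defensive.

(* Call [g] a return vector of a pattern if a patch of fixed large radius recurs
   after translation by [g]. Returns of a cut and project set are projections of
   lattice points with bounded internal coordinate, and include all lattice points
   with small internal coordinate. If [P] is locally derivable from [L P'], returns
   are stable under [L], so [L] is induced by a rational matrix acting on the
   lattice; boundedness makes the internal space an eigenline and forbids expansion
   there. The two eigenlines are therefore distinct, their slopes are conjugate
   quadratic irrationals, and the internal space is determined by the physical one.

   Conversely, Pell's equation yields a unimodular integral matrix, congruent to 1
   modulo any given integer, that expands the physical line and contracts the
   internal line by positive factors. It moves rational endpoints of a window by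
   lattice vectors, so a window and its contraction are finite unions of finite
   intersections of lattice translates of each other, and these formulas are local
   derivations. Every element of the hull comes from a half-open version of the
   window, to which the formulas apply verbatim, with an internal offset; it is fixed
   by a substitution as soon as the offset is rational. If [P] is locally derivable
   from [L P], comparing the jump of the window of [P] at an endpoint with the jumps
   of the contracted window forces the offset to be rational. *)

(** * Diophantine approximation and Pell's equation *)

(** The hull contains patterns at singular offsets, which no closed window describes. Since the
    internal space is a line, such an offset is approached from the left or from the right only, and
    either choice turns each interval of the window into a half-open one. Identities between windows
    must therefore survive passage to one-sided limits.

    The congruence to 1 modulo [N] serves the endpoints: if [N c] is the internal coordinate of a
    lattice vector, so is [(lam^-1 - 1) c], and contraction moves the jump at [c] by a lattice
    vector. Different jumps move by different vectors, so no single translation relates the two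
    windows; they are compared jump by jump, and the local formulas are glued by compactness.

    In the necessity part two independent returns may span a proper sublattice only, so the integral
    matrix realizes a multiple [m lam] of the scaling. Local indistinguishability in the definition
    of [L_sub] is one-directional; repetitivity of nonsingular patterns makes it symmetric. *)

Section Diophantine.
Variables (R : realType) (theta : R).

(** Pigeonhole: [n + 1] fractional parts of multiples of [theta] fall into [n] boxes of length
    [1/n]. *)
Lemma dirichlet_approximation (n : nat) : (0 < n)%N ->
  exists (x : int) (y : nat), [/\ (0 < y <= n)%N &
    `|x%:~R - y%:R * theta| < n%:R^-1].
Proof.
case: n => // n _.
pose fr (k : nat) : R := k%:R * theta - (Num.floor (k%:R * theta))%:~R.
have fr_itv k : 0 <= fr k < 1.
  have /andP[h1 h2] := floor_itv (k%:R * theta).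
  by rewrite subr_ge0 h1 /= ltrBlDl; move: h2; rewrite intrD.
have fr_lt k : (Num.truncn (n.+1%:R * fr k) < n.+1)%N.
  have /andP[h1 h2] := fr_itv k.
  have h3 : 0 <= n.+1%:R * fr k by rewrite mulr_ge0.
  rewrite -(ltr_nat R); apply: (@le_lt_trans _ _ (n.+1%:R * fr k)).
    by have /andP[] := truncn_itv h3.
  by rewrite gtr_pMr.
pose box (k : 'I_n.+2) : 'I_n.+1 := Ordinal (fr_lt k).
have /injectivePn[i [j ij eqij]] : ~~ injectiveb box.
  by apply/negP => /injectiveP /leq_card; rewrite !card_ord ltnn.
wlog {ij} ij : i j eqij / (i < j)%N.
  move=> wl; have : (i != j :> nat) by [].
  rewrite neq_ltn => /orP[|] h; first exact: (wl i j).
  exact: (wl j i).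
exists (Num.floor (j%:R * theta) - Num.floor (i%:R * theta)), (j - i)%N; split.
  by have := ltn_ord j; lia.
have /(congr1 val) /= e := eqij.
have /andP[fi0 fi1] := fr_itv i; have /andP[fj0 fj1] := fr_itv j.
have hi : 0 <= n.+1%:R * fr i by rewrite mulr_ge0.
have hj : 0 <= n.+1%:R * fr j by rewrite mulr_ge0.
have /andP[i1 i2] := truncn_itv hi; have /andP[j1 j2] := truncn_itv hj.
have -> : (Num.floor (j%:R * theta) - Num.floor (i%:R * theta))%:~R
     - (j - i)%:R * theta = fr i - fr j.
  by rewrite /fr natrB 1?ltnW // intrB; ring.
rewrite -[_^-1]mul1r ltr_pdivlMr // -[X in _ * X]ger0_norm // -normrM.
move: i1 i2 j1 j2; rewrite e -!natr1 => i1 i2 j1 j2.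
by rewrite ltr_norml; apply/andP; split; lra.
Qed.

Hypothesis theta_irr : irrational theta.

Lemma irrational_comb_neq0 (x y : int) : (x, y) != (0, 0) ->
  x%:~R - y%:~R * theta != 0.
Proof.
move=> xy; apply/eqP => /eqP; rewrite subr_eq0 => /eqP e.
have [y0|y0] := eqVneq y 0.
  move: e xy; rewrite y0 mul0r => /eqP; rewrite intr_eq0 => /eqP ->.
  by rewrite eqxx.
have yR0 : y%:~R != 0 :> R by rewrite intr_eq0.
apply: theta_irr; exists (x%:~R / y%:~R) => //.
by rewrite fmorph_div /= !ratr_int e mulrC mulKf.
Qed.

Lemma small_comb (e : R) : 0 < e -> exists (x : int) (y : nat),
  [/\ (0 < y)%N, y%:R * `|x%:~R - y%:R * theta| < 1 &
      0 < `|x%:~R - y%:R * theta| < e].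
Proof.
move=> e0.
pose n := (Num.truncn e^-1).+1.
have ne : n%:R^-1 < e.
  rewrite invf_plt ?posrE //.
  have h : 0 <= e^-1 by rewrite invr_ge0 ltW.
  by have /andP[] := truncn_itv h.
have [x [y [/andP[y0 yn] xy]]] := dirichlet_approximation (ltn0Sn _ : (0 < n)%N).
exists x, y; split => //.
  apply: le_lt_trans (_ : n%:R * `|x%:~R - y%:R * theta| < 1).
    by rewrite ler_wpM2r // ler_nat.
  by rewrite mulrC -ltr_pdivlMr // mul1r.
rewrite (lt_trans xy) // andbT normr_gt0.
apply: (irrational_comb_neq0 (x := x) (y := y)).
by rewrite xpair_eqE negb_and eqz_nat -lt0n y0 orbT.
Qed.

(** The multiples of a positive combination smaller than [b - a] cannot jump over the interval. *)
Lemma dense_comb (a b : R) : a < b -> exists x y : int,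
  a < x%:~R - y%:~R * theta < b.
Proof.
move=> ab; have ab0 : 0 < b - a by rewrite subr_gt0.
have [x0 [y0 [_ _ /andP[h1 h2]]]] := small_comb ab0.
have [x [y /andP[t0 tl]]] : exists x y : int,
    0 < x%:~R - y%:~R * theta < b - a.
  have [h|h|h] := ltrgt0P (x0%:~R - y0%:R * theta).
  - by exists x0, y0; rewrite -[y0%:~R]/(y0%:R) h -(gtr0_norm h).
  - exists (- x0), (- y0%:Z); rewrite !intrN -[y0%:~R]/(y0%:R) mulNr -opprD.
    by rewrite oppr_gt0 h -(ltr0_norm h).
  - by move: h1; rewrite h normr0 ltxx.
set t := _ - _ in t0 tl.
pose k := Num.floor (a / t) + 1.
have /andP[k1 k2] := floor_itv (a / t).
exists (k * x), (k * y).
have -> : (k * x)%:~R - (k * y)%:~R * theta = k%:~R * t.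
  by rewrite /t !intrM; ring.
rewrite -ltr_pdivrMr // k2 /=.
rewrite /k intrD mulrDl mul1r.
have : (Num.floor (a / t))%:~R * t <= a by rewrite -ler_pdivlMr.
by lra.
Qed.

End Diophantine.

Section Pell.
Variables (R : realType) (D : int) (theta : R).
Hypotheses (theta_irr : irrational theta) (theta_gt0 : 0 < theta).
Hypothesis theta2 : theta ^+ 2 = D%:~R.

Let N (p : int * int) : int := p.1 ^+ 2 - D * p.2 ^+ 2.
Let ev (p : int * int) : R := p.1%:~R - p.2%:~R * theta.

(** The norm factors as [(x - y theta)(x + y theta)]. For a Dirichlet approximation
    [y |x - y theta| < 1], and the second factor exceeds the first by [2 y theta], whence the bound
    [1 + 2 theta]. *)
Lemma small_norms : exists C : nat, forall e : R, 0 < e -> exists p,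
  [/\ 0 < `|ev p| < e, (`|N p| <= C)%N & N p != 0].
Proof.
exists (Num.truncn (1 + 2 * theta)).+1 => e e0.
have m0 : 0 < Num.min e 1 by rewrite lt_min e0 ltr01.
have [x [y [y0 xy1 /andP[xy0 xye]]]] := small_comb theta_irr m0.
have NE : (N (x, y%:Z))%:~R = (x%:~R - y%:R * theta) * (x%:~R + y%:R * theta).
  rewrite /N /= intrB intrM !rmorphXn /= -theta2 -[y%:~R]/(y%:R); ring.
move: xye; rewrite lt_min => /andP[xye xyl1].
exists (x, y%:Z); split; first by rewrite /ev /= xy0 xye.
  rewrite -(ler_nat R) -[(absz _)%:R]/((absz _)%:~R) abszE intr_norm NE normrM.
  apply: (@le_trans _ _ (1 + 2 * theta)); last first.
    have h : 0 <= 1 + 2 * theta by rewrite addr_ge0 // mulr_ge0 // ltW.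
    by have /andP[_ /ltW] := truncn_itv h.
  have h : `|x%:~R + y%:R * theta| <= `|x%:~R - y%:R * theta| + 2 * (y%:R * theta).
    have -> : x%:~R + y%:R * theta
            = (x%:~R - y%:R * theta) + 2 * (y%:R * theta) by ring.
    apply: (le_trans (ler_normD _ _)); rewrite lerD2l ger0_norm //.
    by rewrite !mulr_ge0 // ltW.
  apply: le_trans (_ : `|x%:~R - y%:R * theta| *
     (`|x%:~R - y%:R * theta| + 2 * (y%:R * theta)) <= _).
    by rewrite ler_wpM2l.
  rewrite mulrDr lerD //; first by rewrite -expr2 expr_le1 // ltW.
  rewrite mulrCA ler_wpM2l // mulrA mulrC -[leRHS]mulr1 ler_wpM2l //.
    exact: ltW.
  by rewrite mulrC ltW.
rewrite -(intr_eq0 R) NE mulf_neq0 // -?normr_gt0 //.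
have := @irrational_comb_neq0 _ _ theta_irr x (- y%:Z).
rewrite xpair_eqE negb_and oppr_eq0 eqz_nat -lt0n y0 orbT normr_gt0.
by rewrite intrN mulNr opprK; apply.
Qed.

(** Strict growth of [|ev p|] distinguishes the pairs even up to sign; this makes the unit built
    from two of them nontrivial. *)
Lemma small_norm_seq (C : nat) : (forall e : R, 0 < e -> exists p,
  [/\ 0 < `|ev p| < e, (`|N p| <= C)%N & N p != 0]) ->
  forall n, exists s : seq (int * int),
  [/\ size s = n, pairwise (fun p q => `|ev p| < `|ev q|) s &
      all (fun p => [&& 0 < `|ev p|, (`|N p| <= C)%N & N p != 0]) s].
Proof.
move=> H; elim=> [|n [s [<- ps als]]]; first by exists [::].
have [e [e0 eP]] : exists e : R, 0 < e /\ all (fun q => e <= `|ev q|) s.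
  elim: s als {ps} => [_|q s IH /= /andP[/and3P[q0 _ _] /IH[e [e0 eP]]]].
    by exists 1.
  exists (Num.min e `|ev q|); split; first by rewrite lt_min e0.
  rewrite /= ge_min lexx orbT /=; apply: sub_all eP => z ez.
  by rewrite ge_min ez.
have [p [/andP[p0 pe] pC pN]] := H _ e0.
exists (p :: s); split => //=; last by rewrite p0 pC pN.
by rewrite ps andbT; apply: sub_all eP => q; apply: lt_le_trans.
Qed.

Lemma pell_solution : exists x y : int, y != 0 /\ x ^+ 2 - D * y ^+ 2 = 1.
Proof.
have [C HC] := small_norms.
(* [C!] is a multiple of every nonzero norm of size at most [C], so congruence modulo [K] implies
   congruence modulo the norm. *)
have [K [K0 dvdK]] : exists K : nat, (0 < K)%N /\
    forall z : int, z != 0 -> (`|z| <= C)%N -> (z %| K%:Z)%Z.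
  exists C`!; split=> [|z z0 zC]; first by rewrite fact_gt0.
  by rewrite dvdzE /=; apply: dvdn_fact; rewrite zC absz_gt0 z0.
pose T : finType := ('I_(C + C).+1 * 'I_K.-1.+1 * 'I_K.-1.+1)%type.
(* The shift by [C] encodes a signed norm in [[-C, C]] as a natural number. *)
pose h (p : int * int) : T := (inord `|(N p + C%:Z)%R|%N,
  inord `|(p.1 %% K%:Z)%Z|%N, inord `|(p.2 %% K%:Z)%Z|%N).
have [s [ss ps als]] := small_norm_seq HC #|T|.+1.
have : ~~ uniq (map h s).
  apply/negP => /card_uniqP; rewrite size_map ss => e.
  by have := max_card (mem (map h s)); rewrite e ltnn.
case/(uniqPn (h (0, 0))) => i [j [ij js]].
rewrite size_map in js; have isz := ltn_trans ij js.
rewrite !(nth_map (0, 0)) //.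
set p := nth _ s i; set q := nth _ s j => hpq.
have lt_pq : `|ev p| < `|ev q|.
  by apply: (pairwiseP (0, 0) ps) => //; rewrite inE.
have /and3P[p0 pC pN] := all_nthP (0, 0) als i isz.
have /and3P[q0 qC qN] := all_nthP (0, 0) als j js.
rewrite -/p -/q in p0 pC pN q0 qC qN.
case: hpq => /(congr1 val) h1 /(congr1 val) h2 /(congr1 val) h3.
have modK (z : int) : (`|(z %% K%:Z)%Z| < K.-1.+1)%N.
  rewrite prednK // -ltz_nat gez0_abs ?modz_ge0 //; last by rewrite eqz_nat -lt0n.
  by rewrite ltz_pmod.
have NCK (z : int) : (`|z| <= C)%N -> (`|(z + C%:Z)%R| < (C + C).+1)%N.
  by clear; lia.
rewrite /= !inordK ?NCK // in h1 h2 h3.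
have h1' : N p = N q.
  by move: (N p) (N q) pC qC h1 => a b; clear; lia.
have modE (z z' : int) : `|(z %% K%:Z)%Z|%N = `|(z' %% K%:Z)%Z|%N ->
    (K%:Z %| z - z')%Z.
  have Kn0 : K%:Z != 0 by rewrite eqz_nat -lt0n.
  move=> e; rewrite -eqz_mod_dvd; apply/eqP.
  have := modz_ge0 z Kn0; have := modz_ge0 z' Kn0; move: e.
  by move: (modz z K) (modz z' K) => a b; clear; lia.
have dK := dvdK _ pN pC.
have d1 := dvdz_trans dK (modE _ _ h2); have d2 := dvdz_trans dK (modE _ _ h3).
case/dvdzP: d1 => u eu; case/dvdzP: d2 => v ev'.
(* (p.1 - p.2 theta) / (q.1 - q.2 theta) has norm one *)
exists (1 + u * q.1 - D * v * q.2), (v * q.1 - u * q.2).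
have NpE : N p = q.1 ^+ 2 - D * q.2 ^+ 2 by rewrite h1'.
have e1 : p.1 = q.1 + u * N p by rewrite -eu; ring.
have e2 : p.2 = q.2 + v * N p by rewrite -ev'; ring.
have X : N p * (1 + u * q.1 - D * v * q.2) = p.1 * q.1 - D * p.2 * q.2.
  by rewrite e1 e2 {2}NpE; rewrite NpE; ring.
have Y : N p * (v * q.1 - u * q.2) = p.2 * q.1 - p.1 * q.2.
  by rewrite e1 e2; ring.
have XY : (1 + u * q.1 - D * v * q.2) ^+ 2 - D * (v * q.1 - u * q.2) ^+ 2 = 1.
  apply: (mulfI (_ : N p ^+ 2 != 0)); first by rewrite expf_neq0.
  rewrite mulr1 mulrBr -exprMn X mulrCA -exprMn Y.
  transitivity (N p * N q); last by rewrite -h1' expr2.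
  rewrite /N; ring.
split=> //; apply/eqP => y0.
(* With [y = 0] the quotient would be 1 or -1, so that [|ev p| = |ev q|]. *)
move: XY Y; rewrite y0 expr0n /= mulr0 subr0 => XY; rewrite mulr0 => Y.
have X1 : `|1 + u * q.1 - D * v * q.2| = 1.
  apply/eqP; rewrite -(@eqrXn2 _ 2) // real_normK ?num_real // XY expr1n //.
have evX : N p = q.1 ^+ 2 - D * q.2 ^+ 2 := NpE.
set x := (1 + _ - _) in X X1 y0.
have E : (N p)%:~R * ev p = (N p)%:~R * (x%:~R * ev q).
  have -> : (N p)%:~R * (x%:~R * ev q) = (N p * x)%:~R * ev q
    by rewrite intrM mulrA.
  rewrite X /ev.
  have Y' : p.2%:~R * q.1%:~R = p.1%:~R * q.2%:~R :> R.
    by rewrite -!intrM; apply/eqP; rewrite eqr_int -subr_eq0 -Y.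
  rewrite NpE !(intrB, intrM, rmorphXn) /= -theta2.
  rewrite !mulrBl !mulrBr.
  ring: Y'.
have E' : ev p = x%:~R * ev q.
  by apply: (mulfI _ E); rewrite intr_eq0.
move: lt_pq; rewrite E' normrM -intr_norm X1 mul1r ltxx //.
Qed.

End Pell.

Lemma irrationalMz (R : realType) (x : R) (m : int) :
  irrational x -> m != 0 -> irrational (m%:~R * x).
Proof.
move=> xirr m0 [r _ rE]; apply: xirr; exists (r / m%:~R) => //.
by rewrite fmorph_div /= ratr_int rE mulrC mulKf // intr_eq0.
Qed.

(** A Pell solution for [D m^2] is squared: [(x + y m theta)^2 = (1 + 2 D m^2 y^2) + 2 x y m theta],
    where both congruences modulo [m] are visible. *)
Lemma pell_unit (R : realType) (D : int) (theta : R) (m : nat) :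
  irrational theta -> theta ^+ 2 = D%:~R -> (0 < m)%N ->
  exists x y : int, [/\ (m %| x - 1)%Z, (m %| y)%Z,
    x ^+ 2 - D * y ^+ 2 = 1 & 1 < x%:~R + y%:~R * theta].
Proof.
move=> irr th2 m0.
have th0 : theta != 0.
  by apply/eqP => th0; apply: irr; exists 0 => //; rewrite rmorph0.
have [sg [sg2 sgth]] : exists sg : int, sg ^+ 2 = 1 /\ `|theta| = sg%:~R * theta.
  have [h|h] := lerP 0 theta.
    by exists 1; split; rewrite ?expr1n // ger0_norm ?mul1r.
  by exists (-1); split; rewrite ?sqrrN ?expr1n // ltr0_norm // intrN mulN1r.
have sg0 : sg != 0 by apply/eqP => sg0; move: sg2; rewrite sg0.
have t2 : (m%:~R * `|theta|) ^+ 2 = (D * m%:Z ^+ 2)%:~R.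
  by rewrite exprMn real_normK ?num_real // th2 intrM rmorphXn /= mulrC.
have t0 : 0 < m%:~R * `|theta| by rewrite mulr_gt0 ?normr_gt0 // ltr0z ltz_nat.
have tirr : irrational (m%:~R * `|theta|).
  rewrite sgth mulrA -intrM; apply: irrationalMz irr _.
  by rewrite mulf_neq0 // eqz_nat -lt0n.
have D0 : 0 < D by rewrite -(ltr0z R) -th2 exprn_even_gt0.
have [x [y [y0 xy]]] := pell_solution tirr t0 t2.
(* The sign of [y] is chosen so that [x y theta] is positive; otherwise the square would be the
   inverse unit, below 1. *)
wlog y1 : x y y0 xy / 0 < x * y * sg.
  have x0 : x != 0.
    apply/eqP => x0; move: xy; rewrite x0 expr0n sub0r => /eqP.
    rewrite eqr_oppLR => /eqP e.
    by have := mulr_ge0 (mulr_ge0 (ltW D0) (sqr_ge0 m%:Z)) (sqr_ge0 y); rewrite e.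
  have xys : x * y * sg != 0 by rewrite !mulf_neq0.
  have [h|h|h] := ltrgt0P (x * y * sg); last by rewrite h eqxx in xys.
    by move/(_ x y y0 xy h).
  move/(_ x (- y)); rewrite oppr_eq0 sqrrN; apply => //.
  by rewrite mulrN mulNr oppr_gt0.
exists (1 + 2 * D * m%:Z ^+ 2 * y ^+ 2), (2 * x * y * m%:Z); split.
- have -> : 1 + 2 * D * m%:Z ^+ 2 * y ^+ 2 - 1 = 2 * D * m%:Z * y ^+ 2 * m%:Z.
    by ring.
  by rewrite dvdz_mull.
- by rewrite dvdz_mull.
- have x2 : x ^+ 2 = 1 + D * m%:Z ^+ 2 * y ^+ 2 by rewrite -xy subrK.
  rewrite [X in _ - D * X](_ : _ = 4 * x ^+ 2 * y ^+ 2 * m%:Z ^+ 2); last by ring.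
  rewrite x2; ring.
- have h1 : 0 < (2 * D * m%:Z ^+ 2 * y ^+ 2)%:~R :> R.
    have m2 : 0 < m%:Z ^+ 2 by rewrite exprn_even_gt0 //= eqz_nat -lt0n.
    have y2 : 0 < y ^+ 2 by rewrite exprn_even_gt0.
    by rewrite ltr0z mulr_gt0 // mulr_gt0 // mulr_gt0.
  have h2 : 0 <= (2 * x * y * m%:Z)%:~R * theta.
    have -> : theta = sg%:~R * `|theta|.
      by rewrite sgth mulrA -intrM -expr2 sg2 mul1r.
    rewrite mulrA mulr_ge0 // -intrM ler0z.
    have -> : 2 * x * y * m%:Z * sg = (x * y * sg) * (2 * m%:Z) by ring.
    by rewrite mulr_ge0 // ltW.
  by rewrite intrD; lra.
Qed.

(** * Coordinates of a planar scheme *)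

Lemma seq_uniform_eps (R : realType) (T : eqType) (s : seq T) (P : T -> R -> Prop) :
  (forall x, x \in s -> exists2 e, 0 < e & forall t, 0 < t < e -> P x t) ->
  exists2 e, 0 < e & forall x, x \in s -> forall t, 0 < t < e -> P x t.
Proof.
elim: s => [|x s IH] H; first by exists 1.
have [e e0 He] := H x (mem_head _ _).
have [|e' e'0 He'] := IH; first by move=> y ys; apply: H; rewrite inE ys orbT.
exists (Num.min e e'); first by rewrite lt_min e0.
move=> y; rewrite inE => /predU1P[->|ys] t; rewrite lt_min => /and3P[t0 te te'].
  by apply: He; rewrite t0.
by apply: He' => //; rewrite t0.
Qed.

Section PlanarNorm.
Variable R : realType.
Implicit Types x y : 'rV[R]_2.

Lemma row2P x y : x 0 0 = y 0 0 -> x 0 1 = y 0 1 -> x = y.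
Proof.
move=> h0 h1; apply/rowP => j; case: (unliftP 0 j) => [j' ->|-> //].
by rewrite (ord1 j') (_ : lift 0 0 = 1) //; apply: val_inj.
Qed.

Lemma coord_le_norm x j : `|x 0 j| <= `|x|.
Proof.
rewrite /Num.Def.normr /= mx_normrE.
exact: (@le_bigmax _ _ _ 0 (fun i : 'I_1 * 'I_2 => `|x i.1 i.2|) (0, j)).
Qed.

Lemma norm_le_coord x M : `|x 0 0| <= M -> `|x 0 1| <= M -> `|x| <= M.
Proof.
move=> h0 h1; rewrite /Num.Def.normr /= mx_normrE; apply: bigmax_le.
  exact: le_trans h0.
case=> i j _ /=; rewrite (ord1 i); case: (unliftP 0 j) => [j' ->|-> //].
by rewrite (ord1 j') (_ : lift 0 0 = 1) //; apply: val_inj.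
Qed.

Local Notation Gamma := (@int_lattice R 2).

Definition lattice_vec (m n : int) : 'rV[R]_2 :=
  \row_j (if j == 0 then m%:~R else n%:~R).

Lemma lattice_vecP x : Gamma x <-> exists m n, x = lattice_vec m n.
Proof.
split=> [Gx|[m [n ->]] j]; last by rewrite mxE; case: eqP.
have /intrP[m hm] := Gx 0; have /intrP[n hn] := Gx 1.
by exists m, n; apply: row2P; rewrite !mxE /=.
Qed.

Lemma lattice0 : Gamma 0. Proof. by move=> j; rewrite mxE. Qed.

Lemma latticeD x y : Gamma x -> Gamma y -> Gamma (x + y).
Proof. by move=> Gx Gy j; rewrite mxE rpredD. Qed.

Lemma latticeN x : Gamma x -> Gamma (- x).
Proof. by move=> Gx j; rewrite mxE rpredN. Qed.

Lemma latticeB x y : Gamma x -> Gamma y -> Gamma (x - y).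
Proof. by move=> Gx /latticeN; apply: latticeD. Qed.

Lemma latticeZ (m : int) x : Gamma x -> Gamma (m%:~R *: x).
Proof. by move=> Gx j; rewrite mxE rpredM // intr_int. Qed.

Lemma latticeM x (B : 'M[R]_2) :
  (forall i j, B i j \is a Num.int) -> Gamma x -> Gamma (x *m B).
Proof. by move=> BZ Gx j; rewrite mxE rpred_sum // => i _; rewrite rpredM. Qed.

Lemma lattice_norm_ge1 x : Gamma x -> x != 0 -> 1 <= `|x|.
Proof.
case/lattice_vecP => m [n ->] h.
have [m0|m0] := eqVneq m 0.
  have n0 : n != 0.
    apply: contraNneq h => ->; rewrite m0; apply/eqP/row2P; rewrite !mxE //=.
  apply: le_trans (coord_le_norm _ 1); rewrite mxE /= -intr_norm.
  by rewrite (ler_int R 1); lia.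
apply: le_trans (coord_le_norm _ 0); rewrite mxE /= -intr_norm.
by rewrite (ler_int R 1); lia.
Qed.

Lemma finite_lattice_ball (K : R) :
  exists s : seq 'rV[R]_2, forall x, Gamma x -> `|x| <= K -> x \in s.
Proof.
pose n := (Num.truncn `|K|).+1.
pose I := [seq i%:Z - n%:Z | i <- iota 0 (n + n).+1].
have inI (m : int) : `|m%:~R : R| <= K -> m \in I.
  move=> mK; have : (`|m| < n)%N.
    rewrite -(ltr_nat R) -[(absz m)%:R]/((absz m)%:~R) abszE intr_norm.
    have /andP[_] := truncn_itv (normr_ge0 K); apply: le_lt_trans.
    by rewrite (le_trans mK) // ler_norm.
  move=> mn; apply/mapP; exists `|(m + n%:Z)%R|%N; last by lia.
  by rewrite mem_iota; lia.
exists [seq lattice_vec a b | a <- I, b <- I] => x /lattice_vecP[m [k ->]] xK.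
apply: allpairs_f; apply: inI; apply: le_trans xK.
  by have := coord_le_norm (lattice_vec m k) 0; rewrite mxE.
by have := coord_le_norm (lattice_vec m k) 1; rewrite mxE.
Qed.

End PlanarNorm.

Section Coordinates.
Variables (R : realType) (alpha : R).
Local Notation V := 'rV[R]_2.
Local Notation Gamma := (@int_lattice R 2).
Local Notation v := (slope_vector alpha).
Local Notation Ev := (slope_line alpha).

(* With [x = p (1, alpha) + q w] and [w = internal_vec alpha k], the coordinates
   are [p = phys_coord alpha k x] and [q = int_coord alpha x]; the latter does not
   depend on the internal space, which the single parameter [k] encodes. *)
Definition internal_vec (k : R) : V :=
  \row_j (if j == 0 then k else 1 + alpha * k).
Definition int_coord (x : V) : R := x 0 1 - alpha * x 0 0.
Definition phys_coord (k : R) (x : V) : R := x 0 0 - k * int_coord x.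

Local Notation q := int_coord.

Lemma int_coordD x y : q (x + y) = q x + q y.
Proof. by rewrite /q !mxE; ring. Qed.
Lemma int_coordN x : q (- x) = - q x.
Proof. by rewrite /q !mxE; ring. Qed.
Lemma int_coordB x y : q (x - y) = q x - q y.
Proof. by rewrite int_coordD int_coordN. Qed.
Lemma int_coordZ a x : q (a *: x) = a * q x.
Proof. by rewrite /q !mxE; ring. Qed.
Lemma int_coord0 : q 0 = 0.
Proof. by rewrite /q !mxE; ring. Qed.
Lemma int_coord_slope : q v = 0.
Proof. by rewrite /q !mxE /=; ring. Qed.
Lemma int_coord_internal k : q (internal_vec k) = 1.
Proof. by rewrite /q !mxE /=; ring. Qed.

Lemma phys_coordD k x y : phys_coord k (x + y) = phys_coord k x + phys_coord k y.
Proof. by rewrite /phys_coord /q !mxE; ring. Qed.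
Lemma phys_coordN k x : phys_coord k (- x) = - phys_coord k x.
Proof. by rewrite /phys_coord /q !mxE; ring. Qed.
Lemma phys_coordB k x y : phys_coord k (x - y) = phys_coord k x - phys_coord k y.
Proof. by rewrite phys_coordD phys_coordN. Qed.
Lemma phys_coordZ k a x : phys_coord k (a *: x) = a * phys_coord k x.
Proof. by rewrite /phys_coord /q !mxE; ring. Qed.
Lemma phys_coord_slope k : phys_coord k v = 1.
Proof. by rewrite /phys_coord /q !mxE /=; ring. Qed.
Lemma phys_coord_internal k : phys_coord k (internal_vec k) = 0.
Proof. by rewrite /phys_coord /q !mxE /=; ring. Qed.

Lemma coord_decomp k x : x = phys_coord k x *: v + q x *: internal_vec k.
Proof. by apply: row2P; rewrite /phys_coord /q !mxE /=; ring. Qed.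

Lemma slope_vector_neq0 : v != 0.
Proof. by apply/eqP => /rowP/(_ 0); rewrite !mxE /= => /eqP; rewrite oner_eq0. Qed.

Lemma int_coord_le x : `|q x| <= (1 + `|alpha|) * `|x|.
Proof.
rewrite /q; apply: (le_trans (ler_normB _ _)); rewrite normrM mulrDl mul1r.
by rewrite lerD ?coord_le_norm // ler_wpM2l // coord_le_norm.
Qed.

Section Line.
Variable k : R.
Local Notation w := (internal_vec k).
Local Notation p := (phys_coord k).
Local Notation Ei := (<[internal_vec k]>%VS).

Lemma slope_internal_cap : (Ev :&: Ei)%VS = 0%VS.
Proof.
apply/eqP; rewrite -subv0; apply/subvP => x; rewrite memv_cap memv0.
case/andP => /vlineP[a ->] /vlineP[b /(congr1 p)].
rewrite !phys_coordZ phys_coord_slope phys_coord_internal mulr0 mulr1 => ->.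
by rewrite scale0r.
Qed.

Lemma slope_internal_add : (Ev + Ei)%VS = fullv.
Proof.
apply/eqP; rewrite eqEsubv subvf /=; apply/subvP => x _.
by rewrite (coord_decomp k x) memv_add // memvZ // memv_line.
Qed.

Lemma prvpriE x : prv Ev Ei x = p x *: v /\ pri Ev Ei x = q x *: w.
Proof.
have e : prv Ev Ei x + pri Ev Ei x = x.
  by apply: daddv_pi_add; rewrite ?slope_internal_cap ?slope_internal_add ?memvf.
have /vlineP[a ea] : prv Ev Ei x \in Ev by exact: memv_pi.
have /vlineP[b eb] : pri Ev Ei x \in Ei by exact: memv_pi.
rewrite -[in p x]e -[in q x]e ea eb phys_coordD int_coordD !phys_coordZ !int_coordZ.
rewrite phys_coord_slope phys_coord_internal int_coord_slope int_coord_internal.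
by rewrite !mulr0 !mulr1 addr0 add0r.
Qed.

Lemma prvE x : prv Ev Ei x = p x *: v. Proof. by case: (prvpriE x). Qed.
Lemma priE x : pri Ev Ei x = q x *: w. Proof. by case: (prvpriE x). Qed.

Lemma internal_vec_neq0 : w != 0.
Proof.
apply/eqP => /(congr1 q); rewrite int_coord_internal int_coord0 => /eqP.
by rewrite oner_eq0.
Qed.

Lemma mem_internal_line x : x \in Ei -> x = q x *: w.
Proof. by case/vlineP => c ->; rewrite int_coordZ int_coord_internal mulr1. Qed.

End Line.

(** [int_coord] vanishes on the physical line, so the internal projection of [(0, 1)] still has
    internal coordinate 1; it is the required [internal_vec]. *)
Lemma complement_internal_line (Ei : {vspace V}) :
  (Ev :&: Ei)%VS = 0%VS -> (Ev + Ei)%VS = fullv ->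
  exists k, Ei = <[internal_vec k]>%VS.
Proof.
move=> cap0 addf.
have priv : pri Ev Ei v = 0.
  have := @daddv_pi_add _ _ Ev Ei v cap0; rewrite addf memvf => /(_ isT).
  rewrite daddv_pi_id ?memv_line // => /eqP; rewrite -subr_eq0 addrAC subrr add0r.
  by move/eqP.
pose e1 : V := \row_j (if j == 0 then 0 else 1).
pose w := pri Ev Ei e1.
have wE : w \in Ei by exact: memv_pi.
have priE' x : pri Ev Ei x = q x *: w.
  have -> : x = x 0 0 *: v + q x *: e1.
    by apply: row2P; rewrite /q !mxE /=; ring.
  rewrite /pri linearD !linearZ /= -!/(pri _ _ _) priv scaler0 add0r.
  by rewrite int_coordD !int_coordZ int_coord_slope mulr0 add0r /w /q !mxE /=;
     congr (_ *: _); ring.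
have w0 : w != 0.
  apply/eqP => w0; have := @daddv_pi_add _ _ Ev Ei e1 cap0.
  rewrite addf memvf => /(_ isT); rewrite -/(pri Ev Ei e1) -/w w0 addr0 => h.
  have : e1 \in Ev by rewrite -h memv_pi.
  case/vlineP => c /rowP hc; have := hc 0; have := hc 1; rewrite !mxE /= mulr1.
  by move=> h1 h0; move: h1; rewrite -h0 mul0r => /eqP; rewrite oner_eq0.
have qw : q w = 1.
  have : pri Ev Ei w = w by apply: daddv_pi_id; rewrite // capvC.
  rewrite priE' -[RHS]scale1r => /eqP; rewrite -subr_eq0 -scalerBl scaler_eq0.
  by rewrite (negPf w0) orbF subr_eq0 => /eqP.
exists (w 0 0).
have -> : internal_vec (w 0 0) = w.
  by apply: row2P; rewrite !mxE //=; rewrite -qw /q; ring.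
apply/eqP; rewrite eqEsubv; apply/andP; split; apply/subvP => x.
  move=> xE; have : pri Ev Ei x = x by apply: daddv_pi_id; rewrite // capvC.
  by rewrite priE' => <-; rewrite memvZ // memv_line.
by case/vlineP => c ->; rewrite memvZ.
Qed.

Section Subspace.
Variable k : R.
Local Notation w := (internal_vec k).
Local Notation Ei := (<[internal_vec k]>%VS).

Definition line_trace (A : set V) : set R := [set r | A (r *: w)].

(** The map [r |-> r *: w] is a homeomorphism onto the internal line, with [int_coord] as Lipschitz
    inverse. Interiors, closures and boundaries of windows thereby become those of subsets of
    [R]. *)
Lemma nbhs_internal_line (r : R) (A : set V) :
  nbhs (r *: w : subspace [set` Ei]) A <-> nbhs r (line_trace A).
Proof.
have rE : [set` Ei] (r *: w) by rewrite /= memvZ // memv_line.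
have -> : nbhs (r *: w : subspace [set` Ei]) = within [set` Ei] (nbhs (r *: w)).
  exact: esym (nbhs_subspace_in rE).
split.
  rewrite /within /= => h.
  have c : {for r, continuous (fun t : R => t *: w)}.
    by apply: continuousZl; exact: cvg_id.
  have h' : nbhs r (fun t : R => [set` Ei] (t *: w) -> A (t *: w)) := c _ h.
  apply: filterS h' => t; apply.
  by rewrite /= memvZ // memv_line.
move=> /nbhs_ballP[e /= e0 He].
pose d := e / (1 + `|alpha|).
have a0 : 0 < 1 + `|alpha| by rewrite ltr_wpDr.
have d0 : 0 < d by rewrite divr_gt0.
apply/nbhs_ballP; exists d => //= y; rewrite -ball_normE /= => yd yE.
rewrite (mem_internal_line yE); apply: He; rewrite -ball_normE /=.
have -> : r - q y = q (r *: w - y).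
  by rewrite int_coordB int_coordZ int_coord_internal mulr1.
apply: le_lt_trans (int_coord_le _) _.
by rewrite mulrC -ltr_pdivlMr.
Qed.

Lemma int_interiorE A r :
  int_interior Ei A (r *: w) <-> (interior (line_trace A)) r.
Proof. exact: nbhs_internal_line. Qed.

Lemma int_closureE A r :
  int_closure Ei A (r *: w) <-> closure (line_trace A) r.
Proof.
split=> cl B nB.
  have /cl[x [Ax Bx]] : nbhs (r *: w : subspace [set` Ei])
      [set y | y \in Ei /\ B (q y)].
    apply/nbhs_internal_line; apply: filterS nB => t Bt.
    by split; rewrite ?memvZ ?memv_line // int_coordZ int_coord_internal mulr1.
  case: Bx => xE Bx; exists (q x); split=> //.
  by rewrite /line_trace /= -(mem_internal_line xE).
have /cl[t [At Bt]] := (nbhs_internal_line r B).1 nB.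
by exists (t *: w).
Qed.

(** The topology of [subspace] is discrete off the given set. *)
Lemma int_closure_out A x : x \notin Ei -> int_closure Ei A x -> A x.
Proof.
move=> xE /(_ [set x]) []; last first.
  by move=> y [Ay yx]; rewrite -yx.
have -> : nbhs (x : subspace [set` Ei]) = globally [set x].
  by apply: esym; apply: (nbhs_subspace_out (A := [set` Ei])); apply/negP.
by move=> y ->.
Qed.

End Subspace.
End Coordinates.

(** * Local derivability and return vectors *)

Section PatternTheory.
Variables (R : realType) (n : nat) (E : {vspace 'rV[R]_n}).
Local Notation V := 'rV[R]_n.

Definition agree l (P Q : pattern R n l) (x y : V) (r : R) : Prop :=
  forall i z, `|z| <= r -> P i (x + z) <-> Q i (y + z).

Lemma patternP l (P Q : pattern R n l) :
  (forall i z, P i z <-> Q i z) -> P = Q.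
Proof. by move=> h; apply/funext => i; apply/seteqP; split=> z /h. Qed.

Lemma translateE l (P : pattern R n l) t i z : translate P t i z <-> P i (z - t).
Proof.
split=> [[y Py <-]|h]; first by rewrite addrK.
by exists (z - t); rewrite ?subrK.
Qed.

Lemma ball_patchP l (P Q : pattern R n l) x y r :
  ball_patch P x r = ball_patch Q y r <-> agree P Q x y r.
Proof.
have bE (P' : pattern R n l) x' i z :
    ball_patch P' x' r i z <-> P' i (x' + z) /\ `|z| <= r.
  rewrite /ball_patch translateE opprK /setI /closed_ball_ /= addrC.
  by rewrite opprD addNKr normrN.
split=> [h i z zr|h].
  by split=> Pz; [have /bE[] : ball_patch Q y r i z; [rewrite -h; apply/bE|]
     |have /bE[] : ball_patch P x r i z; [rewrite h; apply/bE|]].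
apply: patternP => i z; rewrite !bE.
by split=> -[Pz zr]; split=> //; apply/(h i z zr).
Qed.

Lemma ldP l m (P : pattern R n l) (Q : pattern R n m) :
  ld E P Q <-> exists2 c, 0 <= c &
   forall x y, x \in E -> y \in E -> agree P P x y c -> forall i, Q i x <-> Q i y.
Proof.
split=> [[c [c0 h]]|[c c0 h]].
  exists c => // x y xE yE /ball_patchP /(h _ _ xE yE) /ball_patchP ag i.
  by have := ag i 0; rewrite normr0 lexx !addr0; apply.
exists c; split=> // x y xE yE /ball_patchP /(h _ _ xE yE) ag.
apply/ball_patchP => i z; rewrite normr_le0 => /eqP ->; rewrite !addr0.
exact: ag.
Qed.

Lemma bounded_setP (U : set V) :
  bounded_set U -> exists2 K, 0 <= K & forall z, U z -> `|z| <= K.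
Proof.
case=> M [_ h]; exists (`|M| + 1); first by rewrite addr_ge0.
by move=> z Uz; apply: (h (`|M| + 1)) => //; rewrite ltr_pwDr // ler_norm.
Qed.

Lemma liP l (P Q : pattern R n l) :
  li E P Q <-> forall K, exists2 t, t \in E &
    forall i z, `|z| <= K -> P i z <-> Q i (z + t).
Proof.
split=> [h K|h U /bounded_setP[K _ UK]].
  have [|t tE e] := h [set z | `|z| <= K].
    by exists K; split; [exact: num_real|move=> M KM z zK; apply: le_trans zK (ltW KM)].
  exists t => // i z zK; split=> H.
    have : translate (fun i => P i `&` [set z | `|z| <= K]) t i (z + t).
      by apply/translateE; rewrite addrK.
    by rewrite e => -[].
  have : (Q i `&` [set u + t | u in [set z | `|z| <= K]]) (z + t).
    by split=> //; exists z.
  by move/(congr1 (fun P => P i (z + t))): e => <- /translateE; rewrite addrK => -[].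
have [t tE e] := h K; exists t => //; apply: patternP => i z.
rewrite translateE; split=> [[Pz Uz]|[Qz [u Uu uz]]].
  split; last by exists (z - t); rewrite ?subrK.
  by have := (e i _ (UK _ Uz)).1 Pz; rewrite subrK.
by rewrite -uz addrK; split=> //; apply/(e i u (UK _ Uu)); rewrite uz.
Qed.

Lemma li_refl l (P : pattern R n l) : li E P P.
Proof. by apply/liP => K; exists 0; rewrite ?mem0v // => i z _; rewrite addr0. Qed.

Definition supported l (P : pattern R n l) := forall i x, P i x -> x \in E.

Lemma supported_li l (P Q : pattern R n l) :
  li E P Q -> supported Q -> supported P.
Proof.
move=> /liP h sQ i x Px; have [t tE /(_ i x (lexx _)) e] := h `|x|.
by rewrite -[x](addrK t) memvB // (sQ i) //; apply/e.
Qed.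

Definition return_vector l (P : pattern R n l) (r : R) (g : V) : Prop :=
  exists2 x, x \in E & agree P P x (x + g) r.

Lemma return_vector_li l (P Q : pattern R n l) r g :
  li E P Q -> return_vector P r g -> return_vector Q r g.
Proof.
move=> /liP h [x xE ag]; have [t tE ht] := h (`|x| + `|g| + `|r|).
exists (x + t); first by rewrite memvD.
move=> i z zr; have zr' := le_trans zr (ler_norm _).
have e (y : V) : `|y| <= `|x| + `|g| -> P i (y + z) <-> Q i (y + t + z).
  move=> yx; rewrite addrAC; apply: ht; apply: (le_trans (ler_normD _ _)).
  by rewrite lerD.
have e1 := e x _; rewrite lerDl normr_ge0 in e1.
have e2 := e (x + g) (ler_normD _ _).
by rewrite (addrAC x t g) -(e1 isT) -e2; apply: ag.
Qed.

Section Scaling.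
Variables (L : 'End(V)) (lam : R).
Hypotheses (LE : forall x, x \in E -> L x = lam *: x) (lam0 : lam != 0).

Lemma lin_imageE l (P : pattern R n l) : supported P -> forall i z,
  lin_image L P i z <-> P i (lam^-1 *: z).
Proof.
move=> sP i z; split=> [[y Py <-]|Pz].
  by rewrite LE ?(sP i) // scalerA mulVf // scale1r.
by exists (lam^-1 *: z) => //; rewrite LE ?(sP i) // scalerA mulfV // scale1r.
Qed.

(* A return of [P'] seen at scale [r] is a return of [L P'] seen at scale [|lam| r],
   hence of every pattern derived from [L P']. *)
Lemma return_vector_ld l m (P' : pattern R n l) (P : pattern R n m) :
  supported P' -> supported P -> ld E (lin_image L P') P ->
  exists2 c, 0 <= c & forall r g, g \in E -> return_vector P' r g ->
    return_vector P (`|lam| * r - c) (lam *: g).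
Proof.
move=> sP' sP /ldP[c c0 h]; exists c => // r g gE [x xE ag].
exists (lam *: x); first by rewrite memvZ.
move=> i z zr.
have [zE|zE] := boolP (z \in E); last first.
  split=> /sP H; exfalso.
    by move/negP: zE; apply; rewrite -[z](addKr (lam *: x)) memvD // memvN memvZ.
  move/negP: zE; apply; rewrite -[z](addKr (lam *: x + lam *: g)) memvD //.
  by rewrite memvN memvD // memvZ.
apply: h; rewrite ?memvD ?memvZ // => j u uc.
rewrite !lin_imageE // -!addrA !scalerDr !scalerA mulVf // !scale1r.
rewrite -!scalerDr [x + (g + _)]addrA.
apply: ag; rewrite normrZ normfV ler_pdivrMl ?normr_gt0 //.
by apply: (le_trans (ler_normD _ _)); lra.
Qed.

End Scaling.
End PatternTheory.

(** * Linear automorphisms of a line *)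

Section LineMaps.
Variables (R : realType) (n : nat) (E : {vspace 'rV[R]_n}) (L : 'End('rV[R]_n)).

Lemma lin_aut_line (v : 'rV[R]_n) : v != 0 -> E = <[v]>%VS -> lin_aut E L ->
  exists2 lam, lam != 0 & forall x, x \in E -> L x = lam *: x.
Proof.
move=> v0 -> LE.
have /vlineP[lam Lv] : L v \in <[v]>%VS by rewrite -LE memv_img ?memv_line.
exists lam; last by move=> x /vlineP[c ->]; rewrite linearZ /= Lv !scalerA mulrC.
apply: contraNneq v0 => lam0; have := memv_line v; rewrite -[in X in X -> _]LE.
by case/memv_imgP => _ /vlineP[c ->] ->; rewrite linearZ /= Lv lam0 scale0r scaler0.
Qed.

(** The matrix of the restriction is scalar, so [lam] is its only eigenvalue; the vector [v]
    supplies an eigenvector. *)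
Lemma expansive_scalar (lam : R) : (exists2 v, v \in E & v != 0) ->
  (forall x, x \in E -> L x = lam *: x) -> expansive E L <-> 1 < `|lam|.
Proof.
move=> [v vE v0] LE; rewrite /expansive /=.
set e := vbasis _.
have eb : basis_of {: subvs_of E} e by exact: vbasisP.
have -> : restr_end E L = lam *: \1%VF.
  have -> : restr_end E L = linfun ( *:%R lam : subvs_of E -> subvs_of E).
    congr linfun; apply/funext => u; rewrite LE ?subvsP // linearZ /=.
    by rewrite vsvalK.
  by apply/lfunP => u; rewrite lfunE /= scale_lfunE id_lfunE.
rewrite (GRing.scalable_linear (passmx.mxof_linear e e)).
rewrite /= passmx.mxof1 ?(basis_free eb) // scalemx1 map_scalar_mx.
set c : R[i] := real_complex R lam.
have nc : (1 < `|c|) = (1 < `|lam|).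
  rewrite normc_def /= expr0n addr0 sqrtr_sqr.
  by rewrite -[1 in LHS]/(real_complex R 1) ltcR.
split=> [H|l1 z /eigenvalueP[u]].
  rewrite -nc; apply: H; apply/eigenvalueP.
  exists (map_mx (real_complex R) (passmx.rVof e (vsproj E v))).
    by rewrite mul_mx_scalar.
  rewrite map_mx_eq0 passmx.rVof_eq0 //; apply: contraNneq v0 => h.
  by rewrite -(vsprojK vE) h linear0.
rewrite mul_mx_scalar => /eqP; rewrite -subr_eq0 -scalerBl scaler_eq0 subr_eq0.
by move=> /orP[/eqP <- _|/eqP -> /eqP//]; rewrite nc.
Qed.

End LineMaps.

Section SlopeLineMaps.
Variables (R : realType) (alpha : R).
Local Notation Ev := (slope_line alpha).

Lemma slope_line_aut (L : 'End('rV[R]_2)) : lin_aut Ev L -> expansive Ev L ->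
  exists2 lam, 1 < `|lam| & forall x, x \in Ev -> L x = lam *: x.
Proof.
move=> Laut Lexp.
have [lam _ LE] := lin_aut_line (slope_vector_neq0 alpha) erefl Laut.
exists lam => //; apply/(expansive_scalar _ LE) => //.
by exists (slope_vector alpha); rewrite ?memv_line ?slope_vector_neq0.
Qed.

Lemma slope_line_scaling (lam : R) : 1 < `|lam| ->
  exists L : 'End('rV[R]_2), [/\ lin_aut Ev L, expansive Ev L &
    forall x, x \in Ev -> L x = lam *: x].
Proof.
move=> lam1; have lam0 : lam != 0 by rewrite -normr_gt0 (lt_trans ltr01).
exists (lam *: \1%VF); have LE x : (lam *: \1%VF : 'End('rV[R]_2)) x = lam *: x.
  by rewrite scale_lfunE id_lfunE.
split=> //.
  rewrite /lin_aut limg_line LE; apply/eqP; rewrite eqEsubv -!memvE.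
  rewrite memvZ ?memv_line //=; apply/vlineP; exists lam^-1.
  by rewrite scalerA mulVf // scale1r.
apply/(expansive_scalar _ (fun x _ => LE x)) => //.
by exists (slope_vector alpha); rewrite ?memv_line ?slope_vector_neq0.
Qed.

End SlopeLineMaps.

(** * Lattice points in strips along the physical line *)

Section LatticeCoordinates.
Variables (R : realType) (alpha k : R).
Hypothesis alpha_irr : irrational alpha.
Local Notation V := 'rV[R]_2.
Local Notation Gamma := (@int_lattice R 2).
Local Notation v := (slope_vector alpha).
Local Notation w := (internal_vec alpha k).
Local Notation q := (int_coord alpha).
Local Notation p := (phys_coord alpha k).

Lemma int_coord_lattice_eq0 g : Gamma g -> q g = 0 -> g = 0.
Proof.
case/lattice_vecP => a [b ->].
have [[-> ->]|ab] := eqVneq (b, a) (0, 0).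
  by move=> _; apply: row2P; rewrite !mxE.
rewrite /int_coord !mxE /= mulrC => /eqP h.
by have := irrational_comb_neq0 alpha_irr ab; rewrite h.
Qed.

Lemma int_coord_dense (a b : R) : a < b ->
  exists2 g, Gamma g & a < q g < b.
Proof.
move=> /(dense_comb alpha_irr)[x [y xy]].
exists (lattice_vec R y x); first by apply/lattice_vecP; exists y, x.
by rewrite /int_coord !mxE /= mulrC.
Qed.

Lemma norm_le_coords x : `|x| <= `|p x| * `|v| + `|q x| * `|w|.
Proof.
by rewrite {1}(coord_decomp alpha k x) (le_trans (ler_normD _ _)) // !normrZ.
Qed.

Lemma finite_lattice_strip (A B : R) : exists s : seq V,
  forall g, Gamma g -> `|p g| <= A -> `|q g| <= B -> g \in s.
Proof.
have [s hs] := finite_lattice_ball (A * `|v| + B * `|w|).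
exists s => g Gg gA gB; apply: hs => //; apply: le_trans (norm_le_coords _) _.
by rewrite lerD // ler_wpM2r.
Qed.

Lemma phys_coord_le x : `|p x| <= (1 + `|k| * (1 + `|alpha|)) * `|x|.
Proof.
rewrite /phys_coord (le_trans (ler_normB _ _)) // mulrDl mul1r lerD //.
  exact: coord_le_norm.
by rewrite normrM -mulrA ler_wpM2l // int_coord_le.
Qed.

(** The point [t *: v] is rounded to a lattice point, whose internal coordinate is bounded
    independently of [t]; adding a bounded multiple of a fixed [e] with [0 < q e < b - a] then
    brings that coordinate into the interval. *)
Lemma strip_relatively_dense (a b : R) : a < b -> exists rho : R,
  forall t, exists g, [/\ Gamma g, a < q g < b & `|p g - t| <= rho].
Proof.
move=> ab; have ba0 : 0 < b - a by rewrite subr_gt0.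
have [e Ge /andP[e0 eb]] := int_coord_dense ba0.
pose C := 1 + `|alpha|; pose C' := 1 + `|k| * C.
exists (C' + ((`|a| + C) / q e + 1) * `|p e|) => t.
pose g := lattice_vec R (Num.floor t) (Num.floor (t * alpha)).
have Gg : Gamma g by apply/lattice_vecP; eexists; eexists.
have fl (x : R) : `|(Num.floor x)%:~R - x| <= 1.
  have /andP[h1 h2] := floor_itv x; move: h2; rewrite intrD => h2.
  by rewrite ler_norml; apply/andP; split; lra.
have gt : `|g - t *: v| <= 1.
  by apply: norm_le_coord; rewrite !mxE /= ?mulr1; exact: fl.
have qg : `|q g| <= C.
  have -> : q g = q (g - t *: v).
    by rewrite int_coordB int_coordZ int_coord_slope mulr0 subr0.
  apply: le_trans (int_coord_le _ _) _.
  by rewrite -[leRHS]mulr1 ler_wpM2l // addr_ge0.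
have pg : `|p g - t| <= C'.
  have -> : p g - t = p (g - t *: v).
    by rewrite phys_coordB phys_coordZ phys_coord_slope mulr1.
  apply: le_trans (phys_coord_le _) _.
  by rewrite -[leRHS]mulr1 ler_wpM2l // addr_ge0 // mulr_ge0 // addr_ge0.
pose y := (a - q g) / q e; pose j := Num.floor y + 1.
have /andP[j1 j2] := floor_itv y.
exists (g + j%:~R *: e); split; first exact/latticeD/latticeZ.
  rewrite int_coordD int_coordZ -ltrBlDl -ltr_pdivrMr // j2 /=.
  rewrite /j intrD mulrDl mul1r.
  have : (Num.floor y)%:~R * q e <= a - q g by rewrite -ler_pdivlMr.
  by lra.
rewrite phys_coordD phys_coordZ addrAC (le_trans (ler_normD _ _)) // lerD //.
rewrite normrM ler_wpM2r //.
have jy : `|j%:~R| <= `|y| + 1.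
  have jE : j%:~R = (Num.floor y)%:~R + 1 :> R by rewrite intrD.
  have : y < j%:~R by [].
  rewrite jE; move: ((Num.floor y)%:~R) j1 => z zy yz.
  have := ler_norm y; have := ler_norm (- y); rewrite normrN => y1 y2.
  by rewrite ler_norml; apply/andP; split; lra.
apply: (le_trans jy); rewrite lerD2r /y normrM normfV (gtr0_norm e0).
rewrite ler_pM2r ?invr_gt0 // (le_trans (ler_normB _ _)) // lerD2l //.
Qed.

End LatticeCoordinates.

Lemma exprn_unbounded (R : realType) (x C : R) : 1 < x -> exists n, C < x ^+ n.
Proof.
move=> x1; have h0 : 0 < x - 1 by rewrite subr_gt0.
have bern n : 1 + n%:R * (x - 1) <= x ^+ n.
  elim: n => [|n IH]; first by rewrite mul0r addr0 expr0.
  rewrite exprS; apply: le_trans (_ : x * (1 + n%:R * (x - 1)) <= _).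
    rewrite -natr1; have : 0 <= n%:R * (x - 1) * (x - 1).
      by rewrite !mulr_ge0 // ltW.
    by lra.
  by rewrite ler_wpM2l // ltW // (lt_trans ltr01).
pose n := (Num.truncn (`|C| / (x - 1))).+1; exists n.
apply: lt_le_trans (bern n); apply: le_lt_trans (ler_norm C) _.
rewrite ltr_pwDl // -ler_pdivrMr // ltW //.
by have /andP[] := truncn_itv (divr_ge0 (normr_ge0 C) (ltW h0)).
Qed.

(* If returns stay returns under scaling by [lam], the scaling comes from an
   integral matrix; it preserves the physical line since small internal
   coordinates have bounded images, and it does not expand the internal line since
   iterating a return keeps the internal coordinate bounded. *)
Section ReturnModule.
Variables (R : realType) (alpha k lam delta C : R) (T : set R).
Hypothesis alpha_irr : irrational alpha.
Local Notation V := 'rV[R]_2.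
Local Notation Gamma := (@int_lattice R 2).
Local Notation v := (slope_vector alpha).
Local Notation w := (internal_vec alpha k).
Local Notation q := (int_coord alpha).
Local Notation p := (phys_coord alpha k).
Hypothesis phys_inj : forall g, Gamma g -> p g = 0 -> g = 0.
Hypothesis delta0 : 0 < delta.
Hypothesis T_small : forall g, Gamma g -> `|q g| < delta -> T (p g).
Hypothesis T_bounded : forall t, T t -> exists g, [/\ Gamma g, t = p g & `|q g| <= C].
Hypothesis T_scaled : forall t, T t -> T (lam * t).

Lemma phys_coord_inj g h : Gamma g -> Gamma h -> p g = p h -> g = h.
Proof.
move=> Gg Gh e; apply/eqP; rewrite -subr_eq0; apply/eqP.
by apply: phys_inj; [exact: latticeB|rewrite phys_coordB e subrr].
Qed.

(** Independent lattice vectors [e], [f] with small internal coordinates are scaled to the physical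
    coordinates of lattice vectors [e'], [f']. The map sending [e], [f] to [e'], [f'] is rational,
    and by Cramer's rule the determinant [m] of [(e, f)] clears its denominators. *)
Lemma return_matrix_rows : exists (m : int) (B : 'M[R]_2), [/\ m != 0,
  forall i j, B i j \is a Num.int &
  forall x, p (x *m B) = m%:~R * lam * p x].
Proof.
have d0 : 0 < Num.min delta 1 by rewrite lt_min delta0 ltr01.
have [e Ge /andP[e0]] := int_coord_dense alpha_irr d0.
rewrite lt_min => /andP[ed e1].
have int01 (n : int) : 0 < n%:~R :> R -> n%:~R < 1 :> R -> False.
  by rewrite ltr0z (ltr_int R n 1); lia.
case/lattice_vecP: (Ge) => a0 [a1 eE].
have qe : q e = a1%:~R - alpha * a0%:~R by rewrite eE /int_coord !mxE.
have a00 : a0 != 0.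
  apply/eqP => a00; move: qe; rewrite a00 mulr0 subr0 => qe.
  by apply: (int01 a1); rewrite -qe.
have a00R : 0 < `|a0%:~R| :> R by rewrite normr_gt0 intr_eq0.
(* If [e] and [f] were dependent, then [q f * a0 = b0 * q e] with [|b0| >= 1], hence
   [q f >= q e / |a0|]; the last bound excludes this. *)
have d1 : 0 < Num.min delta (Num.min 1 (q e / `|a0%:~R|)).
  by rewrite !lt_min delta0 ltr01 divr_gt0.
have [f Gf /andP[f0]] := int_coord_dense alpha_irr d1.
rewrite !lt_min => /and3P[fd f1 fe].
case/lattice_vecP: (Gf) => b0 [b1 fE].
have qf : q f = b1%:~R - alpha * b0%:~R by rewrite fE /int_coord !mxE.
have m0 : a0 * b1 - a1 * b0 != 0.
  apply/eqP => /(congr1 (fun z : int => z%:~R : R)); rewrite intrB !intrM => m0.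
  have E : q f * a0%:~R = b0%:~R * q e by rewrite qf qe; lra.
  have b00 : b0 != 0.
    apply/eqP => b00; move: qf; rewrite b00 mulr0 subr0 => qf.
    by apply: (int01 b1); rewrite -qf.
  move: fe; rewrite ltr_pdivlMr // ltNge => /negP; apply.
  rewrite -[q f]gtr0_norm // -normrM E normrM (gtr0_norm e0).
  rewrite ler_peMl ?(ltW e0) // -intr_norm (ler_int R 1); move: b00; clear; lia.
have [e' [Ge' e'E _]] : exists g, [/\ Gamma g, lam * p e = p g & `|q g| <= C].
  by apply: T_bounded; apply: T_scaled; apply: T_small; rewrite ?gtr0_norm.
have [f' [Gf' f'E _]] : exists g, [/\ Gamma g, lam * p f = p g & `|q g| <= C].
  by apply: T_bounded; apply: T_scaled; apply: T_small; rewrite ?gtr0_norm.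
pose r0 := b1%:~R *: e' - a1%:~R *: f'; pose r1 := a0%:~R *: f' - b0%:~R *: e'.
have Gr0 : Gamma r0 by exact/latticeB/latticeZ/Gf'/latticeZ.
have Gr1 : Gamma r1 by exact/latticeB/latticeZ/Ge'/latticeZ.
exists (a0 * b1 - a1 * b0), (\matrix_(i, j) (if i == 0 then r0 0 j else r1 0 j)).
split=> // [i j|x]; first by rewrite mxE; case: eqP => _; [exact: Gr0|exact: Gr1].
have -> : x *m (\matrix_(i, j) (if i == 0 then r0 0 j else r1 0 j))
        = x 0 0 *: r0 + x 0 1 *: r1.
  apply/rowP => j; rewrite mxE big_ord_recl big_ord1 !mxE /=.
  by rewrite (_ : lift 0 0 = 1) //; apply: val_inj.
rewrite phys_coordD !phys_coordZ !phys_coordB !phys_coordZ -e'E -f'E intrB !intrM.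
by rewrite eE fE /phys_coord /int_coord !mxE /=; ring.
Qed.

Lemma return_matrix : exists (m : int) (B : 'M[R]_2) (mu : R), [/\ m != 0,
  forall i j, B i j \is a Num.int,
  forall x, p (x *m B) = m%:~R * lam * p x,
  forall x, q (x *m B) = m%:~R * mu * q x &
  `|mu| <= 1].
Proof.
have [m [B [m0 BZ pB]]] := return_matrix_rows.
have mR0 : m%:~R != 0 :> R by rewrite intr_eq0.
have mR : 0 < `|m%:~R : R| by rewrite normr_gt0.
pose A := q (w *m B); pose b := q (v *m B).
have qB x : q (x *m B) = A * q x + b * p x.
  rewrite {1}(coord_decomp alpha k x) mulmxDl int_coordD -!scalemxAl !int_coordZ.
  by rewrite /A /b; ring.
have small_image g : Gamma g -> `|m%:~R * q g| < delta -> `|q (g *m B)| <= C.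
  move=> Gg gd; have : T (p (m%:~R *: g)).
    by apply: T_small; rewrite ?int_coordZ //; apply: latticeZ.
  move=> /T_scaled/T_bounded[h [Gh hE hC]].
  rewrite (@phys_coord_inj (g *m B) h) //; first exact: latticeM.
  by rewrite -hE pB phys_coordZ; ring.
have v0 : 0 < `|v| by rewrite normr_gt0 slope_vector_neq0.
have w0 : 0 < `|w| by rewrite normr_gt0 internal_vec_neq0.
(* A lattice vector [g] with tiny internal coordinate has norm at least 1, so its physical
   coordinate is bounded below. The multiple [N g] still has small internal coordinate, and [N] is
   so large that its image would violate the bound [C] unless [b = 0]. *)
have b0 : b = 0.
  apply/eqP/negP => /negP b0; have b0' : 0 < `|b| by rewrite normr_gt0.
  pose N := (Num.truncn ((C + `|A| * delta / `|m%:~R|) * (2 * `|v|) / `|b|)).+1.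
  have C0 : 0 <= C.
    have := small_image 0 (@lattice0 _); rewrite int_coord0 mulr0 normr0 => /(_ delta0).
    exact: le_trans.
  have N0 : 0 < N%:R :> R by rewrite ltr0n.
  have h : 0 < Num.min (delta / (`|m%:~R| * N%:R)) (2 * `|w|)^-1.
    by rewrite lt_min invr_gt0 !(divr_gt0, mulr_gt0).
  have [g Gg /andP[g0]] := int_coord_dense alpha_irr h.
  rewrite lt_min => /andP[g1 g2].
  have gn0 : g != 0 by apply: contraTneq g0 => ->; rewrite int_coord0 ltxx.
  have pg : (2 * `|v|)^-1 <= `|p g|.
    have := le_trans (lattice_norm_ge1 Gg gn0) (norm_le_coords alpha k g).
    rewrite (gtr0_norm g0) => h1.
    have h2 : q g * `|w| <= 2^-1.
      by move: g2; rewrite invfM -ltr_pdivrMr ?invr_gt0 // invrK => /ltW.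
    by rewrite invfM ler_pdivrMr //; lra.
  have := small_image (N%:~R *: g) (latticeZ N Gg).
  rewrite int_coordZ qB int_coordZ phys_coordZ.
  have gN : `|m%:~R * (N%:~R * q g)| < delta.
    rewrite !normrM (gtr0_norm g0) (gtr0_norm (N0 : 0 < N%:~R :> R)).
    by move: g1; rewrite ltr_pdivlMr ?mulr_gt0 // mulrC -mulrA.
  move=> /(_ gN) h1.
  have h2 : N%:R * `|b| * (2 * `|v|)^-1 <= C + `|A| * delta / `|m%:~R|.
    apply: le_trans (_ : N%:R * `|b| * `|p g| <= _).
      by rewrite ler_wpM2l // mulr_ge0.
    have -> : N%:R * `|b| * `|p g| = `|b * (N%:~R * p g)|.
      by rewrite !normrM (gtr0_norm (N0 : 0 < N%:~R :> R)); ring.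
    have -> : b * (N%:~R * p g)
            = A * (N%:~R * q g) + b * (N%:~R * p g) - A * (N%:~R * q g) by ring.
    apply: (le_trans (ler_normB _ _)); rewrite lerD //.
    rewrite normrM -mulrA ler_wpM2l // ler_pdivlMr //.
    by rewrite mulrC -normrM ltW.
  have : N%:R <= (C + `|A| * delta / `|m%:~R|) * (2 * `|v|) / `|b|.
    by rewrite ler_pdivlMr // -ler_pdivrMr ?mulr_gt0.
  apply/negP; rewrite -ltNge.
  have h0 : 0 <= (C + `|A| * delta / `|m%:~R|) * (2 * `|v|) / `|b|.
    have d0 := ltW delta0.
    by rewrite !(divr_ge0, mulr_ge0, addr_ge0).
  by have /andP[] := truncn_itv h0.
have qBA x : q (x *m B) = A * q x by rewrite qB b0 mul0r addr0.
exists m, B, (A / m%:~R); split=> // [x|].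
  by rewrite qBA; field.
have [e Ge /andP[e0 ed]] := int_coord_dense alpha_irr delta0.
(* Each step divides by [m] inside the lattice: [g *m B = m h] for the lattice vector [h] that
   represents the scaled return, so internal coordinates are multiplied by [A / m]. *)
have iter n : exists g, [/\ Gamma g, T (p g), `|q g| <= C
    & q g = (A / m%:~R) ^+ n * q e].
  elim: n => [|n [g [Gg Tg gC gE]]].
    have Te : T (p e) by apply: T_small; rewrite ?gtr0_norm.
    have [g [Gg eg gC]] := T_bounded Te.
    by exists e; rewrite expr0 mul1r; split=> //; rewrite (phys_coord_inj Ge Gg eg).
  have Th := T_scaled Tg; have [h [Gh hE hC]] := T_bounded Th.
  exists h; rewrite -hE; split=> //.
  have e1 : g *m B = m%:~R *: h.
    apply: phys_coord_inj; [exact: latticeM|exact: latticeZ|].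
    by rewrite pB phys_coordZ -hE mulrA.
  have : m%:~R * q h = A * q g by rewrite -qBA e1 int_coordZ.
  by move=> /(canRL (mulKf mR0)) ->; rewrite gE exprS; field.
rewrite leNgt; apply/negP => /(exprn_unbounded (C / q e))[n].
rewrite ltr_pdivrMr // => h.
have [g [_ _ gC gE]] := iter n.
by move: gC; rewrite gE normrM normrX (gtr0_norm e0) leNgt h.
Qed.

End ReturnModule.

(** * Model patterns over nonsingular windows *)

Section LocallyConstant.
Variable R : realType.
Implicit Types B : set R.

Definition locally_constant B (r : R) : Prop :=
  exists2 e, 0 < e & forall t, `|t - r| < e -> B t <-> B r.

Lemma locally_constant_open B r : locally_constant B r ->
  exists2 e, 0 < e & forall t, `|t - r| < e -> locally_constant B t.
Proof.
move=> [e e0 h]; exists (e / 2); first by rewrite divr_gt0.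
move=> t tr; exists (e / 2); first by rewrite divr_gt0.
move=> u ut; rewrite (h t) ?(h u) //.
  have := ler_normD (u - t) (t - r); rewrite subrKA; lra.
by lra.
Qed.

(** This is the form in which lying off the boundary of the window is used. *)
Lemma locally_constantE B r :
  locally_constant B r <-> ~ (closure B r /\ ~ interior B r).
Proof.
split=> [[e e0 h] [cl int]|H].
  have nb : nbhs r [set t | `|t - r| < e].
    by apply/nbhs_ballP; exists e => //= t; rewrite -ball_normE /= distrC.
  have [t [Bt /h /iffLR/(_ Bt) Br]] := cl _ nb.
  by apply: int; apply: filterS nb => u /h ->.
have [int|int] := pselect (interior B r).
  have /nbhs_ballP[e /= e0 he] := int; exists e => // t tr.
  split=> _; apply: he; first exact: ballxx.
  by rewrite -ball_normE /= distrC.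
have ncl : ~ closure B r by move=> cl; apply: H.
have /existsNP[U /not_implyP[nU /forallNP UB]] := ncl.
have /nbhs_ballP[e /= e0 he] := nU; exists e => // t tr.
split=> Bt; exfalso; [apply: (UB t)|apply: (UB r)]; split=> //; apply: he.
  by rewrite -ball_normE /= distrC.
exact: ballxx.
Qed.

Lemma regular_closed_locally_constant_dense B : B = closure (interior B) ->
  forall a b, a < b -> exists2 t, a < t < b & locally_constant B t.
Proof.
move=> Breg a b ab; pose r := (a + b) / 2.
have rab : a < r < b by rewrite /r; apply/andP; split; lra.
have [Br|Br] := pselect (B r); last first.
  exists r => //; apply/locally_constantE => -[clB _]; apply: Br.
  by rewrite Breg; apply: closed_closure; rewrite -Breg.
have clB : closure (interior B) r by rewrite -Breg.
have [] := clB `]a, b[%classic.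
  by apply: near_in_itvoo; rewrite in_itv.
move=> t [tB]; rewrite /= in_itv /= => tab; exists t => //.
by apply/locally_constantE => -[_].
Qed.

End LocallyConstant.

Section NonsingularParameter.
Variables (R : realType) (T : countType) (B : T -> set R).
Hypothesis Breg : forall i, B i = closure (interior (B i)).

(** Baire's theorem: for each of countably many indices the good offsets form an open set, dense
    because the boundary of a regular closed set has empty interior. *)
Lemma nonsingular_parameter_exists (shift : T -> R) :
  exists om, forall i, locally_constant (B i) (shift i + om).
Proof.
pose F (n : nat) : set R^o := if unpickle n is Some i
  then [set om | locally_constant (B i) (shift i + om)] else setT.
have dF : dense (\bigcap_n F n).
  apply: (@Baire R R^o) => n; rewrite /F; case: unpickle => [i|]; last first.
    by split; [exact: openT|move=> U U0 _; rewrite setIT].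
  split.
    rewrite openE => om /= /locally_constant_open[e e0 he].
    apply/nbhs_ballP; exists e => //= t; rewrite -ball_normE /= => h.
    by apply: he; rewrite opprD addrACA subrr add0r distrC.
  move=> U [u Uu] openU.
  have /nbhs_ballP[e /= e0 he] : nbhs u U by apply: open_nbhs_nbhs.
  have ab : shift i + u - e < shift i + u + e by lra.
  have [t /andP[t1 t2] tc] := regular_closed_locally_constant_dense (Breg i) ab.
  exists (t - shift i); split; last by rewrite /= addrC subrK.
  by apply: he; rewrite -ball_normE /= ltr_norml; apply/andP; split; lra.
have [|om [_ h]] := dF setT _ openT; first by exists 0.
by exists om => i; have := h (pickle i) I; rewrite /F pickleK.
Qed.

End NonsingularParameter.

Section ModelPatterns.
Variables (R : realType) (alpha k : R).
Hypothesis alpha_irr : irrational alpha.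
Local Notation V := 'rV[R]_2.
Local Notation Gamma := (@int_lattice R 2).
Local Notation v := (slope_vector alpha).
Local Notation w := (internal_vec alpha k).
Local Notation q := (int_coord alpha).
Local Notation p := (phys_coord alpha k).
Local Notation Ev := (slope_line alpha).
Local Notation Ei := (<[internal_vec alpha k]>%VS).
Hypothesis phys_inj : forall g, Gamma g -> p g = 0 -> g = 0.

(** In coordinates this is the set attached to the point [a v + om w]. The [B i] are arbitrary
    subsets of the line, so that half-open windows are covered too. *)
Definition model l (B : 'I_l -> set R) (a om : R) : pattern R 2 l :=
  fun i => [set z | exists g, [/\ Gamma g, z = (a + p g) *: v & B i (q g + om)]].

Lemma slope_scale_inj (x y : R) : x *: v = y *: v -> x = y.
Proof.
by move/(congr1 (phys_coord alpha 0)); rewrite !phys_coordZ !phys_coord_slope !mulr1.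
Qed.

Lemma modelE l (B : 'I_l -> set R) a om i g :
  Gamma g -> model B a om i ((a + p g) *: v) <-> B i (q g + om).
Proof.
move=> Gg; split=> [[h [Gh /slope_scale_inj/addrI e Bh]]|Bg]; last by exists g.
by rewrite (phys_coord_inj phys_inj Gg Gh e).
Qed.

Lemma model_supported l (B : 'I_l -> set R) a om : supported Ev (model B a om).
Proof. by move=> i z [g [_ -> _]]; rewrite memvZ // memv_line. Qed.

(** Reindexing by [g]: the parameters [(a, om)] matter only modulo the lattice. *)
Lemma model_translate l (B : 'I_l -> set R) a om g i : Gamma g ->
  model B a (om + q g) i = model B (a - p g) om i.
Proof.
move=> Gg; apply/seteqP; split=> z [h [Gh -> Bh]].
  exists (h + g); split; [exact: latticeD|rewrite phys_coordD; congr (_ *: _); ring|].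
  by rewrite int_coordD addrAC -addrA.
exists (h - g); split; [exact: latticeB|rewrite phys_coordB; congr (_ *: _); ring|].
by rewrite int_coordB addrACA addNr addr0.
Qed.

Section Bounded.
Variables (l : nat) (B : 'I_l -> set R) (K : R).
Hypothesis BK : forall i r, B i r -> `|r| <= K.

(** Differences of points come from lattice vectors with internal coordinate at most [2 K]. Finitely
    many of these have small physical coordinate, and it vanishes only for the zero vector. *)
Lemma model_discrete a om : exists r : R, 0 < r /\
  forall x y, (\bigcup_i model B a om i) x -> (\bigcup_i model B a om i) y ->
    x != y -> r <= `|x - y|.
Proof.
have [s hs] := @finite_lattice_strip _ alpha k 1 (K + K).
have [|e e0 he] := @seq_uniform_eps R _ s
    (fun h t => h != 0 -> Gamma h -> t < `|p h|).
  move=> h _; have [/and3P[h0 _ _]|hn] := boolP [&& h != 0, `[< Gamma h >] & true];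
    last first.
    exists 1 => // t _ h0 /asboolP Gh; move: hn; rewrite h0 Gh //.
  have [/asboolP Gh|/asboolP nG] := boolP `[< Gamma h >]; last by exists 1.
  exists `|p h|; last by move=> t /andP[].
  rewrite normr_gt0; apply: contra_neq h0; exact: phys_inj.
have v0 : 0 < `|v| by rewrite normr_gt0 slope_vector_neq0.
pose d := Num.min (e / 2) 1.
have d0 : 0 < d by rewrite lt_min ltr01 divr_gt0.
exists (d * `|v|); split; first by rewrite mulr_gt0.
move=> x y [i _ [g [Gg xE Bg]]] [j _ [h [Gh yE Bh]]] xy.
have -> : x - y = p (g - h) *: v.
  by rewrite xE yE -scalerBl phys_coordB; congr (_ *: _); ring.
rewrite normrZ ler_wpM2r // leNgt; apply/negP => gh.
move: gh; rewrite lt_min => /andP[gh1 gh2].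
have gh0 : g - h != 0.
  by apply: contraNneq xy => /eqP; rewrite subr_eq0 => /eqP gh; rewrite xE yE gh.
have Ggh := latticeB Gg Gh.
have ghs : g - h \in s.
  apply: hs => //; first exact: ltW.
  have -> : q (g - h) = (q g + om) - (q h + om) by rewrite int_coordB; ring.
  by rewrite (le_trans (ler_normB _ _)) // lerD // ?(BK Bg) ?(BK Bh).
have e2 : 0 < e / 2 < e by lra.
by have := he _ ghs _ e2 gh0 Ggh; rewrite ltNge (ltW gh1).
Qed.

Lemma model_delone a om i c d : c < d -> (forall r, c < r < d -> B i r) ->
  delone Ev (model B a om).
Proof.
move=> cd Bcd; split; [exact: model_supported|exact: model_discrete|].
have cd' : c - om < d - om by lra.
have [rho hrho] := strip_relatively_dense k alpha_irr cd'.
exists (rho * `|v|) => x /vlineP[t ->].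
have [g [Gg qg pg]] := hrho (t - a).
exists ((a + p g) *: v).
  exists i => //; apply/(modelE B a om i Gg); apply: Bcd.
  by case/andP: qg => *; apply/andP; split; lra.
rewrite -scalerBl normrZ ler_wpM2r // distrC.
by have -> : a + p g - t = p g - (t - a) by ring.
Qed.

(** Beyond the covering radius [rho] every patch contains a point; the lattice vectors of this point
    and of its translate both project into the bounded window. *)
Lemma model_return_bounded a om i c d : c < d -> (forall r, c < r < d -> B i r) ->
  exists rho, forall r t, rho <= r -> return_vector Ev (model B a om) r (t *: v) ->
    exists g, [/\ Gamma g, t = p g & `|q g| <= K + K].
Proof.
move=> cd Bcd; have [_ _ [rho hrho]] := @model_delone a om i c d cd Bcd.
exists rho => r t rr [x xE ag].
have [y [j _ [g [Gg yE Bg]]] xy] := hrho x xE.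
have [|] := ag j (y - x) _; first by rewrite distrC (le_trans xy).
have x1 : x + (y - x) = y by rewrite addrC subrK.
rewrite addrAC x1 => /(_ (ex_intro _ g (And3 Gg yE Bg))) [h [Gh hE Bh]] _.
exists (h - g); split; first exact: latticeB.
  move: hE; rewrite yE -scalerDl => /slope_scale_inj hE; rewrite phys_coordB; lra.
have -> : q (h - g) = (q h + om) - (q g + om) by rewrite int_coordB; ring.
by rewrite (le_trans (ler_normB _ _)) // lerD // ?(BK Bg) ?(BK Bh).
Qed.

Section Nonsingular.
Variables (a om : R).
Hypothesis Bcst : forall i g, Gamma g -> locally_constant (B i) (q g + om).
Local Notation Q := (model B a om).

(** A ball involves finitely many lattice points near the window, and each stays on its side of the
    boundary under small internal shifts. The 1 in the width [K + 1 + |om|] leaves room for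
    [|q h| < 1]: beyond it, points are outside the window before and after the shift. *)
Lemma nonsingular_almost_period M : exists2 delta, 0 < delta &
  forall h, Gamma h -> `|q h| < delta -> forall i z, `|z| <= M ->
    Q i z <-> Q i (z + p h *: v).
Proof.
have v0 : 0 < `|v| by rewrite normr_gt0 slope_vector_neq0.
have [s hs] := @finite_lattice_strip _ alpha k (M / `|v| + `|a|) (K + 1 + `|om|).
have [|e e0 he] := @seq_uniform_eps R _ [seq (g, i) | g <- s, i <- enum 'I_l]
    (fun gi t => Gamma gi.1 -> forall u, `|u| <= t ->
       B gi.2 (q gi.1 + om + u) <-> B gi.2 (q gi.1 + om)).
  move=> [g i] _ /=; have [Gg|nG] := pselect (Gamma g); last by exists 1.
  have [e e0 he] := Bcst i Gg; exists e => // t /andP[_ te] _ u ut.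
  by apply: he; rewrite addrAC subrr add0r; apply: le_lt_trans te.
exists (Num.min (e / 2) 1); first by rewrite lt_min ltr01 divr_gt0.
move=> h Gh; rewrite lt_min => /andP[qe q1] i z zM.
have key g : Gamma g -> z = (a + p g) *: v -> Q i z <-> Q i (z + p h *: v).
  move=> Gg zE; rewrite zE -scalerDl -addrA -phys_coordD !modelE //; last first.
    exact: latticeD.
  rewrite int_coordD [q g + q h + om]addrAC.
  have [gK|gK] := lerP `|q g| (K + 1 + `|om|).
    have gs : g \in s.
      apply: hs => //; have -> : p g = (a + p g) - a by ring.
      rewrite (le_trans (ler_normB _ _)) // lerD2r ler_pdivlMr // -normrZ -zE //.
    have e2 : 0 < e / 2 < e by lra.
    have gis : (g, i) \in [seq (g, i) | g <- s, i <- enum 'I_l].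
      by apply: allpairs_f => //; rewrite mem_enum.
    by have /= -> := he _ gis _ e2 Gg (q h) (ltW qe).
  have far r : B i r -> `|r - q g| <= `|om| + 1 -> False.
    move=> /BK rK rg; have := ler_normB (r - q g) r.
    have -> : r - q g - r = - q g by ring.
    by rewrite normrN; lra.
  split=> Br; exfalso; apply: (far _ Br).
    by rewrite addrAC subrr add0r; lra.
  have -> : q g + om + q h - q g = om + q h by ring.
  by rewrite (le_trans (ler_normD _ _)) // lerD2l ltW.
split=> [Qz|Qz]; have [g [Gg zE Bg]] := Qz; first exact/(key g).
have zE' : z = (a + p (g - h)) *: v.
  rewrite phys_coordB addrA scalerBl -zE addrK //.
exact/(key (g - h) (latticeB Gg Gh) zE').
Qed.

(** Almost periods of [Q] are relatively dense, so each patch of [Q] recurs within bounded distance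
    of any place. A large ball of [P] is copied from [Q], hence contains that patch. *)
Lemma nonsingular_repetitive (P : pattern R 2 l) : li Ev P Q -> li Ev Q P.
Proof.
move=> /liP hP; apply/liP => M.
have [delta d0 hd] := nonsingular_almost_period M.
have dd : - delta < delta by lra.
have [rho hrho] := strip_relatively_dense k alpha_irr dd.
have [t tE ht] := hP (M + rho * `|v|).
have /vlineP[t0 t0E] := tE.
have [g [Gg qg pg]] := hrho t0.
exists (p g *: v - t); first by rewrite memvB // memvZ // memv_line.
move=> i z zM; rewrite (hd g) ?ltr_norml // ht ?subrKA.
  by rewrite addrA subrK.
apply: (le_trans (ler_normD _ _)); rewrite lerD //.
by rewrite t0E -scalerBl normrZ ler_wpM2r.
Qed.

Lemma nonsingular_return M : exists2 delta, 0 < delta &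
  forall h, Gamma h -> `|q h| < delta -> return_vector Ev Q M (p h *: v).
Proof.
have [delta d0 hd] := nonsingular_almost_period M; exists delta => // h Gh qh.
exists 0; first exact: mem0v.
by move=> i z zM; rewrite !add0r addrC; apply: hd.
Qed.

Lemma scaling_matrix (P P' : pattern R 2 l) (L : 'End(V)) (lam : R) i c d :
  c < d -> (forall r, c < r < d -> B i r) ->
  (forall x, x \in Ev -> L x = lam *: x) -> 1 < `|lam| ->
  li Ev P Q -> li Ev P' Q -> ld Ev (lin_image L P') P ->
  exists (m : int) (M : 'M[R]_2) (mu : R), [/\ m != 0,
    forall i j, M i j \is a Num.int,
    forall x, p (x *m M) = m%:~R * lam * p x,
    forall x, q (x *m M) = m%:~R * mu * q x &
    `|mu| <= 1].
Proof.
move=> cd Bcd LE lam1 PQ PQ' der.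
have lam0 : lam != 0 by rewrite -normr_gt0 (lt_trans ltr01).
have sP := supported_li PQ (@model_supported _ _ _ _).
have sP' := supported_li PQ' (@model_supported _ _ _ _).
have [c0 c00 hder] := return_vector_ld LE lam0 sP' sP der.
have [rho hrho] := model_return_bounded a om cd Bcd.
(* This radius satisfies [|lam| r - c0 >= r]: expansion makes up for the derivation radius, so
   returns of radius [r] are stable under [lam]. *)
pose r := Num.max rho (c0 / (`|lam| - 1)).
have rr : r <= `|lam| * r - c0.
  have : c0 / (`|lam| - 1) <= r by rewrite le_max lexx orbT.
  by rewrite ler_pdivrMr ?subr_gt0 //; lra.
have [delta d0 hd] := nonsingular_return r.
apply: (@return_matrix _ _ _ _ delta (K + K) [set t | return_vector Ev Q r (t *: v)])
  => //.
  by move=> t /=; apply: hrho; rewrite le_max lexx.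
move=> t /= /(return_vector_li (nonsingular_repetitive PQ')) rt.
have := hder _ _ _ rt; rewrite memvZ ?memv_line // => /(_ isT).
move=> /(return_vector_li PQ) [x xE ag]; exists x => //; rewrite -scalerA.
by move=> j z zr; apply: ag; apply: le_trans rr.
Qed.

End Nonsingular.
End Bounded.
End ModelPatterns.

(** * Cut and project sets as models *)

Section CutAndProjectModels.
Variables (R : realType) (alpha k : R).
Local Notation V := 'rV[R]_2.
Local Notation Gamma := (@int_lattice R 2).
Local Notation v := (slope_vector alpha).
Local Notation w := (internal_vec alpha k).
Local Notation q := (int_coord alpha).
Local Notation p := (phys_coord alpha k).
Local Notation Ev := (slope_line alpha).
Local Notation Ei := (<[internal_vec alpha k]>%VS).

Definition window_trace l (W : 'I_l -> set V) (i : 'I_l) : set R :=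
  line_trace alpha k (W i).

Definition nonsingular_shift l (W : 'I_l -> set V) (om : R) : Prop :=
  forall i g, Gamma g -> locally_constant (window_trace W i) (q g + om).

Section Window.
Variables (l : nat) (W : 'I_l -> set V).
Hypothesis winW : window Ei W.
Local Notation B := (window_trace W).

Lemma window_trace_regular i : B i = closure (interior (B i)).
Proof.
have [/(_ i)[_ _ We] _] := winW.
apply/seteqP; split=> r.
  rewrite /window_trace /line_trace /= {1}We => /int_closureE cl U nU.
  by have [t [/int_interiorE]] := cl U nU; exists t.
move=> cl; rewrite /window_trace /line_trace /= We; apply/int_closureE => U nU.
by have [t [it Ut]] := cl U nU; exists t; split=> //; apply/int_interiorE.
Qed.

Lemma window_trace_bounded : exists K, forall i r, B i r -> `|r| <= K.
Proof.
have [H _] := winW.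
have b i : exists K, forall r, B i r -> `|r| <= K.
  have [_ /compact_bounded/bounded_setP[K _ hK] _] := H i.
  exists ((1 + `|alpha|) * K) => r Br.
  have -> : r = q (r *: w) by rewrite int_coordZ int_coord_internal mulr1.
  apply: le_trans (int_coord_le _ _) _; rewrite ler_wpM2l ?addr_ge0 //.
  exact: hK.
have [f hf] := choice b.
exists (\sum_i `|f i|) => i r Br; apply: (le_trans (hf i r Br)).
rewrite (bigD1 i) //= (le_trans (ler_norm _)) // lerDl.
by apply: sumr_ge0.
Qed.

Lemma window_trace_interval : exists i c d, c < d /\ forall r, c < r < d -> B i r.
Proof.
have [H [i [x Wx]]] := winW; exists i.
have [WE _ We] := H i.
have xE := mem_internal_line (WE _ Wx).
have Bx : B i (q x) by rewrite /window_trace /line_trace /= -xE.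
have clB : closure (interior (B i)) (q x) by rewrite -window_trace_regular.
have [] := clB setT; first exact: filterT.
move=> r [/nbhs_ballP[e /= e0 he] _].
exists (r - e), (r + e); split; first by lra.
move=> t /andP[t1 t2]; apply: he; rewrite -ball_normE /= ltr_norml.
by apply/andP; split; lra.
Qed.

End Window.

Lemma translate_trace l (W : 'I_l -> set V) s i r : s \in Ei ->
  translate W s i (r *: w) <-> window_trace W i (r - q s).
Proof.
by move=> sE; rewrite translateE {1}(mem_internal_line sE) -scalerBl.
Qed.

Lemma locally_constant_shift (B C : set R) (r u : R) :
  (forall t, B t <-> C (t - u)) -> locally_constant B r <-> locally_constant C (r - u).
Proof.
move=> BC; split=> -[e e0 h]; exists e => // t tr.
  have -> : t = t + u - u by ring.
  rewrite -!BC; apply: h; move: tr; congr (`|_| < _); ring.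
by rewrite !BC; apply: h; move: tr; congr (`|_| < _); ring.
Qed.

Lemma nonsingular_windowE l (W : 'I_l -> set V) s : s \in Ei ->
  nonsingular_window Ev Ei (translate W s) <-> nonsingular_shift W (- q s).
Proof.
move=> sE.
have lcE i g : locally_constant (line_trace alpha k (translate W s i)) (q g)
    <-> locally_constant (window_trace W i) (q g - q s).
  by apply: locally_constant_shift => t; apply: translate_trace.
split=> h i.
  move=> g Gg; apply/lcE; apply/locally_constantE => -[cl int].
  have : (pri Ev Ei @` Gamma `&` int_boundary Ei (translate W s i)) (q g *: w).
    split; first by exists g; rewrite ?priE.
    by split; [exact/int_closureE|move/int_interiorE].
  by rewrite h.
apply/seteqP; split=> // _ [[g Gg <-]]; rewrite priE => -[cl int].
have /lcE/locally_constantE := h i g Gg; apply.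
by split; [exact/int_closureE|move=> /int_interiorE].
Qed.

Lemma cp_setE l (W : 'I_l -> set V) s : s \in Ei ->
  cp_set Ev Ei (translate W s) = model alpha k (window_trace W) 0 (- q s).
Proof.
move=> sE; apply: patternP => i z; split=> [[g [Gg]] /=|[g [Gg -> Bg]]].
  rewrite priE translate_trace // prvE => Bg <-.
  by exists g; rewrite add0r.
exists g; last by rewrite prvE add0r.
by split=> //=; rewrite priE; apply/translate_trace.
Qed.

Lemma cp_hullP l (W : 'I_l -> set V) P : cp_hull Ev Ei W P <->
  exists om, [/\ nonsingular_shift W om, delone Ev P
    & li Ev P (model alpha k (window_trace W) 0 om)].
Proof.
split=> [[s [sE ns [dP PQ]]]|[om [ns dP PQ]]].
  exists (- q s); split=> //; first exact/nonsingular_windowE.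
  by rewrite -cp_setE.
have sE : - om *: w \in Ei by rewrite memvZ // memv_line.
have qs : - q (- om *: w) = om.
  by rewrite int_coordZ int_coord_internal mulr1 opprK.
exists (- om *: w); split=> //; first by apply/nonsingular_windowE; rewrite ?qs.
by split=> //; rewrite cp_setE // qs.
Qed.

Lemma nonsingular_shift_exists l (W : 'I_l -> set V) : window Ei W ->
  exists om, nonsingular_shift W om.
Proof.
move=> winW.
have [|om h] := @nonsingular_parameter_exists R ('I_l * (int * int))%type
  (fun t => window_trace W t.1) _ (fun t => q (lattice_vec R t.2.1 t.2.2)).
  by move=> t; apply: window_trace_regular.
exists om => i g /lattice_vecP[a [b ->]]; exact: (h (i, (a, b))).
Qed.

End CutAndProjectModels.

(** * The quadratic equation and the conjugate line *)

Section Quadratic.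
Variables (R : realType) (alpha : R).
Hypothesis alpha_irr : irrational alpha.
Local Notation Gamma := (@int_lattice R 2).
Local Notation Ev := (slope_line alpha).

Definition quadratic_eq (a b c : int) : Prop :=
  a != 0 /\ a%:~R * alpha ^+ 2 + b%:~R * alpha + c%:~R = 0.

Lemma quadratic_irrationalP :
  quadratic_irrational alpha <-> exists a b c, quadratic_eq a b c.
Proof.
split=> [[_ [P [sP /rootP]]]|[a [b [c [a0 e]]]]].
  rewrite horner_coef size_map_inj_poly ?rmorph0 //; last exact: intr_inj.
  rewrite sP !big_ord_recl big_ord0 !coef_map /= => e.
  exists P`_2, P`_1, P`_0; split.
    have : lead_coef P != 0 by rewrite lead_coef_eq0 -size_poly_eq0 sP.
    by rewrite lead_coefE sP.
  by rewrite -e /bump /= ?expr0 ?expr1; ring.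
split=> //; exists (Poly [:: c; b; a]).
have pE : Poly [:: c; b; a] = [:: c; b; a] :> seq int by rewrite (@PolyK _ 0).
split; first by rewrite pE.
apply/rootP; rewrite horner_coef size_map_inj_poly ?rmorph0 //; last exact: intr_inj.
rewrite pE !big_ord_recl big_ord0 !coef_map pE /= -[RHS]e /bump /= expr0 expr1; ring.
Qed.

Lemma irrational_affine_eq0 (x y : int) :
  x%:~R + y%:~R * alpha = 0 -> x = 0 /\ y = 0.
Proof.
move=> e; have [[-> /eqP]|xy] := eqVneq (x, - y) (0, 0).
  by rewrite oppr_eq0 => /eqP.
have := irrational_comb_neq0 alpha_irr xy.
by rewrite intrN mulNr opprK e eqxx.
Qed.

Lemma scheme_line (Ei : {vspace 'rV[R]_2}) : cut_and_project_scheme Ev Ei ->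
  exists2 k, Ei = <[internal_vec alpha k]>%VS &
    forall g, Gamma g -> phys_coord alpha k g = 0 -> g = 0.
Proof.
case=> cap0 addf injv _ _; have [k EiE] := complement_internal_line cap0 addf.
exists k => // g Gg pg; apply: injv; rewrite ?in_setE //; first exact: lattice0.
by rewrite EiE !prvE pg scale0r /phys_coord int_coord0 !mxE mulr0 subr0 scale0r.
Qed.

(* The integral matrix realizing the scaling has the physical and the internal line
   as eigenlines, so their slopes are the two roots of one integral quadratic; here
   [1 / k] is the difference of the slopes. *)
Lemma sub_scheme_quadratic k l (W : 'I_l -> set 'rV[R]_2) (L : 'End('rV[R]_2)) :
  (forall g, Gamma g -> phys_coord alpha k g = 0 -> g = 0) ->
  window <[internal_vec alpha k]>%VS W -> lin_aut Ev L -> expansive Ev L ->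
  (forall P, cp_hull Ev <[internal_vec alpha k]>%VS W P -> L_sub Ev L P) ->
  exists a b c, quadratic_eq a b c /\
    a%:~R * (1 + alpha * k *+ 2) + b%:~R * k = 0.
Proof.
move=> pinj winW Laut Lexp Lsub.
have [lam lam1 LE] := slope_line_aut Laut Lexp.
have [om ns] := nonsingular_shift_exists winW.
have [K BK] := window_trace_bounded winW.
have [i [c [d [cd Bcd]]]] := window_trace_interval winW.
pose Q := model alpha k (window_trace alpha k W) 0 om.
have [P' [_ PQ der]] : L_sub Ev L Q.
  apply: Lsub; apply/cp_hullP; exists om; split=> //; last exact: li_refl.
  exact: (model_delone alpha_irr pinj BK 0 om cd Bcd).
have [m [M [mu [m0 MZ pM qM mu1]]]] := scaling_matrix alpha_irr pinj BK ns cd Bcd LE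
  lam1 (li_refl _ _) PQ der.
have mR0 : m%:~R != 0 :> R by rewrite intr_eq0.
have mulE x j : (x *m M) 0 j = x 0 0 * M 0 j + x 0 1 * M 1 j.
  rewrite mxE big_ord_recl big_ord1; congr (_ + _ * M _ _);
  try (congr (x _ _)); exact: val_inj.
have /intrP[a00 E00] := MZ 0 0; have /intrP[a01 E01] := MZ 0 1.
have /intrP[a10 E10] := MZ 1 0; have /intrP[a11 E11] := MZ 1 1.
have vM j : (slope_vector alpha *m M) 0 j = m%:~R * lam * slope_vector alpha 0 j.
  rewrite {1}(coord_decomp alpha k (slope_vector alpha *m M)) pM qM.
  by rewrite int_coord_slope phys_coord_slope mulr0 mulr1 scale0r addr0 mxE.
have wM j : (internal_vec alpha k *m M) 0 j = m%:~R * mu * internal_vec alpha k 0 j.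
  rewrite {1}(coord_decomp alpha k (internal_vec alpha k *m M)) pM qM.
  by rewrite int_coord_internal phys_coord_internal mulr0 mulr1 scale0r add0r mxE.
have := wM 1; have := wM 0; have := vM 1; have := vM 0.
rewrite !mulE E00 E01 E10 E11 !mxE /= !mul1r mulr1 => v0 v1 w0 w1.
have e1 : a10%:~R * alpha ^+ 2 + (a00 - a11)%:~R * alpha + (- a01)%:~R = 0.
  rewrite intrB intrN.
  have -> : a10%:~R * alpha ^+ 2 = alpha * (alpha * a10%:~R) by ring.
  have -> : alpha * a10%:~R = m%:~R * lam - a00%:~R by rewrite -v0; ring.
  have -> : a01%:~R = m%:~R * lam * alpha - alpha * a11%:~R by rewrite -v1; ring.
  by ring.
(* If [a10] vanished, irrationality of [alpha] would make the matrix scalar and force [lam = mu],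
   contrary to [|mu| <= 1 < |lam|]. *)
have a100 : a10 != 0.
  apply/eqP => a0; have := e1; rewrite a0 mul0r add0r addrC.
  move=> /irrational_affine_eq0[_ /eqP]; rewrite subr_eq0 => /eqP a00E.
  move: v0 w0 w1; rewrite a0 !mulr0 !addr0.
  have -> : a01 = 0.
    have := e1; rewrite a0 mul0r add0r addrC => /irrational_affine_eq0[/eqP].
    by rewrite oppr_eq0 => /eqP.
  rewrite mulr0 add0r -a00E => v0 w0 w1.
  have : (m%:~R * lam) = m%:~R * mu.
    rewrite -v0; have [k0|k0] := eqVneq k 0.
      by move: w1; rewrite k0 mulr0 addr0 mul1r mulr1.
    by apply: (mulIf k0); rewrite mulrC.
  by move/(mulfI mR0) => lm; move: lam1; rewrite lm ltNge mu1.
exists a10, (a00 - a11), (- a01); split; first by split.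
set u := 1 + alpha * k in w0 w1.
(* The vector [(k, u)] is parallel to its image, so the homogenised quadratic vanishes at slope
   [u : k]; subtracting [k^2] times the equation of [alpha] leaves the claim. *)
have e2 : u * (k * a00%:~R + u * a10%:~R) = k * (k * a01%:~R + u * a11%:~R).
  by rewrite w0 w1; ring.
have -> : a10%:~R * (1 + alpha * k *+ 2) + (a00 - a11)%:~R * k =
   (u * (k * a00%:~R + u * a10%:~R) - k * (k * a01%:~R + u * a11%:~R))
   - k ^+ 2 * (a10%:~R * alpha ^+ 2 + (a00 - a11)%:~R * alpha + (- a01)%:~R).
  by rewrite /u intrB intrN; ring.
by rewrite e1 e2 subrr mulr0 subr0.
Qed.

(** Eliminating [alpha^2] leaves an integral affine relation for [alpha], which must be trivial. The
    conjugate root thus does not depend on the chosen equation. *)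
Lemma quadratic_eq_unique a b c a' b' c' :
  quadratic_eq a b c -> quadratic_eq a' b' c' -> a * b' = a' * b.
Proof.
move=> [a0 e] [a'0 e'].
have : (a * c' - a' * c)%:~R + (a * b' - a' * b)%:~R * alpha = 0.
  rewrite !intrB !intrM.
  have -> : a%:~R * c'%:~R - a'%:~R * c%:~R
     + (a%:~R * b'%:~R - a'%:~R * b%:~R) * alpha =
     a%:~R * (a'%:~R * alpha ^+ 2 + b'%:~R * alpha + c'%:~R)
     - a'%:~R * (a%:~R * alpha ^+ 2 + b%:~R * alpha + c%:~R) by ring.
  by rewrite e e' !mulr0 subrr.
by move=> /irrational_affine_eq0[_ /eqP]; rewrite subr_eq0 => /eqP.
Qed.

Lemma conjugate_line_unique a b c k : quadratic_eq a b c ->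
  (exists a' b' c', quadratic_eq a' b' c' /\
    a'%:~R * (1 + alpha * k *+ 2) + b'%:~R * k = 0) ->
  k = - a%:~R / (b%:~R + (2 * a)%:~R * alpha).
Proof.
move=> qe [a' [b' [c' [qe' ek]]]].
have th0 : b%:~R + (2 * a)%:~R * alpha != 0.
  apply/eqP => /irrational_affine_eq0[_ /eqP]; rewrite mulf_eq0.
  by case: qe => /negPf ->.
have a'0 : a'%:~R != 0 :> R by rewrite intr_eq0; case: qe'.
have e := congr1 (fun z : int => z%:~R : R) (quadratic_eq_unique qe qe').
rewrite !intrM in e.
have e2 : a'%:~R * (a%:~R * (1 + alpha * k *+ 2) + b%:~R * k) = 0.
  have -> : a'%:~R * (a%:~R * (1 + alpha * k *+ 2) + b%:~R * k) =
    a%:~R * (a'%:~R * (1 + alpha * k *+ 2) + b'%:~R * k)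
    - (a%:~R * b'%:~R - a'%:~R * b%:~R) * k by ring.
  by rewrite ek e subrr mul0r mulr0 subrr.
move: e2 => /eqP; rewrite mulf_eq0 (negPf a'0) /= => /eqP e2.
apply: (mulIf th0); rewrite divfK // intrM; apply/eqP; rewrite -subr_eq0.
by apply/eqP; rewrite -[RHS]e2; ring.
Qed.

End Quadratic.

(** * Interval windows *)

Section IntervalUnions.
Variable R : realType.
Implicit Types (s : seq (R * R)) (sg : bool).

Definition toward sg (t : R) : R := if sg then t else - t.

(** The half-open interval that decides membership immediately on the side [sg] of [y]. *)
Definition in_side sg (a b y : R) : bool :=
  if sg then a <= y < b else a < y <= b.

Definition iv_set s : set R := [set y | exists2 ab, ab \in s & ab.1 <= y <= ab.2].

(* The points near which, on the side [sg] (true: right), the union fills up. *)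
Definition iv_side s sg : set R :=
  [set y | exists2 ab, ab \in s & in_side sg ab.1 ab.2 y].

Definition iv_proper s : Prop := forall ab, ab \in s -> ab.1 < ab.2.

(** Close to [y], but off it, no endpoint is met, so the closed interval and both half-open ones
    agree there. *)
Lemma near_interval (a b y : R) sg : exists2 e, 0 < e & forall t, 0 < t < e ->
  (a <= y + toward sg t <= b) = in_side sg a b y /\
  forall sg', in_side sg' a b (y + toward sg t) = in_side sg a b y.
Proof.
(* An endpoint equal to [y] imposes no bound; 1 is a placeholder. *)
exists (Num.min (if a == y then 1 else `|a - y|) (if b == y then 1 else `|b - y|)).
  rewrite lt_min; apply/andP; split; case: eqVneq => // ay;
  by rewrite normr_gt0 subr_eq0.
move=> t /andP[t0]; rewrite lt_min => /andP[ta tb].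
have key c : t < (if c == y then 1 else `|c - y|) ->
    (c <= y + toward sg t) = (if sg then c <= y else c < y) /\
    (c < y + toward sg t) = (if sg then c <= y else c < y).
  case: (ltrgtP c y) => [cy|cy|->]; rewrite /toward; case: sg => /= tc;
    rewrite ?ltr0_norm ?gtr0_norm ?subr_lt0 ?subr_gt0 // in tc; split;
    first [apply/idP; lra | apply/negP/negP; rewrite -ltNge; lra
          | apply/negP/negP; rewrite -leNgt; lra].
have [a1 a2] := key a ta; have [b1 b2] := key b tb.
clear key ta tb; move: (y + toward sg t) a1 a2 b1 b2 => z a1 a2 b1 b2.
split=> [|sg']; rewrite /in_side (leNgt z b) ?(ltNge z b) ?a1 ?a2 b2 ?b1.
  by clear; case: sg; rewrite -?ltNge -?leNgt.
by clear; case: sg'; case: sg; rewrite -?ltNge -?leNgt.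
Qed.

Lemma iv_near s y sg : exists2 e, 0 < e & forall t, 0 < t < e ->
  (iv_set s (y + toward sg t) <-> iv_side s sg y) /\
  forall sg', iv_side s sg' (y + toward sg t) <-> iv_side s sg y.
Proof.
have [ab _|e e0 he] := @seq_uniform_eps R _ s (fun ab t =>
  (ab.1 <= y + toward sg t <= ab.2) = in_side sg ab.1 ab.2 y /\
  forall sg', in_side sg' ab.1 ab.2 (y + toward sg t) = in_side sg ab.1 ab.2 y).
  exact: near_interval.
exists e => // t te; split=> [|sg']; split=> -[ab abs h]; exists ab => //;
  have [h1 h2] := he ab abs t te; move: h; rewrite ?h1 ?h2 //.
Qed.

Lemma iv_side_sub s sg : iv_side s sg `<=` iv_set s.
Proof.
move=> y [ab abs h]; exists ab => //; move: h; rewrite /in_side.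
by case: sg => /andP[h1 h2]; rewrite ?(ltW h1) ?(ltW h2) ?h1 ?h2.
Qed.

Lemma iv_setE s y : iv_proper s -> iv_set s y -> exists sg, iv_side s sg y.
Proof.
move=> ps [ab abs /andP[h1 h2]]; have := ps _ abs.
have [yb|yb] := ltrP y ab.2 => ab12.
  by exists true; exists ab; rewrite //= h1.
by exists false; exists ab; rewrite //= h2 andbT (lt_le_trans ab12).
Qed.

Definition endpoints s : seq R := unzip1 s ++ unzip2 s.

(** Some interval covers [x] but not [y], and one of its ends separates them. *)
Lemma iv_side_change s sg x y : iv_side s sg x -> ~ iv_side s sg y ->
  exists2 c, c \in endpoints s & `|x - c| <= `|x - y|.
Proof.
move=> [ab abs h] ny.
have {ny} ny : ~~ in_side sg ab.1 ab.2 y by apply/negP => hy; apply: ny; exists ab.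
have a1 : ab.1 \in endpoints s by rewrite mem_cat map_f.
have a2 : ab.2 \in endpoints s by rewrite mem_cat [X in _ || X]map_f ?orbT.
have [yx|xy] := lerP y x.
  exists ab.1 => //; move: h ny; rewrite /in_side.
  by case: sg => /andP[h1 h2]; rewrite negb_and -?ltNge -?leNgt => /orP[|] h3;
     rewrite ger0_norm; lra.
exists ab.2 => //; move: h ny; rewrite /in_side.
by case: sg => /andP[h1 h2]; rewrite negb_and -?ltNge -?leNgt => /orP[|] h3;
   rewrite ler0_norm; lra.
Qed.

(** An interval that covers one side of [y] only must end at [y]. The converse fails when intervals
    overlap or abut, so windows are compared at jumps rather than at endpoints. *)
Lemma iv_jump_endpoint s y sg : iv_side s sg y -> ~ iv_side s (~~ sg) y ->
  y \in endpoints s.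
Proof.
move=> [ab abs h] ny.
have {ny} : ~~ in_side (~~ sg) ab.1 ab.2 y by apply/negP => hy; apply: ny; exists ab.
have a1 : ab.1 \in endpoints s by rewrite mem_cat map_f.
have a2 : ab.2 \in endpoints s by rewrite mem_cat [X in _ || X]map_f ?orbT.
move: h; rewrite /in_side; case: sg => /= /andP[h1 h2];
  rewrite negb_and -ltNge -leNgt => /orP[|] h3.
- by rewrite (_ : y = ab.1) //; lra.
- by exfalso; lra.
- by exfalso; lra.
- by rewrite (_ : y = ab.2) //; lra.
Qed.

Lemma iv_set_max s : s != [::] -> iv_proper s -> exists M d, [/\ 0 < d,
  M \in endpoints s, forall y, iv_set s y -> y <= M &
  forall y, M - d < y <= M -> iv_set s y].
Proof.
elim: s => // ab s IH _ ps.
have ab12 : ab.1 < ab.2 by apply: ps; rewrite mem_head.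
have pt : iv_proper s by move=> cd cds; apply: ps; rewrite inE cds orbT.
have abd : exists d, [/\ 0 < d, ab.2 \in endpoints (ab :: s) &
    forall y, ab.2 - d < y <= ab.2 -> iv_set (ab :: s) y].
  exists (ab.2 - ab.1); split; first by rewrite subr_gt0.
    by rewrite mem_cat /= mem_head orbT.
  move=> y /andP[y1 y2]; exists ab; first exact: mem_head.
  by rewrite y2 andbT; lra.
have [s0|s0] := eqVneq s [::].
  have [d [d0 e2 h]] := abd; exists ab.2, d; split=> //.
  by move=> y [cd]; rewrite s0 mem_seq1 => /eqP -> /andP[].
have [M [d [d0 Me Ms Md]]] := IH s0 pt.
have [Mb|bM] := lerP M ab.2.
  have [d' [d'0 e2 h]] := abd; exists ab.2, d'; split=> //.
  move=> y [cd]; rewrite inE => /predU1P[-> /andP[]//|cds ycd].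
  by apply: le_trans Mb; apply: Ms; exists cd.
exists M, d; split=> //.
- by move: Me; rewrite !mem_cat /= !inE => /orP[->|->]; rewrite ?orbT.
- move=> y [cd]; rewrite inE => /predU1P[-> /andP[_ h]|cds ycd].
    by rewrite (le_trans h) // ltW.
  by apply: Ms; exists cd.
- by move=> y /Md[cd cds ycd]; exists cd; rewrite ?inE ?cds ?orbT.
Qed.

Definition iv_opp s : seq (R * R) := [seq (- ab.2, - ab.1) | ab <- s].

Lemma iv_set_opp s y : iv_set (iv_opp s) y <-> iv_set s (- y).
Proof.
split=> [[_ /mapP[ab abs ->] /= /andP[h1 h2]]|[ab abs /andP[h1 h2]]].
  by exists ab; rewrite // lerNr h2 lerNl h1.
exists (- ab.2, - ab.1); first exact: map_f.
by rewrite /= lerNl h2 lerNr h1.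
Qed.

Lemma iv_set_min s : s != [::] -> iv_proper s -> exists m d, [/\ 0 < d,
  forall y, iv_set s y -> m <= y & forall y, m <= y < m + d -> iv_set s y].
Proof.
move=> s0 ps.
have [||M [d [d0 _ h1 h2]]] := @iv_set_max (iv_opp s).
- by rewrite -size_eq0 size_map size_eq0.
- by move=> _ /mapP[ab abs ->] /=; rewrite ltrN2; apply: ps.
exists (- M), d; split=> // y.
  by move=> sy; rewrite lerNl; apply: h1; apply/iv_set_opp; rewrite opprK.
move=> /andP[y1 y2]; rewrite -[y]opprK; apply/iv_set_opp; apply: h2.
by apply/andP; split; lra.
Qed.

End IntervalUnions.

(** * Windows as unions of intersections of lattice translates *)

Section Generation.
Variables (R : realType) (alpha : R).
Hypothesis alpha_irr : irrational alpha.
Local Notation V := 'rV[R]_2.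
Local Notation Gamma := (@int_lattice R 2).
Local Notation q := (int_coord alpha).

Definition combine (D : seq (seq V)) (W : set R) : set R :=
  [set y | exists2 d, d \in D & forall g, g \in d -> W (y - q g)].

(** An empty list would contribute the whole line. Nonemptiness also lets a derived point be traced
    back to a lattice vector. *)
Definition combination (D : seq (seq V)) : Prop :=
  forall d, d \in D -> d != [::] /\ forall g, g \in d -> Gamma g.

(** One translate has its least point just left of [y], the other its greatest point just right of
    [y]. Their intersection is confined between these two points, and it fills a neighbourhood of
    [y] because [s] is solid next to its extreme points. *)
Lemma small_combination (s : seq (R * R)) y e : s != [::] -> iv_proper s -> 0 < e ->
  exists g h, [/\ Gamma g, Gamma h,
    forall z, iv_set s (z - q g) -> iv_set s (z - q h) -> `|z - y| < e &
    exists2 e', 0 < e' & forall z, `|z - y| < e' ->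
      iv_set s (z - q g) /\ iv_set s (z - q h)].
Proof.
move=> s0 ps e0.
have [M [d [d0 _ M1 M2]]] := iv_set_max s0 ps.
have [m [d' [d'0 m1 m2]]] := iv_set_min s0 ps.
pose f := Num.min e (Num.min (d / 2) (d' / 2)).
have f0 : 0 < f by rewrite !lt_min e0 !divr_gt0.
have [fe fd fd'] : [/\ f <= e, f <= d / 2 & f <= d' / 2].
  by rewrite /f !ge_min !lexx !orbT.
have [g Gg /andP[g1 g2]] := @int_coord_dense R alpha alpha_irr (y - f - m) (y - m) ltac:(lra).
have [h Gh /andP[h1 h2]] := @int_coord_dense R alpha alpha_irr (y - M) (y + f - M) ltac:(lra).
exists g, h; split=> //.
  move=> z /m1 z1 /M1 z2; rewrite ltr_norml; apply/andP; split; lra.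
exists (Num.min (y - (m + q g)) (M + q h - y)).
  by rewrite lt_min; apply/andP; split; lra.
move=> z; rewrite lt_min !ltr_norml => /andP[/andP[z1 z2] /andP[z3 z4]].
by split; [apply: m2|apply: M2]; apply/andP; split; lra.
Qed.

Lemma local_global_segment (lo hi : R) (P : set R -> Prop) :
  P set0 -> (forall A B, P A -> P B -> P (A `|` B)) ->
  (forall A B, A `<=` B -> P B -> P A) ->
  (forall y, exists2 e, 0 < e & P [set z | `|z - y| < e]) -> P `[lo, hi]%classic.
Proof.
move=> P0 PU Psub Ploc.
have [e he] := choice (fun y => let: ex_intro2 e e0 h := Ploc y in
  ex_intro (fun e => 0 < e /\ P [set z | `|z - y| < e]) e (conj e0 h)).
have := @segment_compact R lo hi; rewrite compact_cover.
move=> /(_ R setT (fun y => ball y (e y))) [].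
- by move=> y _; apply: ball_open; case: (he y).
- by move=> y _; exists y => //; apply: ballxx; case: (he y).
move=> F _ cov; apply: (Psub _ _ cov).
rewrite /cover bigcup_fset; apply: big_ind => // y _; have [_] := he y; apply: Psub => z.
by rewrite -ball_normE /= distrC.
Qed.

(* Near a jump, intersect a translate of [s] with a small set of the form
   [(s + g) /\ (s + h)]; elsewhere use only the latter; then conclude by compactness. *)
Lemma generated_intervals (s s' : seq (R * R)) : s != [::] -> iv_proper s ->
  iv_proper s' ->
  (forall y sg, iv_side s' sg y -> ~ iv_side s' (~~ sg) y ->
    exists2 g, Gamma g & forall sg', iv_side s sg' (y - q g) <-> iv_side s' sg' y) ->
  exists2 D, combination D & iv_set s' = combine D (iv_set s).
Proof.
move=> s0 ps ps' jumps.
pose good (U : set R) := exists D, [/\ combination D,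
  combine D (iv_set s) `<=` iv_set s' &
  forall y, U y -> iv_set s' y -> combine D (iv_set s) y].
have good0 : good set0.
  by exists [::]; split=> // y [d].
have goodU A B : good A -> good B -> good (A `|` B).
  move=> [D [cD DW hD]] [D' [cD' D'W hD']]; exists (D ++ D'); split.
  - by move=> d; rewrite mem_cat => /orP[/cD|/cD'].
  - by move=> y [d]; rewrite mem_cat => /orP[dD|dD'] h; [apply: DW|apply: D'W]; exists d.
  - by move=> y [Ay|By] Wy; [have [d dD h] := hD y Ay Wy|have [d dD h] := hD' y By Wy];
      exists d; rewrite // mem_cat dD ?orbT.
have goodS A B : A `<=` B -> good B -> good A.
  by move=> AB [D [cD DW hD]]; exists D; split=> // y /AB; apply: hD.
have two_sided (y z : R) : z = y \/ exists sg t, 0 < t /\ z = y + toward sg t /\ t = `|z - y|.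
  have [h|h|->] := ltrgtP z y; [right|right|by left].
    by exists false, (y - z); rewrite subr_gt0 h /=; split=> //; split; lra.
  by exists true, (z - y); rewrite subr_gt0 h /=; split=> //; split; lra.
have near2 (s1 : seq (R * R)) y : exists2 e, 0 < e & forall sg t, 0 < t < e ->
    iv_set s1 (y + toward sg t) <-> iv_side s1 sg y.
  have [e1 e10 h1] := iv_near s1 y true; have [e2 e20 h2] := iv_near s1 y false.
  exists (Num.min e1 e2); first by rewrite lt_min e10.
  move=> [] t /andP[t0]; rewrite lt_min => /andP[te1 te2].
    by have [] := h1 t; rewrite ?t0.
  by have [] := h2 t; rewrite ?t0.
have goodL y : exists2 e, 0 < e & good [set z | `|z - y| < e].
  have [e e0 he] := near2 s' y.
  have [/existsNP[sg nsg]|/contrapT all_sides] :=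
    pselect (~ forall sg, iv_side s' sg y); last first.
    (* Both sides of [y] belong to the target, which therefore contains a whole small set around
       [y]. *)
    have [g [h [Gg Gh small [e' e'0 he']]]] := small_combination y s0 ps e0.
    exists e' => //; exists [:: [:: g; h]]; split.
    - by move=> d; rewrite mem_seq1 => /eqP ->; split=> // x; rewrite !inE => /orP[]/eqP ->.
    - move=> z [d]; rewrite mem_seq1 => /eqP -> hd.
      have ze := small z (hd g (mem_head _ _)) (hd h _).
      have {}ze := ze (_ : h \in [:: g; h]).
      have [->|[sg [t [t0 [zE tE]]]]] := two_sided y z.
        exact: iv_side_sub (all_sides true).
      rewrite zE; apply/he; last exact: all_sides.
      by rewrite t0 tE ze // !inE eqxx orbT.
    - move=> z /he'[hg hh] _; exists [:: g; h]; first exact: mem_head.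
      by move=> x; rewrite !inE => /orP[]/eqP ->.
  have [other|other] := pselect (iv_side s' (~~ sg) y); last first.
    (* Neither side belongs to it, and proper intervals leave no isolated point at [y]: nothing has
       to be covered. *)
    exists e => //; exists [::]; split=> // [y' [d]//|z /= ze].
    have [->|[sg' [t [t0 [zE tE]]]]] := two_sided y z.
      by case/(iv_setE ps') => sg'; case: (eqVneq sg' sg) => [->|] //;
         case: sg sg' nsg other => [] [].
    rewrite zE => /he; rewrite t0 tE ze => /(_ isT).
    by case: sg sg' nsg other {zE} => [] [].
  (* A genuine jump: near [y] the target coincides with a lattice translate of [s], cut down to a
     small set. *)
  have [|g Gg hg] := jumps y (~~ sg) other; first by rewrite negbK.
  have [f f0 hf] := near2 s (y - q g).
  have m0 : 0 < Num.min e f by rewrite lt_min e0.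
  have [g' [h [Gg' Gh small [e' e'0 he']]]] := small_combination y s0 ps m0.
  have same z : `|z - y| < Num.min e f -> iv_set s (z - q g) <-> iv_set s' z.
    rewrite lt_min => /andP[ze zf].
    have [->|[sg' [t [t0 [zE tE]]]]] := two_sided y z.
      split=> _; first exact: iv_side_sub other.
      by apply: iv_side_sub; apply/hg; exact: other.
    have -> : z - q g = y - q g + toward sg' t by rewrite zE; ring.
    rewrite hf; last by rewrite t0 tE.
    by rewrite zE he ?hg // t0 tE.
  exists (Num.min e' (Num.min e f)); first by rewrite lt_min e'0.
  exists [:: [:: g; g'; h]]; split.
  - by move=> d; rewrite mem_seq1 => /eqP ->; split=> // x; rewrite !inE => /or3P[]/eqP ->.
  - move=> z [d]; rewrite mem_seq1 => /eqP -> hd.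
    apply/same; first by apply: small; apply: hd; rewrite !inE eqxx ?orbT.
    by apply: hd; exact: mem_head.
  - move=> z /=; rewrite lt_min => /andP[ze' zef] Wz.
    exists [:: g; g'; h]; first exact: mem_head.
    have [h1 h2] := he' z ze'.
    by move=> x; rewrite !inE => /or3P[]/eqP -> //; apply/same.
have [->|s'0] := eqVneq s' [::].
  by exists [::] => //; apply/seteqP; split=> y [].
have [M [_ [_ _ hM _]]] := iv_set_max s'0 ps'.
have [m [_ [_ hm _]]] := iv_set_min s'0 ps'.
have [D [cD DW hD]] := local_global_segment m M good0 goodU goodS goodL.
exists D => //; apply/seteqP; split=> // y Wy; apply: hD => //.
by rewrite /= in_itv /= hm // hM.
Qed.

(** The identity is evaluated slightly off [y] on the side [sg], where every set involved agrees
    with its one-sided version. Hence one formula serves closed and half-open windows alike. *)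
Lemma combine_side (s s' : seq (R * R)) D sg :
  iv_set s' = combine D (iv_set s) -> iv_side s' sg = combine D (iv_side s sg).
Proof.
move=> e; apply/seteqP.
suff H y : iv_side s' sg y <-> combine D (iv_side s sg) y by split=> y /H.
have [f f0 hf] := iv_near s' y sg.
have [g _|f' f'0 hf'] := @seq_uniform_eps R _ (flatten D) (fun g t =>
   iv_set s (y - q g + toward sg t) <-> iv_side s sg (y - q g)).
  have [f' f'0 hf'] := iv_near s (y - q g) sg.
  by exists f' => // t /hf'[].
pose t := Num.min f f' / 2.
have m0 : 0 < Num.min f f' by rewrite lt_min f0.
have t0 : 0 < t by rewrite divr_gt0.
have [tf tf'] : t < f /\ t < f'.
  have : t < Num.min f f' by rewrite /t; lra.
  by rewrite lt_min => /andP[].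
have [<- _] : (iv_set s' (y + toward sg t) <-> iv_side s' sg y) /\ True.
  by split=> //; have [] := hf t; rewrite ?t0.
rewrite e; split=> -[d dD h]; exists d => // g gd;
  have gD : g \in flatten D by (apply/flattenP; exists d).
  apply/(hf' g gD t); first by rewrite t0.
  have -> : y - q g + toward sg t = y + toward sg t - q g by ring.
  exact: h.
have -> : y + toward sg t - q g = y - q g + toward sg t by ring.
by apply/(hf' g gD t); [rewrite t0|exact: h].
Qed.

End Generation.

(** * One-sided models and the hull *)

Section IntervalModels.
Variables (R : realType) (alpha k : R).
Hypothesis alpha_irr : irrational alpha.
Local Notation V := 'rV[R]_2.
Local Notation Gamma := (@int_lattice R 2).
Local Notation v := (slope_vector alpha).
Local Notation q := (int_coord alpha).
Local Notation p := (phys_coord alpha k).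
Local Notation Ev := (slope_line alpha).
Local Notation Ei := (<[internal_vec alpha k]>%VS).
Hypothesis phys_inj : forall g, Gamma g -> p g = 0 -> g = 0.
Variable s : seq (R * R).
Hypotheses (s0 : s != [::]) (ps : iv_proper s).

Definition full_model : R -> R -> pattern R 2 1 :=
  model alpha k (fun _ : 'I_1 => iv_set s).
Definition side_model (sg : bool) : R -> R -> pattern R 2 1 :=
  model alpha k (fun _ : 'I_1 => iv_side s sg).
Definition nonsingular_offset (om : R) : Prop :=
  forall g, Gamma g -> locally_constant (iv_set s) (q g + om).

Lemma iv_bounded : exists K, forall r, iv_set s r -> `|r| <= K.
Proof.
have [M [_ [_ _ hM _]]] := iv_set_max s0 ps.
have [m [_ [_ hm _]]] := iv_set_min s0 ps.
exists (`|M| + `|m|) => r sr; have := hM _ sr; have := hm _ sr.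
have := ler_norm M; have := ler_norm (- m); rewrite normrN.
have := normr_ge0 M; have := normr_ge0 m => *.
by rewrite ler_norml; apply/andP; split; lra.
Qed.

Lemma iv_side_interval sg : exists c d, c < d /\ forall r, c < r < d -> iv_side s sg r.
Proof.
case: s s0 ps => // -[c d] s' _ ps'; exists c, d; split.
  by apply: (ps' (c, d)); rewrite mem_head.
move=> r /andP[h1 h2]; exists (c, d); first exact: mem_head.
by rewrite /in_side /=; case: sg; rewrite ?h1 ?h2 ?(ltW h1) ?(ltW h2).
Qed.

Lemma side_model_delone sg a om : delone Ev (side_model sg a om).
Proof.
have [K hK] := iv_bounded; have [c [d [cd hcd]]] := iv_side_interval sg.
apply: (@model_delone _ _ _ alpha_irr phys_inj _ _ K _ a om ord0 c d) => //.
by move=> _ r /iv_side_sub; apply: hK.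
Qed.

(** By density some lattice vector moves the offset [om'] to just beside [om], on the side [sg].
    There the finitely many relevant points see the one-sided window of [P] whatever [sg'] is. In
    particular all one-sided models are locally indistinguishable from each other. *)
Lemma side_model_offset sg a a' om om' :
  forall e M, 0 < e -> exists h, [/\ Gamma h,
    exists2 t, 0 < t < e & om' + q h = om + toward sg t &
    forall sg' i z, `|z| <= M -> side_model sg a om i z <->
      side_model sg' a' om' i (z + (a' - a + p h) *: v)].
Proof.
move=> e M e0.
have v0 : 0 < `|v| by rewrite normr_gt0 slope_vector_neq0.
have [K hK] := iv_bounded.
have [S hS] := @finite_lattice_strip _ alpha k (M / `|v| + `|a|) (K + 1 + `|om|).
have [g _|f f0 hf] := @seq_uniform_eps R _ S (fun g t =>
    forall sg', iv_side s sg' (q g + om + toward sg t) <-> iv_side s sg (q g + om)).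
  have [f f0 hf] := iv_near s (q g + om) sg.
  by exists f => // t /hf[].
pose f' := Num.min e (Num.min f 1).
have f'0 : 0 < f' by rewrite !lt_min e0 f0 ltr01.
have [fe ff f1] : [/\ f' <= e, f' <= f & f' <= 1].
  by rewrite /f' !ge_min !lexx !orbT.
have [h Gh [t tf hE]] : exists2 h, Gamma h &
    exists2 t, 0 < t < f' & om' + q h = om + toward sg t.
  case: sg {hf} => /=.
    have [h Gh /andP[h1 h2]] :=
      @int_coord_dense R alpha alpha_irr (om - om') (om - om' + f') ltac:(lra).
    exists h => //; exists (om' + q h - om); last by rewrite /toward; ring.
    by apply/andP; split; lra.
  have [h Gh /andP[h1 h2]] :=
    @int_coord_dense R alpha alpha_irr (om - om' - f') (om - om') ltac:(lra).
  exists h => //; exists (om - om' - q h); last by rewrite /toward; ring.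
  by apply/andP; split; lra.
have /andP[t0 t1] := tf.
exists h; split=> //; first by exists t; rewrite // t0 (lt_le_trans t1).
move=> sg' i z zM.
have key g : Gamma g -> z = (a + p g) *: v -> side_model sg a om i z <->
   side_model sg' a' om' i (z + (a' - a + p h) *: v).
  move=> Gg zE; rewrite zE -scalerDl.
  have -> : a + p g + (a' - a + p h) = a' + p (g + h).
    by rewrite phys_coordD; ring.
  have Ggh := latticeD Gg Gh.
  rewrite /side_model !modelE // int_coordD.
  have -> : q g + q h + om' = q g + om + toward sg t by lra.
  have [gK|gK] := lerP `|q g| (K + 1 + `|om|).
    have gs : g \in S.
      apply: hS => //; have -> : p g = (a + p g) - a by ring.
      by rewrite (le_trans (ler_normB _ _)) // lerD2r ler_pdivlMr // -normrZ -zE.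
    by rewrite (hf g gs t) // t0 (lt_le_trans t1).
  have far sg1 u : iv_side s sg1 (q g + om + u) -> `|u| <= 1 -> False.
    move=> /iv_side_sub/hK rK u1; have := ler_normB (q g + om + u) (om + u).
    have -> : q g + om + u - (om + u) = q g by ring.
    by have := ler_normD om u; lra.
  split=> Br; exfalso.
    by apply: (far sg 0); rewrite ?addr0 // normr0 ler01.
  apply: (far sg' _ Br); rewrite /toward; case: (sg); rewrite ?normrN gtr0_norm //; lra.
split=> [Qz|Qz]; have [g [Gg zE Bg]] := Qz; first exact/(key g).
apply/(key (g - h)) => //; first exact: latticeB.
have -> : a + p (g - h) = (a' + p g) - (a' - a + p h) by rewrite phys_coordB; ring.
by rewrite scalerBl -zE addrK.
Qed.

Lemma side_model_li sg sg' a a' om om' :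
  li Ev (side_model sg a om) (side_model sg' a' om').
Proof.
apply/liP => M; have [h [Gh _ H]] := side_model_offset sg a a' om om' M ltr01.
by exists ((a' - a + p h) *: v); [rewrite memvZ // memv_line|exact: H].
Qed.

Lemma locally_constant_side sg y :
  locally_constant (iv_set s) y -> iv_set s y <-> iv_side s sg y.
Proof.
move=> [e e0 he]; have [f f0 hf] := iv_near s y sg.
have m0 : 0 < Num.min e f by rewrite lt_min e0.
pose t := Num.min e f / 2.
have [t0 te tf] : [/\ 0 < t, t < e & t < f].
  have t1 : t < Num.min e f by rewrite /t; lra.
  by move: t1; rewrite lt_min => /andP[? ?]; split=> //; rewrite divr_gt0.
have [h1 _] : (iv_set s (y + toward sg t) <-> iv_side s sg y) /\
    (forall sg', iv_side s sg' (y + toward sg t) <-> iv_side s sg y).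
  by apply: hf; rewrite t0.
apply: iff_trans h1; apply: iff_sym; apply: he; rewrite addrAC subrr add0r /toward.
by case: (sg); rewrite ?normrN gtr0_norm.
Qed.

Lemma nonsingular_full_model sg a om :
  nonsingular_offset om -> full_model a om = side_model sg a om.
Proof.
move=> ns; apply: patternP => i z; split=> -[g [Gg -> Bg]]; exists g; split=> //;
by apply/(locally_constant_side sg (ns g Gg)).
Qed.

Section Hull.
Variable A : set V.
Hypothesis winA : window Ei (fun _ : 'I_1 => A).
Hypothesis traceA : line_trace alpha k A = iv_set s.
Local Notation W := (fun _ : 'I_1 => A).

Lemma iv_hullP P : cp_hull Ev Ei W P <-> exists om, [/\ nonsingular_offset om,
  delone Ev P & li Ev P (full_model 0 om)].
Proof.
have tr : window_trace alpha k W = (fun _ : 'I_1 => iv_set s).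
  by apply/funext => i; exact: traceA.
rewrite cp_hullP /nonsingular_shift tr; split=> -[om [ns dP PQ]]; exists om; split=> //.
by move=> g; apply: ns ord0 g.
Qed.

Lemma side_model_hull sg a om : cp_hull Ev Ei W (side_model sg a om).
Proof.
have [om' ns] := nonsingular_shift_exists winA.
have ns' : nonsingular_offset om'.
  by move=> g Gg; have := ns ord0 g Gg; rewrite /window_trace traceA.
apply/iv_hullP; exists om'; split=> //; first exact: side_model_delone.
by rewrite (nonsingular_full_model true) //; exact: side_model_li.
Qed.

(* Pinning one point of [P] fixes the physical coordinate of the approximating
   parameters exactly; their internal coordinates then stay in the window. *)
Lemma hull_approximation P : cp_hull Ev Ei W P -> exists a om sg,
  forall e M, 0 < e -> exists om', [/\ nonsingular_offset om',
    exists2 t, 0 <= t < e & om' = om + toward sg t &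
    forall i z, `|z| <= M -> P i z <-> full_model a om' i z].
Proof.
case/iv_hullP => om0 [ns0 [sP _ [rd hrd]] /liP PQ].
have [p0 [i0 _ Pp0] _] := hrd 0 (mem0v _).
have /vlineP[a p0E] := sP _ _ Pp0.
have approx M : exists om', [/\ nonsingular_offset om', iv_set s om' &
    forall i z, `|z| <= M -> P i z <-> full_model a om' i z].
  have [t tE ht] := PQ (Num.max M `|p0|).
  have [|/(_ Pp0) [g [Gg gE Bg]] _] := ht i0 p0; first by rewrite le_max lexx orbT.
  have tE' : t = (p g - a) *: v.
    by rewrite scalerBl -p0E; move: gE; rewrite add0r => <-; rewrite addrAC subrr add0r.
  exists (om0 + q g); split.
  - move=> h Gh; have := ns0 _ (latticeD Gh Gg); rewrite int_coordD.
    by have -> : q h + q g + om0 = q h + (om0 + q g) by ring.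
  - by rewrite addrC.
  move=> i z zM; rewrite ht ?le_max ?zM // tE' /full_model model_translate //.
  split=> -[h [Gh hE Bh]]; exists h; split=> //.
    have -> : a - p g + p h = (0 + p h) - (p g - a) by ring.
    by rewrite scalerBl -hE addrK.
  by rewrite hE -scalerDl; congr (_ *: _); ring.
have [u hu] := choice approx.
have [K hK] := iv_bounded.
(* The approximating offsets lie in the window, hence in a compact segment. *)
have [om _ clom] : exists2 om, `[- K, K]%classic om &
    cluster ((fun n : nat => u n%:R) @ \oo) om.
  have := @segment_compact R (- K) K; move=> /(_ ((fun n : nat => u n%:R) @ \oo)) [].
    exists 0%N => // n _ /=; have [_ /hK] := hu n%:R.
    by rewrite in_itv /= ler_norml.
  by move=> om [h1 h2]; exists om.
have near e M : 0 < e -> exists om', [/\ nonsingular_offset om', `|om' - om| < e &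
    forall i z, `|z| <= M -> P i z <-> full_model a om' i z].
  move=> e0; pose N := (Num.truncn `|M|).+1.
  have [] := clom [set u n%:R | n in [set n | (N <= n)%N]] (ball om e).
  - by exists N => // n Nn; exists n.
  - exact: nbhsx_ballx.
  move=> _ [[n Nn <-]]; rewrite -ball_normE /= distrC => ue.
  have [h1 _ h3] := hu n%:R; exists (u n%:R); split=> // i z zM; apply: h3.
  apply: (le_trans zM); apply: (le_trans (ler_norm _)).
  have /andP[_ /ltW h] := truncn_itv (normr_ge0 M).
  by apply: (le_trans h); rewrite ler_nat.
(* Either arbitrarily good approximations exist from the right, or this fails for some [e1], [M1];
   then all approximations at least that good come from the left. *)
have [right|/existsNP[e1 /existsNP[M1 /not_implyP[e10 H]]]] := pselect
  (forall e M, 0 < e -> exists om', [/\ nonsingular_offset om', `|om' - om| < e,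
    forall i z, `|z| <= M -> P i z <-> full_model a om' i z & om <= om']).
  exists a, om, true => e M e0; have [om' [h1 h2 h3 h4]] := right e M e0.
  exists om'; split=> //; exists (om' - om); last by rewrite /toward; ring.
  by rewrite subr_ge0 h4 /=; apply: le_lt_trans h2; apply: ler_norm.
exists a, om, false => e M e0.
have m0 : 0 < Num.min e e1 by rewrite lt_min e0.
have [om' [h1 h2 h3]] := near _ (Num.max M M1) m0.
move: h2; rewrite lt_min => /andP[h2 h2'].
exists om'; split=> //; last by move=> i z zM; apply: h3; rewrite le_max zM.
have [omle|omgt] := lerP om om'.
  exfalso; apply: H; exists om'; split=> // i z zM; apply: h3.
  by rewrite le_max zM orbT.
exists (om - om'); last by rewrite /toward; ring.
rewrite subr_ge0 (ltW omgt) /=; apply: le_lt_trans h2.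
by rewrite distrC ler_norm.
Qed.

(** Near each lattice point the approximating offset is either strictly on the side [sg] of [om],
    where the window has its one-sided value, or equal to [om], which is then nonsingular. The
    approximation is retained for evaluating the torus parametrisation. *)
Lemma hull_side_model P : cp_hull Ev Ei W P -> exists a om sg,
  P = side_model sg a om /\
  forall e M, 0 < e -> exists om', [/\ nonsingular_offset om', `|om' - om| < e &
    forall i z, `|z| <= M -> P i z <-> full_model a om' i z].
Proof.
move=> HP; have [a [om [sg H]]] := hull_approximation HP.
have sP : supported Ev P by have /iv_hullP[_ [_ [sP _ _] _]] := HP.
exists a, om, sg; split; last first.
  move=> e M e0; have [om' [h1 [t /andP[t0 te] omE] h3]] := H e M e0.
  exists om'; split=> //; rewrite omE addrAC subrr add0r /toward.
  by case: (sg); rewrite ?normrN ger0_norm.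
apply: patternP => i z.
have key g : Gamma g -> z = (a + p g) *: v -> P i z <-> side_model sg a om i z.
  move=> Gg zE; have [f f0 hf] := iv_near s (q g + om) sg.
  have [om' [ns [t /andP[t0 tf] omE] h3]] := H f `|z| f0.
  rewrite (h3 i z (lexx _)) zE /full_model /side_model !modelE //.
  move: t0; rewrite le_eqVlt => /predU1P[t0|t0].
    have {}omE : om' = om by rewrite omE -t0 /toward; case: (sg); rewrite ?oppr0 addr0.
    by rewrite omE; apply: locally_constant_side; rewrite -omE; exact: ns.
  by rewrite omE addrA; have [] := hf t; rewrite ?t0.
split=> [Pz|[g [Gg zE Bg]]]; last by apply/(key g) => //; exists g.
have [om' [_ _ h3]] := H 1 `|z| ltr01.
have [g [Gg zE _]] := (h3 i z (lexx _)).1 Pz.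
exact/(key g).
Qed.

End Hull.
End IntervalModels.

(** * Rational windows and unit scalings *)

Section RationalWindows.
Variables (R : realType) (alpha k : R).
Local Notation V := 'rV[R]_2.
Local Notation Gamma := (@int_lattice R 2).
Local Notation w := (internal_vec alpha k).
Local Notation q := (int_coord alpha).
Local Notation Ev := (slope_line alpha).
Local Notation Ei := (<[internal_vec alpha k]>%VS).

(** Membership in [(1/N) q(Gamma)]; [N] is explicit so that several points can share a
    denominator. *)
Definition lattice_rational (N : nat) (c : R) : Prop :=
  exists2 g, Gamma g & N%:R * c = q g.

Lemma rational_priE x : rational_pri Ev Ei x <->
  x \in Ei /\ exists2 N, (0 < N)%N & lattice_rational N (q x).
Proof.
split=> [[N [N0 [g Gg ->]]]|[xE [N N0 [g Gg e]]]].
  rewrite priE !memvZ ?memv_line //; split=> //; exists N => //; exists g => //.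
  by rewrite !int_coordZ int_coord_internal mulr1 mulVKf // pnatr_eq0 -lt0n.
exists N; split=> //; exists g => //; rewrite priE -e scalerA mulKf -?mem_internal_line //.
by rewrite pnatr_eq0 -lt0n.
Qed.

Lemma lattice_rationalM N N' c : lattice_rational N c -> lattice_rational (N' * N)%N c.
Proof.
move=> [g Gg e]; exists (N'%:~R *: g); first exact: latticeZ.
by rewrite int_coordZ -e natrM -[N'%:~R]/(N'%:R) mulrA.
Qed.

Lemma common_denominator (cs : seq R) :
  (forall c, c \in cs -> exists2 N, (0 < N)%N & lattice_rational N c) ->
  exists2 N, (0 < N)%N & forall c, c \in cs -> lattice_rational N c.
Proof.
elim: cs => [|c cs IH] H; first by exists 1%N.
have [N N0 hN] := H c (mem_head _ _).
have [|N' N'0 hN'] := IH; first by move=> d ds; apply: H; rewrite inE ds orbT.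
exists (N' * N)%N; first by rewrite muln_gt0 N'0.
move=> d; rewrite inE => /predU1P[->|/hN' h]; first exact: lattice_rationalM.
by rewrite mulnC; apply: lattice_rationalM.
Qed.

Lemma segment_internal (c d : R) (x : V) :
  segment (c *: w) (d *: w) x <->
  exists2 r, Num.min c d <= r <= Num.max c d & x = r *: w.
Proof.
split=> [[t] /=|[y]].
  rewrite in_itv /= => /andP[t0 t1] <-.
  exists ((1 - t) * c + t * d); last by rewrite !scalerA -scalerDl.
  have t1' : 0 <= 1 - t by rewrite subr_ge0.
  have [cd|/ltW cd] := lerP c d; have cd' := cd; rewrite -subr_ge0 in cd';
    have := mulr_ge0 t0 cd'; have := mulr_ge0 t1' cd' => h1 h2;
    by apply/andP; split; lra.
move=> cyd ->; have [cd|cd] := eqVneq c d.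
  exists 0; first by rewrite /= in_itv /= lexx ler01.
  move: cyd; rewrite -cd minxx maxxx => cyc.
  by rewrite subr0 scale1r scale0r addr0; congr (_ *: _); lra.
have cd0 : d - c != 0 by rewrite subr_eq0 eq_sym.
exists ((y - c) / (d - c)); last first.
  by rewrite !scalerA -scalerDl; congr (_ *: _); field.
rewrite /= in_itv /=; case: (ltrgtP c d) cyd cd => // h /andP[y1 y2] _.
  by rewrite divr_ge0 ?subr_ge0 ?(ltW h) //= ler_pdivrMr ?subr_gt0 // mul1r lerD2r.
rewrite -[(y - c) / _]opprK -mulrN -invrN opprB -mulNr opprB.
by rewrite divr_ge0 ?subr_ge0 ?(ltW h) //= ler_pdivrMr ?subr_gt0 // mul1r lerD2l lerN2.
Qed.

(** The two ends of a segment come in no particular order, so each pair is sorted by [min] and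
    [max]. *)
Lemma rational_interval_unionE A : rational_interval_union Ev Ei A ->
  exists s : seq (R * R), [/\ s != [::], iv_proper s,
    forall c, c \in endpoints s -> exists2 N, (0 < N)%N & lattice_rational N c &
    A = [set x | exists2 r, iv_set s r & x = r *: w]].
Proof.
move=> [S [S0 HS ->]].
pose mk (u : V * V) : R * R :=
  (Num.min (q u.1) (q u.2), Num.max (q u.1) (q u.2)).
have inE' u : u \in S -> [/\ u.1 = q u.1 *: w, u.2 = q u.2 *: w & q u.1 != q u.2].
  move=> /HS[/rational_priE[u1 _] /rational_priE[u2 _] u12].
  have e1 := mem_internal_line u1; have e2 := mem_internal_line u2.
  by split=> //; apply: contraNneq u12 => e; rewrite e1 e2 e.
exists (map mk S); split.
- by rewrite -size_eq0 size_map size_eq0; apply/eqP.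
- move=> _ /mapP[u /inE'[_ _ u12] ->] /=.
  by case: (ltrP (q u.1) (q u.2)) => // h; rewrite lt_neqAle eq_sym u12.
- have hmk u : u \in S -> forall c, c = q u.1 \/ c = q u.2 ->
     exists2 N, (0 < N)%N & lattice_rational N c.
    by move=> /HS[/rational_priE[_ h1] /rational_priE[_ h2] _] c [] ->.
  move=> c; rewrite mem_cat => /orP[] /mapP[_ /mapP[u uS ->] ->] /=;
  apply: (hmk u uS); rewrite /Num.min /Num.max; case: ifP => _; by [left|right].
apply/seteqP; split=> x.
  move=> [u /= uS ux]; have [e1 e2 _] := inE' u uS.
  move: ux; rewrite e1 e2 => /segment_internal[r hr ->].
  by exists r => //; exists (mk u); first exact: map_f.
move=> [r [_ /mapP[u uS ->] /= hr] ->]; exists u => //=.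
have [e1 e2 _] := inE' u uS; rewrite e1 e2; apply/segment_internal.
by exists r.
Qed.

Lemma iv_set_compact (s : seq (R * R)) : compact (iv_set s).
Proof.
elim: s => [|ab s IH].
  have -> : iv_set [::] = set0 :> set R by apply/seteqP; split=> y [].
  exact: compact0.
have -> : iv_set (ab :: s) = `[ab.1, ab.2]%classic `|` iv_set s.
  apply/seteqP; split=> y.
    move=> [cd]; rewrite inE => /predU1P[-> h|cds h]; first by left; rewrite /= in_itv.
    by right; exists cd.
  move=> [|[cd cds h]]; last by exists cd; rewrite // inE cds orbT.
  by rewrite /= in_itv /= => h; exists ab; first exact: mem_head.
by apply: compactU => //; exact: segment_compact.
Qed.

Lemma iv_set_regular (s : seq (R * R)) : iv_proper s ->
  iv_set s = closure (interior (iv_set s)).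
Proof.
move=> ps; apply/seteqP; split=> y; last first.
  move=> cl; have : closure (iv_set s) y.
    by apply: closure_subset cl; exact: interior_subset.
  exact: (compact_closed (@Rhausdorff R) (@iv_set_compact s)).
move=> /(iv_setE ps)[sg [ab abs hy]] U /nbhs_ballP[e /= e0 he].
have ab12 := ps _ abs.
have [z [zab ze]] : exists z, ab.1 < z < ab.2 /\ `|z - y| < e.
  pose t := Num.min (e / 2) ((ab.2 - ab.1) / 2).
  have t0 : 0 < t by rewrite lt_min !divr_gt0 ?subr_gt0.
  have [te tab] : t < e /\ t < ab.2 - ab.1.
    have : t <= e / 2 by rewrite /t ge_min lexx.
    have : t <= (ab.2 - ab.1) / 2 by rewrite /t ge_min lexx orbT.
    by split; lra.
  have /andP[y1 y2] : ab.1 <= y <= ab.2.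
    by move: hy; rewrite /in_side; case: sg => /andP[h1 h2]; rewrite ?h1 ?h2 ?(ltW h1) ?(ltW h2).
  have [h|h] := lerP y ((ab.1 + ab.2) / 2).
    exists (y + t / 2); rewrite addrAC subrr add0r gtr0_norm ?divr_gt0 //.
    by split; [apply/andP; split|]; lra.
  exists (y - t / 2); rewrite addrAC subrr add0r normrN gtr0_norm ?divr_gt0 //.
  by split; [apply/andP; split|]; lra.
exists z; split; last by apply: he; rewrite -ball_normE /= distrC.
apply: (@filterS _ _ _ `]ab.1, ab.2[%classic); last first.
  by apply: near_in_itvoo; rewrite in_itv.
by move=> x; rewrite /= in_itv /= => /andP[h1 h2]; exists ab; rewrite // !ltW.
Qed.

Lemma iv_window (s : seq (R * R)) (A : set V) : s != [::] -> iv_proper s ->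
  A = [set x | exists2 r, iv_set s r & x = r *: w] ->
  window Ei (fun _ : 'I_1 => A) /\ line_trace alpha k A = iv_set s.
Proof.
move=> s0 ps AE.
have tr : line_trace alpha k A = iv_set s.
  rewrite AE; apply/seteqP; split=> r; last by exists r.
  move=> [r' h /(congr1 q)]; rewrite !int_coordZ int_coord_internal !mulr1.
  by move=> ->.
have AEi : A `<=` [set` Ei] by rewrite AE => _ [r _ ->]; rewrite /= memvZ // memv_line.
split=> //; split=> [_|]; last first.
  exists ord0; have [c [d [cd h]]] := iv_side_interval s0 ps true.
  exists ((c + d) / 2 *: w); rewrite AE; exists ((c + d) / 2) => //.
  by apply: (@iv_side_sub _ _ true); apply: h; apply/andP; split; lra.
split=> //.
  have -> : A = (fun r : R => r *: w) @` iv_set s.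
    by rewrite AE; apply/seteqP; split=> x [r h e]; exists r.
  apply: continuous_compact; last exact: iv_set_compact.
  by apply: continuous_subspaceT => r; apply: continuousZl; exact: cvg_id.
apply/seteqP; split=> x Ax.
  rewrite (mem_internal_line (AEi _ Ax)); apply/int_closureE.
  have -> : line_trace alpha k (int_interior Ei A) = interior (iv_set s).
    by rewrite -tr; apply/seteqP; split=> r /int_interiorE.
  rewrite -iv_set_regular // -tr /line_trace /= -mem_internal_line //.
  exact: AEi.
have [xE|xE] := boolP (x \in Ei); last first.
  have /(_ xE) := @int_closure_out R alpha k (int_interior Ei A) x.
  by move=> /(_ Ax); apply: (@interior_subset (subspace [set` Ei])).
move: Ax; rewrite {1}(mem_internal_line xE) => /int_closureE.
have -> : line_trace alpha k (int_interior Ei A) = interior (iv_set s).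
  by rewrite -tr; apply/seteqP; split=> r /int_interiorE.
by rewrite -iv_set_regular // -tr /line_trace /= -mem_internal_line.
Qed.

End RationalWindows.

(** * Integral maps from units of a quadratic order *)

Section UnitScaling.
Variables (R : realType) (alpha : R) (a b c : int).
Hypothesis alpha_irr : irrational alpha.
Hypothesis qe : quadratic_eq alpha a b c.
Local Notation V := 'rV[R]_2.
Local Notation Gamma := (@int_lattice R 2).
Local Notation q := (int_coord alpha).

Definition discriminant_root : R := b%:~R + (2 * a)%:~R * alpha.
(** With this [k] the internal line has slope [alpha + 1/k = - b/a - alpha], the other root. *)
Definition conjugate_param : R := - a%:~R / discriminant_root.

Local Notation theta := discriminant_root.
Local Notation k := conjugate_param.
Local Notation p := (phys_coord alpha conjugate_param).

Lemma discriminant_root_irrational : irrational theta.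
Proof.
have a20 : 2 * a != 0 by rewrite mulf_neq0 //; case: qe.
move=> [r _ rE]; apply: (irrationalMz alpha_irr a20).
exists (r - b%:~R) => //; rewrite rmorphB /= rE ratr_int /theta; ring.
Qed.

Lemma discriminant_root_neq0 : theta != 0.
Proof.
apply/eqP => e; apply: discriminant_root_irrational; exists 0 => //.
by rewrite rmorph0 e.
Qed.

Lemma discriminant_rootE : theta ^+ 2 = (b ^+ 2 - 4 * a * c)%:~R.
Proof.
have [_ e] := qe; rewrite /theta.
have -> : (b ^+ 2 - 4 * a * c)%:~R = b%:~R ^+ 2 - 4 * a%:~R * c%:~R :> R.
  by rewrite intrB !intrM; ring.
have -> : (2 * a)%:~R = 2 * a%:~R :> R by rewrite intrM.
have -> : c%:~R = - (a%:~R * alpha ^+ 2 + b%:~R * alpha) by lra.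
by ring.
Qed.

(* The matrix of [x + y theta], with eigenvectors [(1, alpha)] and its conjugate. *)
Definition quadratic_map (x y : int) (z : V) : V := \row_j
  (if j == 0 then (x + y * b)%:~R * z 0 0 + (y * (2 * a))%:~R * z 0 1
   else (x - y * b)%:~R * z 0 1 - (y * (2 * c))%:~R * z 0 0).

Lemma quadratic_map_lattice x y z : Gamma z -> Gamma (quadratic_map x y z).
Proof.
move=> Gz j; rewrite mxE; case: ifP => _.
  by rewrite rpredD // rpredM // ?intr_int.
by rewrite rpredB // rpredM // ?intr_int.
Qed.

Lemma quadratic_map_int x y z :
  q (quadratic_map x y z) = (x%:~R - y%:~R * theta) * q z.
Proof.
have [_ e] := qe; rewrite /q !mxE /= /theta.
apply/eqP; rewrite -subr_eq0; apply/eqP.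
transitivity (- 2 * y%:~R * z 0 0 *
   (a%:~R * alpha ^+ 2 + b%:~R * alpha + c%:~R)); last by rewrite e mulr0.
by ring.
Qed.

Lemma quadratic_map_phys x y z :
  p (quadratic_map x y z) = (x%:~R + y%:~R * theta) * p z.
Proof.
rewrite /phys_coord quadratic_map_int; have th0 := discriminant_root_neq0.
have tE : theta = b%:~R + 2 * a%:~R * alpha by rewrite /theta intrM.
have kth : k * theta = - a%:~R by rewrite /k divfK.
apply: (mulIf th0).
have -> (m u : R) : (m - k * u) * theta = m * theta - (k * theta) * u by ring.
have -> (u m r : R) : u * (m - k * r) * theta = u * (m * theta - (k * theta) * r).
  by ring.
rewrite kth.
by rewrite /int_coord !mxE /= tE; ring.
Qed.

(** The inverse of an element of norm 1 is its conjugate. *)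
Lemma quadratic_map_inv x y : x ^+ 2 - (b ^+ 2 - 4 * a * c) * y ^+ 2 = 1 ->
  cancel (quadratic_map x (- y)) (quadratic_map x y).
Proof.
move=> xy z.
have key : x%:~R ^+ 2 - (b%:~R ^+ 2 - 4 * a%:~R * c%:~R) * y%:~R ^+ 2 = 1 :> R.
  have := congr1 (fun n : int => n%:~R : R) xy.
  by move=> h; apply: etrans h; ring.
by apply: row2P; rewrite !mxE /= -[RHS]mul1r -[in RHS]key; ring.
Qed.

(** For the last clause, [lam^-1 - 1 = (x - 1) - y theta] with both [x - 1] and [y] divisible by
    [N]; the quotient acts on the lattice by another [quadratic_map]. *)
Lemma unit_scaling (N : nat) : (0 < N)%N -> exists lam phi psi, [/\ 1 < lam,
  (forall g, Gamma g -> Gamma (phi g)) /\ (forall g, Gamma g -> Gamma (psi g)),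
  cancel psi phi,
  (forall z, p (phi z) = lam * p z) /\ (forall z, q (phi z) = lam^-1 * q z) &
  forall g, Gamma g -> exists2 h, Gamma h & (lam^-1 - 1) * q g = N%:R * q h].
Proof.
move=> N0; have [x [y [dx dy xy lam1]]] :=
  pell_unit discriminant_root_irrational discriminant_rootE N0.
set lam := _ + _ in lam1.
have lamV : lam^-1 = x%:~R - y%:~R * theta.
  have lam0 : lam != 0 by rewrite gt_eqF // (lt_trans ltr01).
  apply: (mulfI lam0); rewrite divff // /lam.
  have := congr1 (fun n : int => n%:~R : R) xy.
  by rewrite intrB [(_ * y ^+ 2)%:~R]intrM -discriminant_rootE => h; apply: etrans (esym h) _; ring.
exists lam, (quadratic_map x y), (quadratic_map x (- y)); split=> //.
- by split=> g; apply: quadratic_map_lattice.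
- exact: quadratic_map_inv.
- by split=> z; [apply: quadratic_map_phys|rewrite quadratic_map_int lamV].
move=> g Gg; case/dvdzP: dx => x' xE; case/dvdzP: dy => y' yE.
exists (quadratic_map x' y' g); first exact: quadratic_map_lattice.
rewrite quadratic_map_int lamV.
have -> : x%:~R = 1 + x'%:~R * N%:R :> R.
  by rewrite -[N%:R]/(N%:~R) -intrM -xE intrB; ring.
by rewrite yE intrM -[N%:~R]/(N%:R); ring.
Qed.

(** For [g = (m, n)], [theta * p g] equals [(b m + a n) + a m alpha], an integral affine expression
    in [alpha]. *)
Lemma conjugate_param_phys_inj g : Gamma g -> p g = 0 -> g = 0.
Proof.
move=> Gg; case/lattice_vecP: (Gg) => m [n gE] /(congr1 ( *%R theta)).
rewrite mulr0 /phys_coord /k => e.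
have th0 := discriminant_root_neq0.
have {}e : theta * g 0 0 + a%:~R * q g = 0.
  by rewrite -e; field.
have : (b * m + a * n)%:~R + (a * m)%:~R * alpha = 0.
  by rewrite -e /theta gE /int_coord !mxE /=; ring.
case/(irrational_affine_eq0 alpha_irr) => e1 /eqP; rewrite mulf_eq0.
have [/negPf a0 _] := qe; rewrite a0 /= => /eqP m0.
move: e1; rewrite m0 mulr0 add0r => /eqP; rewrite mulf_eq0 a0 /= => /eqP n0.
by rewrite gE m0 n0; apply: row2P; rewrite !mxE.
Qed.

End UnitScaling.

(** * Local derivations between a pattern and its inflation *)

Section Derivations.
Variables (R : realType) (alpha k : R).
Local Notation V := 'rV[R]_2.
Local Notation Gamma := (@int_lattice R 2).
Local Notation v := (slope_vector alpha).
Local Notation q := (int_coord alpha).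
Local Notation p := (phys_coord alpha k).
Local Notation Ev := (slope_line alpha).
Hypothesis phys_inj : forall g, Gamma g -> p g = 0 -> g = 0.

(* The physical counterpart of [combine D], followed by a translation by [- t]. *)
Definition derive_pattern (D : seq (seq V)) (t : R) l (P : pattern R 2 l) :
  pattern R 2 l :=
  fun i => [set z | exists2 d, d \in D & forall g, g \in d -> P i (z + (t - p g) *: v)].

(** The internal shift by [q g] and the physical shift by [p g] come from the same lattice vector,
    so set formulas for windows become local rules for points. *)
Lemma derive_model D t l (B B' : 'I_l -> set R) a om : combination D ->
  (forall i, B' i = combine alpha D (B i)) ->
  derive_pattern D t (model alpha k B a om) = model alpha k B' (a - t) om.
Proof.
move=> cD BB; apply: patternP => i z; split=> [[d dD h]|[g [Gg ->]]].
  have [+ Gd] := cD d dD; case: d dD h Gd => // g0 d dD h Gd _.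
  have [g1 [Gg1 zE _]] := h g0 (mem_head _ _).
  have Gg0 := Gd g0 (mem_head _ _).
  have zE' : z = ((a - t) + p (g1 + g0)) *: v.
    rewrite -[z](addrK ((t - p g0) *: v)) zE -scalerBl phys_coordD.
    by congr (_ *: _); ring.
  rewrite zE'; exists (g1 + g0); split=> //; first exact: latticeD.
  rewrite BB; exists (g0 :: d) => // g gd; have Gg := Gd g gd.
  have := h g gd; rewrite zE' -scalerDl.
  have -> : a - t + p (g1 + g0) + (t - p g) = a + p (g1 + g0 - g).
    by rewrite phys_coordB; ring.
  move/(modelE phys_inj) => Bg.
  have -> : q (g1 + g0) + om - q g = q (g1 + g0 - g) + om by rewrite int_coordB; ring.
  by apply: Bg; apply: latticeB => //; apply: latticeD.
rewrite BB => -[d dD h]; exists d => // h0 hd.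
have [_ Gd] := cD d dD; have Gh := Gd _ hd.
exists (g - h0); split; first exact: latticeB.
  by rewrite -scalerDl phys_coordB; congr (_ *: _); ring.
have -> : q (g - h0) + om = q g + om - q h0 by rewrite int_coordB; ring.
exact: h.
Qed.

Lemma derive_local D t l : exists2 c, 0 <= c & forall (P Q : pattern R 2 l) x y,
  agree P Q x y c -> forall i, derive_pattern D t P i x <-> derive_pattern D t Q i y.
Proof.
exists (\sum_(g <- flatten D) `|(t - p g) *: v|); first exact: sumr_ge0.
move=> P Q x y ag i.
have bound d g : d \in D -> g \in d ->
    `|(t - p g) *: v| <= \sum_(g <- flatten D) `|(t - p g) *: v|.
  move=> dD gd; have gD : g \in flatten D by apply/flattenP; exists d.
  by rewrite (big_rem g) //= lerDl sumr_ge0.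
by split=> -[d dD h]; exists d => // g gd; apply/(ag i _ (bound d g dD gd)); apply: h.
Qed.

Lemma derive_ld D t l (P : pattern R 2 l) : ld Ev P (derive_pattern D t P).
Proof.
have [c c0 hc] := derive_local D t l.
by apply/ldP; exists c => // x y _ _ ag; apply: hc.
Qed.

Hypothesis alpha_irr : irrational alpha.
Variable s : seq (R * R).
Hypotheses (s0 : s != [::]) (ps : iv_proper s).
Variables (N : nat) (lam : R) (phi psi : V -> V).
Hypotheses (N0 : (0 < N)%N) (lam1 : 1 < lam).
Hypothesis rational_ends : forall c, c \in endpoints s -> lattice_rational alpha N c.
Hypotheses (phiG : forall g, Gamma g -> Gamma (phi g))
  (psiG : forall g, Gamma g -> Gamma (psi g)) (psiK : cancel psi phi).
Hypotheses (p_phi : forall z, p (phi z) = lam * p z)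
  (q_phi : forall z, q (phi z) = lam^-1 * q z).
Hypothesis lam_modN :
  forall g, Gamma g -> exists2 h, Gamma h & (lam^-1 - 1) * q g = N%:R * q h.
Variable L : 'End(V).
Hypothesis LE : forall x, x \in Ev -> L x = lam *: x.

Local Notation S sg := (side_model alpha k s sg).

Let lam0 : lam != 0. Proof. by rewrite gt_eqF // (lt_trans ltr01). Qed.
Let lam_gt0 : 0 < lam. Proof. exact: lt_trans lam1. Qed.

(** The window of [L P]: [L] stretches the physical line by [lam], and the lattice map [phi] that
    extends it contracts internal coordinates by [lam^-1]. *)
Definition iv_scale : seq (R * R) := [seq (lam^-1 * ab.1, lam^-1 * ab.2) | ab <- s].

Lemma iv_scale_side sg y : iv_side iv_scale sg y <-> iv_side s sg (lam * y).
Proof.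
have e ab : in_side sg (lam^-1 * ab.1) (lam^-1 * ab.2) y = in_side sg ab.1 ab.2 (lam * y).
  by rewrite /in_side !ler_pdivrMl // !ltr_pdivrMl // !ler_pdivlMl // !ltr_pdivlMl.
split=> [[_ /mapP[ab abs ->] /=]|[ab abs h]].
  by rewrite (e ab); exists ab.
by exists (lam^-1 * ab.1, lam^-1 * ab.2); rewrite ?e //=; apply: map_f.
Qed.

Lemma iv_scale_proper : iv_proper iv_scale.
Proof. by move=> _ /mapP[ab /ps h ->] /=; rewrite ltr_pM2l ?invr_gt0. Qed.

Lemma iv_scale_neq0 : iv_scale != [::].
Proof. by rewrite -size_eq0 size_map size_eq0. Qed.

Lemma rational_shift c : lattice_rational alpha N c ->
  exists2 h, Gamma h & lam^-1 * c = c + q h.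
Proof.
move=> [g Gg e]; have [h Gh eh] := lam_modN Gg; exists h => //.
have NR : N%:R != 0 :> R by rewrite pnatr_eq0 -lt0n.
by apply: (mulfI NR); rewrite mulrDr -eh -e; ring.
Qed.

(** A jump of [s] at [c] becomes a jump of the contracted window at [lam^-1 c], which differs from
    [c] by some [q h]; translation by [- h] brings it back. *)
Lemma generated_from_scaled :
  exists2 D, combination D & iv_set s = combine alpha D (iv_set iv_scale).
Proof.
apply: generated_intervals => //; first exact: iv_scale_neq0.
  exact: iv_scale_proper.
move=> y sg hy nhy; have [h Gh e] := rational_shift (rational_ends (iv_jump_endpoint hy nhy)).
exists (- h); first exact: latticeN.
move=> sg'; rewrite iv_scale_side; have -> // : lam * (y - q (- h)) = y.
by rewrite int_coordN opprK -e mulVKf.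
Qed.

Lemma scaled_generated :
  exists2 D, combination D & iv_set iv_scale = combine alpha D (iv_set s).
Proof.
apply: generated_intervals => //; first exact: iv_scale_proper.
move=> y sg /iv_scale_side hy nhy.
have nhy' : ~ iv_side s (~~ sg) (lam * y) by move=> h; apply: nhy; apply/iv_scale_side.
have [h Gh e] := rational_shift (rational_ends (iv_jump_endpoint hy nhy')).
exists h => // sg'; rewrite iv_scale_side; have -> // : y - q h = lam * y.
by rewrite mulKf // in e; rewrite {1}e addrK.
Qed.

Lemma lin_image_side_model sg a om : lin_image L (S sg a om) =
  side_model alpha k iv_scale sg (lam * a) (lam^-1 * om).
Proof.
apply: patternP => i z; rewrite (lin_imageE LE lam0); last exact: model_supported.
split=> -[g [Gg zE Bg]].
  exists (phi g); split; first exact: phiG.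
    by rewrite -[z](scalerKV lam0) zE scalerA p_phi mulrDr.
  by apply/iv_scale_side; rewrite q_phi -mulrDr mulVKf.
exists (psi g); split; first exact: psiG.
  by rewrite zE scalerA -{1}(psiK g) p_phi mulrDr !mulKf.
move/iv_scale_side: Bg; rewrite -{1}(psiK g) q_phi -mulrDr mulVKf //.
Qed.

Lemma side_model_L_Sub sg a om : L_Sub Ev L (S sg a om).
Proof.
have [D cD eD] := generated_from_scaled; have [D' cD' eD'] := scaled_generated.
(* These parameters are sent to [(a, om)] by [L]. *)
exists (S sg (lam^-1 * a) (lam * om)); split.
- exact: side_model_delone.
- by split; apply: side_model_li.
rewrite lin_image_side_model mulVKf // mulKf //; split.
  have -> : S sg a om = derive_pattern D 0 (side_model alpha k iv_scale sg a om).
    rewrite (@derive_model _ _ _ _ (fun _ => iv_side s sg)) ?subr0 //.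
    by move=> _; apply: combine_side.
  exact: derive_ld.
have -> : side_model alpha k iv_scale sg a om = derive_pattern D' 0 (S sg a om).
  rewrite (@derive_model _ _ _ _ (fun _ => iv_side iv_scale sg)) ?subr0 //.
  by move=> _; apply: combine_side.
exact: derive_ld.
Qed.

(** Contraction changes a rational offset by some [q h], equivalent to a physical shift by [- p h];
    [t] cancels it together with the shift [lam a - a]. The same [D] and [t] serve all sides and
    parameters, so the rule acts on the whole hull. *)
Lemma side_model_fixed a om : lattice_rational alpha N om ->
  exists D t, (forall sg, derive_pattern D t (lin_image L (S sg a om)) = S sg a om) /\
    forall sg b om', derive_pattern D t (lin_image L (S sg b om')) =
      S sg (lam * b - t) (lam^-1 * om').
Proof.
move=> /rational_shift[h Gh e]; have [D cD eD] := generated_from_scaled.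
have H t sg b om' : derive_pattern D t (lin_image L (S sg b om')) =
    S sg (lam * b - t) (lam^-1 * om').
  rewrite lin_image_side_model (@derive_model _ _ _ _ (fun _ => iv_side s sg)) //.
  by move=> _; apply: combine_side.
exists D, (lam * a - p h - a); split=> // sg.
rewrite H e; apply/funext => i; rewrite /side_model model_translate //.
by congr (model _ _ _ _ _ _); ring.
Qed.

End Derivations.

(** * Torus parametrisation *)

Section TorusParametrisation.
Variable R : realType.
Local Notation V := 'rV[R]_2.
Local Notation Gamma := (@int_lattice R 2).

Lemma torus_classP (x y : V) : torus_class x = torus_class y <-> Gamma (x - y).
Proof.
have E : reflect (torus_class x = torus_class y) (lattice_eqv x y).
  exact: (@eqmodP _ (lattice_equiv R 2)).
by split=> [/E/asboolP|Gxy] //; apply/E/asboolP.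
Qed.

Lemma torus_repr (t : torus R 2) : exists x : V, t = torus_class x.
Proof. by exists (repr t); rewrite /torus_class reprK. Qed.

Lemma torus_nbhs (y : V) (r : R) : 0 < r ->
  nbhs (torus_class y)
    [set t | exists x g, [/\ t = torus_class x, Gamma g & `|x - y - g| < r]].
Proof.
move=> r0; apply: open_nbhs_nbhs; split; last first.
  by exists y, 0; split=> //; [exact: lattice0|rewrite subr0 subrr normr0].
rewrite /open /= /quotient_open openE => x /= [x' [g [xx' Gg xr]]].
have {xx'} Gx : Gamma (x - x') by apply/torus_classP.
have e0 : 0 < r - `|x' - y - g| by rewrite subr_gt0.
apply/nbhs_ballP; exists (r - `|x' - y - g|) => //= z.
rewrite -ball_normE /= distrC => zx.
exists z, (g + (x - x')); split=> //; first exact: latticeD.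
have -> : z - y - (g + (x - x')) = (z - x) + (x' - y - g).
  by apply/rowP => j; rewrite !mxE; ring.
by apply: le_lt_trans (ler_normD _ _) _; lra.
Qed.

Lemma lattice_separated (x : V) : ~ Gamma x -> exists2 r, 0 < r &
  forall g, Gamma g -> r <= `|x - g|.
Proof.
move=> nG; have [s hs] := finite_lattice_ball (`|x| + 1).
have [g _|e e0 he] := @seq_uniform_eps R _ s (fun g t => Gamma g -> t < `|x - g|).
  have [Gg|] := pselect (Gamma g); last by exists 1.
  exists `|x - g|; last by move=> t /andP[].
  by rewrite normr_gt0 subr_eq0; apply/eqP => xg; apply: nG; rewrite xg.
exists (Num.min (e / 2) 1); first by rewrite lt_min ltr01 divr_gt0.
move=> g Gg; rewrite ge_min; apply/orP.
have [gs|gx] := lerP `|g| (`|x| + 1).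
  by left; apply/ltW/(he g (hs g Gg gs)) => //; apply/andP; split; lra.
by right; have := ler_normB x (x - g); rewrite subKr; lra.
Qed.

Variables (alpha k : R).
Hypothesis alpha_irr : irrational alpha.
Local Notation v := (slope_vector alpha).
Local Notation w := (internal_vec alpha k).
Local Notation q := (int_coord alpha).
Local Notation p := (phys_coord alpha k).
Local Notation Ev := (slope_line alpha).
Local Notation Ei := (<[internal_vec alpha k]>%VS).
Hypothesis phys_inj : forall g, Gamma g -> p g = 0 -> g = 0.
Variables (s : seq (R * R)) (A : set V).
Hypotheses (s0 : s != [::]) (ps : iv_proper s).
Hypothesis winA : window Ei (fun _ : 'I_1 => A).
Hypothesis traceA : line_trace alpha k A = iv_set s.
Local Notation W := (fun _ : 'I_1 => A).

Lemma cp_set_at_model x :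
  cp_set_at Ev Ei W x = full_model alpha k s (p x) (q x).
Proof.
apply: patternP => i z; rewrite /cp_set_at /full_model -traceA; split.
  move=> [g [Gg]] /=; rewrite priE prvE => Ag <-; exists g; split=> //.
    by rewrite phys_coordD addrC.
  by rewrite -int_coordD.
move=> [g [Gg -> Ag]]; exists g; last by rewrite prvE phys_coordD addrC.
by split=> //=; rewrite priE int_coordD.
Qed.

Lemma nonsingular_pointP x : nonsingular_offset alpha s (q x) ->
  nonsingular_point Ev Ei W x.
Proof.
move=> ns [i _ [_ [h Gh <-]]] [y [cl int]]; rewrite !priE => e.
have yE : y = (q (- h) + q x) *: w.
  by rewrite int_coordN scalerDl scaleNr -e addrC addrK.
have /locally_constantE := ns _ (latticeN Gh); apply.
by move: cl int; rewrite yE -traceA => /int_closureE cl int; split=> // /int_interiorE.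
Qed.

(** The values of [tau] are prescribed at nonsingular points only. Approximants of [P] with
    nonsingular offsets near [om] lie in every local neighbourhood of [P]; were [tau P] another
    class, the discreteness of the lattice would keep it a distance [r] away, contradicting
    continuity. *)
Lemma torus_parametrisationE tau a om P :
  torus_parametrisation Ev Ei W tau -> cp_hull Ev Ei W P ->
  (forall e M, 0 < e -> exists om', [/\ nonsingular_offset alpha s om', `|om' - om| < e &
    forall i z, `|z| <= M -> P i z <-> full_model alpha k s a om' i z]) ->
  tau P = torus_class (a *: v + om *: w).
Proof.
move=> [tau_cvg tau_ns] HP approx; set u := _ + _.
have [y yE] := torus_repr (tau P); rewrite yE; apply/torus_classP; apply: contrapT => nG.
have [r r0 hr] := lattice_separated nG.
have r2 : 0 < r / 2 by rewrite divr_gt0.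
have nb := torus_nbhs y r2; rewrite -yE in nb.
have [e /= e0 he] := tau_cvg P HP _ nb.
have w0 : 0 < `|w| by rewrite normr_gt0 internal_vec_neq0.
have [om' [ns omom' PQ]] := approx (r / 2 / `|w|) e^-1 (divr_gt0 r2 w0).
pose x := a *: v + om' *: w.
have px : p x = a.
  by rewrite phys_coordD !phys_coordZ phys_coord_slope phys_coord_internal mulr1 mulr0 addr0.
have qx : q x = om'.
  by rewrite int_coordD !int_coordZ int_coord_slope int_coord_internal mulr1 mulr0 add0r.
have QE : cp_set_at Ev Ei W x = full_model alpha k s a om' by rewrite cp_set_at_model px qx.
have [||z [g [zE Gg zr]]] := he (cp_set_at Ev Ei W x).
- exists 0; split; [exact: mem0v|by rewrite normr0 ltW|].
  move=> i; rewrite QE; apply/seteqP.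
  by split=> z [Qz zb]; split=> //; move: Qz; rewrite translateE subr0 => Qz;
    apply/(PQ i z) => //; move: zb; rewrite /closed_ball_ /= sub0r normrN.
- rewrite QE (@nonsingular_full_model _ alpha k s true) //.
  exact: side_model_hull.
rewrite tau_ns in zE; last by apply: nonsingular_pointP; rewrite qx.
have /hr : Gamma (- (g + (x - z))).
  by apply/latticeN/latticeD => //; apply/torus_classP.
apply/negP; rewrite -ltNge.
have -> : y - u - - (g + (x - z)) = - (z - y - g) + (x - u).
  by apply/rowP => j; rewrite !mxE; ring.
apply: le_lt_trans (ler_normD _ _) _; rewrite normrN.
have : `|x - u| < r / 2.
  have -> : x - u = (om' - om) *: w.
    by rewrite /x /u scalerBl opprD addrACA subrr add0r.
  by rewrite normrZ -ltr_pdivlMr.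
by lra.
Qed.

End TorusParametrisation.

(** * Rationality of pseudo self-affine patterns *)

Section PseudoSelfAffine.
Variables (R : realType) (alpha k : R).
Hypothesis alpha_irr : irrational alpha.
Local Notation V := 'rV[R]_2.
Local Notation Gamma := (@int_lattice R 2).
Local Notation v := (slope_vector alpha).
Local Notation w := (internal_vec alpha k).
Local Notation q := (int_coord alpha).
Local Notation p := (phys_coord alpha k).
Local Notation Ev := (slope_line alpha).
Hypothesis phys_inj : forall g, Gamma g -> p g = 0 -> g = 0.

Lemma int_coord_dense_scaled (c x y : R) : c != 0 -> x < y ->
  exists2 g, Gamma g & x < c * q g < y.
Proof.
move=> c0 xy; have [cn|cp] := ltrP c 0.
  have yx : y / c < x / c by rewrite ltr_ndivrMr // divfK.
  have [g Gg /andP[h1 h2]] := int_coord_dense alpha_irr yx; exists g => //.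
  by rewrite mulrC -ltr_ndivlMr // h2 /= -ltr_ndivrMr.
have c1 : 0 < c by rewrite lt_def c0.
have xyc : x / c < y / c by rewrite ltr_pM2r ?invr_gt0.
have [g Gg /andP[h1 h2]] := int_coord_dense alpha_irr xyc; exists g => //.
by rewrite mulrC -ltr_pdivrMr // h1 /= -ltr_pdivlMr.
Qed.

Lemma lattice_separated_line (s : seq V) (T : eqType) (ts : seq T) (f : V -> T -> R) :
  (forall g t, g \in s -> t \in ts -> Gamma g -> f g t != 0) ->
  exists2 e, 0 < e & forall g t, g \in s -> t \in ts -> Gamma g -> e <= `|f g t|.
Proof.
move=> H; have [gt gts|e e0 he] := @seq_uniform_eps R _ [seq (g, t) | g <- s, t <- ts]
    (fun gt e => Gamma gt.1 -> e < `|f gt.1 gt.2|).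
  case/allpairsP: gts => -[g t] /= [gs tt ->] /=.
  have [Gg|] := pselect (Gamma g); last by exists 1.
  by exists `|f g t|; [rewrite normr_gt0 H|move=> e /andP[]].
exists (e / 2); first by rewrite divr_gt0.
move=> g t gs tt Gg; apply/ltW/(he (g, t)) => //; first exact: allpairs_f.
by apply/andP; split; lra.
Qed.

Section Scaled.
Variables (m : int) (M : 'M[R]_2) (lam mu : R).
Hypotheses (m0 : m != 0) (lam1 : 1 < `|lam|).
Hypothesis MZ : forall i j, M i j \is a Num.int.
Hypothesis pM : forall x, p (x *m M) = m%:~R * lam * p x.
Hypothesis qM : forall x, q (x *m M) = m%:~R * mu * q x.

Let mR0 : m%:~R != 0 :> R. Proof. by rewrite intr_eq0. Qed.
Let lam0 : lam != 0. Proof. by rewrite -normr_gt0 (lt_trans ltr01). Qed.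

Let nonzero_lattice_vec : exists e, [/\ Gamma e, p e != 0 & q e != 0].
Proof.
have [e Ge /andP[e0 _]] := int_coord_dense alpha_irr ltr01; exists e; split=> //.
  apply: contraTneq e0 => /(phys_inj Ge) ->; rewrite int_coord0 ltxx //.
by rewrite gt_eqF.
Qed.

Lemma int_scale_neq0 : mu != 0.
Proof.
have [e [Ge pe _]] := nonzero_lattice_vec; apply/eqP => mu0.
have /(int_coord_lattice_eq0 alpha_irr) eM : Gamma (e *m M) by apply: latticeM.
have : p (e *m M) = 0.
  by rewrite eM ?qM ?mu0 ?mulr0 ?mul0r // /phys_coord int_coord0 !mxE mulr0 subr0.
by move/eqP; rewrite pM !mulf_eq0 (negPf mR0) (negPf lam0) (negPf pe).
Qed.

(** For [mu = 1] the lattice vector [e M - m e] would have zero internal coordinate, hence vanish,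
    forcing [lam = 1]. *)
Lemma int_scale_neq1 : mu != 1.
Proof.
have [e [Ge pe _]] := nonzero_lattice_vec; apply/eqP => mu1.
have /(int_coord_lattice_eq0 alpha_irr) eM : Gamma (e *m M - m%:~R *: e).
  by apply: latticeB; [exact: latticeM|exact: latticeZ].
have : p (e *m M - m%:~R *: e) = 0.
  rewrite eM ?int_coordB ?qM ?int_coordZ ?mu1 ?mulr1 ?subrr //.
  by rewrite /phys_coord int_coord0 !mxE mulr0 subr0.
rewrite phys_coordB pM phys_coordZ => /eqP.
have -> : m%:~R * lam * p e - m%:~R * p e = m%:~R * (lam - 1) * p e by ring.
rewrite !mulf_eq0 (negPf mR0) (negPf pe) orbF /= subr_eq0 => /eqP l1.
by move: lam1; rewrite l1 normr1 ltxx.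
Qed.

(** The integral matrix [T = m - M] multiplies internal coordinates by [m (1 - mu)]. It is
    invertible, and its adjugate inverts it over the lattice up to the determinant, which enters the
    denominator. *)
Lemma lattice_rational_solve N om : (0 < N)%N ->
  (exists2 g, Gamma g & N%:R * (m%:~R * (1 - mu) * om) = q g) ->
  exists2 N', (0 < N')%N & lattice_rational alpha N' om.
Proof.
move=> N0 [g Gg e].
have [M' M'E] : exists M' : 'M[int]_2, M = map_mx intr M'.
  exists (\matrix_(i, j) Num.floor (M i j)); apply/matrixP => i j; rewrite !mxE.
  by apply/esym/eqP; rewrite -intrEfloor.
pose T' := m%:M - M'; pose T : 'M[R]_2 := map_mx intr T'.
have TE : T = (m%:~R)%:M - M.
  by rewrite /T /T' map_mxB map_scalar_mx M'E.
have xT x : x *m T = m%:~R *: x - x *m M by rewrite TE mulmxBr mul_mx_scalar.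
have qT x : q (x *m T) = m%:~R * (1 - mu) * q x.
  by rewrite xT int_coordB int_coordZ qM; ring.
have pT x : p (x *m T) = m%:~R * (1 - lam) * p x.
  by rewrite xT phys_coordB phys_coordZ pM; ring.
have mu1 : 1 - mu != 0 by rewrite subr_eq0 eq_sym int_scale_neq1.
have la1 : 1 - lam != 0.
  by rewrite subr_eq0; apply: contraTneq lam1 => <-; rewrite normr1 ltxx.
have dT : \det T = (\det T')%:~R by rewrite /T det_map_mx.
have d0 : \det T' != 0.
  rewrite -(intr_eq0 R) -dT; apply/det0P => -[x x0 xT0].
  have qx : q x = 0.
    apply/eqP; move: (qT x); rewrite xT0 int_coord0 => /esym/eqP.
    by rewrite !mulf_eq0 (negPf mR0) (negPf mu1).
  have px : p x = 0.
    apply/eqP; move: (pT x).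
    rewrite xT0 /phys_coord int_coord0 !mxE mulr0 subr0 -/(phys_coord _ _ _) => /esym/eqP.
    by rewrite !mulf_eq0 (negPf mR0) (negPf la1).
  by move/eqP: x0; apply; rewrite (coord_decomp alpha k x) qx px !scale0r addr0.
have Gh : Gamma (g *m \adj T).
  apply: latticeM => // i j; rewrite /T -map_mx_adj mxE; exact: intr_int.
have qh : q (g *m \adj T) = (\det T')%:~R * N%:R * om.
  apply: (mulfI (mulf_neq0 mR0 mu1)); rewrite -qT -mulmxA mul_adj_mx mul_mx_scalar.
  by rewrite int_coordZ -e dT; ring.
exists (`|\det T'| * N)%N; first by rewrite muln_gt0 absz_gt0 d0.
exists ((sgz (\det T'))%:~R *: (g *m \adj T)); first exact: latticeZ.
have dE : `|\det T'|%N%:R = (sgz (\det T'))%:~R * (\det T')%:~R :> R.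
  by rewrite -intrM -abszEsg.
by rewrite int_coordZ qh natrM dE; ring.
Qed.

End Scaled.

Variables (s : seq (R * R)) (N : nat).
Hypotheses (s0 : s != [::]) (ps : iv_proper s) (N0 : (0 < N)%N).
Hypothesis rational_ends : forall c, c \in endpoints s -> lattice_rational alpha N c.

Lemma iv_side_interior sg (c d y : R) : (forall r, c < r < d -> iv_set s r) ->
  c < y < d -> iv_side s sg y.
Proof.
move=> cd /andP[cy yd]; have [e e0 he] := iv_near s y sg.
pose f := Num.min e (Num.min (y - c) (d - y)).
have f0 : 0 < f by rewrite !lt_min e0 !subr_gt0 cy yd.
have [fe fc fd] : [/\ f <= e, f <= y - c & f <= d - y].
  by rewrite /f !ge_min !lexx !orbT.
have [h1 _] : (iv_set s (y + toward sg (f / 2)) <-> iv_side s sg y) /\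
    (forall sg', iv_side s sg' (y + toward sg (f / 2)) <-> iv_side s sg y).
  by apply: he; apply/andP; split; lra.
by apply/h1; apply: cd; rewrite /toward; case: (sg); apply/andP; split; lra.
Qed.

(* Consider two nearby internal coordinates on either side of the right end of the
   window. A local rule from [L P] can separate them only if the window of [L P] has
   a jump close by, relative to one of finitely many lattice displacements; in the
   limit this expresses the internal coordinate of [P] through endpoints. *)
Lemma pseudo_self_affine_rational (L : 'End(V)) (lam : R) sg a om :
  (forall x, x \in Ev -> L x = lam *: x) -> 1 < `|lam| ->
  pseudo_self_affine Ev L (side_model alpha k s sg a om) ->
  exists2 N', (0 < N')%N & lattice_rational alpha N' om.
Proof.
move=> LE lam1 der; set P := side_model alpha k s sg a om in der.
have lam0 : lam != 0 by rewrite -normr_gt0 (lt_trans ltr01).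
have [K hK] := iv_bounded s0 ps.
have [m [M [mu [m0 MZ pM qM _]]]] : exists (m : int) (M : 'M[R]_2) (mu : R), [/\ m != 0,
    forall i j, M i j \is a Num.int,
    forall x, p (x *m M) = m%:~R * lam * p x,
    forall x, q (x *m M) = m%:~R * mu * q x & `|mu| <= 1].
  have [om0 ns] := @nonsingular_parameter_exists R (int * int)%type (fun _ => iv_set s)
    (fun _ => iv_set_regular ps) (fun t => q (lattice_vec R t.1 t.2)).
  have ns' : nonsingular_offset alpha s om0.
    by move=> g /lattice_vecP[x [y ->]]; exact: (ns (x, y)).
  have [c [d [cd hcd]]] := iv_side_interval s0 ps true.
  have PQ : li Ev P (full_model alpha k s 0 om0).
    rewrite (@nonsingular_full_model _ alpha k s true) //; exact: side_model_li.
  have hK' (i : 'I_1) r : iv_set s r -> `|r| <= K by exact: hK.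
  have ns1 (i : 'I_1) g : Gamma g -> locally_constant (iv_set s) (q g + om0).
    exact: ns'.
  have hcd' r : c < r < d -> iv_set s r.
    by move=> rcd; apply: (@iv_side_sub _ _ true); exact: hcd.
  exact: (@scaling_matrix _ _ _ alpha_irr phys_inj _ (fun _ => iv_set s) K hK' 0 om0
    ns1 P P L lam ord0 c d cd hcd' LE lam1 PQ PQ der).
have mR0 : m%:~R != 0 :> R by rewrite intr_eq0.
have mu0 := int_scale_neq0 m0 lam1 MZ pM qM.
have mmu0 := mulf_neq0 mR0 mu0.
have [Mx [d [d0 Mxe Mx1 Mx2]]] := iv_set_max s0 ps.
(* Solved for the offset, the identity reads [m (1 - mu) om = m Mx - m mu c - q h], whose right side
   is rational. *)
suff [c ce [h Gh hE]] : exists2 c, c \in endpoints s & exists2 h, Gamma h &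
    q h = m%:~R * (Mx - om - mu * (c - om)).
  apply: (lattice_rational_solve m0 lam1 MZ pM qM N0).
  have [g1 Gg1 e1] := rational_ends Mxe; have [g2 Gg2 e2] := rational_ends ce.
  exists (m%:~R *: g1 - g2 *m M - N%:~R *: h).
    exact: latticeB (latticeB (latticeZ _ Gg1) (latticeM MZ Gg2)) (latticeZ _ Gh).
  rewrite !int_coordB qM !int_coordZ hE -e1 -e2 -[N%:~R]/(N%:R); ring.
have [/ldP[c c0 hc] sP] : ld Ev (lin_image L P) P /\ supported Ev P.
  by split=> //; exact: model_supported.
(* [Cp] and [Cq] bound the coordinates of the displacement [m g - th M] found below, independently
   of [eps]; hence finitely many displacements compete, and those missing the identity miss it by a
   uniform [e]. *)
pose Cp := `|m%:~R| * (`|lam * a - a| + (1 + `|k| * (1 + `|alpha|)) * c).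
pose B t := m%:~R * (Mx - om - mu * (t - om)).
pose Cq := \sum_(t <- endpoints s) `|B t| + `|m%:~R| * 5.
have [S hS] := @finite_lattice_strip _ alpha k Cp Cq.
apply: contrapT => none.
have [|e e0 he] := @lattice_separated_line S _ (endpoints s) (fun h t => q h - B t).
  move=> h t _ te Gh; rewrite subr_eq0; apply/eqP => hB.
  by apply: none; exists t => //; exists h.
have mn0 : 0 < `|m%:~R : R| by rewrite normr_gt0.
(* The error below is at most [5 |m| eps]; the factor 6 keeps it strictly below [e]. *)
pose eps := Num.min (Num.min d 1) (e / (6 * `|m%:~R|)).
have eps0 : 0 < eps by rewrite !lt_min d0 ltr01 divr_gt0 // mulr_gt0.
have [epsd eps1 epse] : [/\ eps <= d, eps <= 1 & eps <= e / (6 * `|m%:~R|)].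
  by rewrite /eps !ge_min !lexx !orbT.
(* [g] places [x] just inside the maximum [Mx] of the window, and [h M] carries it just outside. *)
have [g Gg /andP[g1 g2]] :=
  @int_coord_dense R alpha alpha_irr (Mx - om - eps) (Mx - om) ltac:(lra).
have [h Gh /andP[h1 h2]] := @int_coord_dense_scaled (m%:~R * mu)
  (Mx - om - q g) (Mx - om - q g + eps) mmu0 ltac:(lra).
have GhM : Gamma (h *m M) by exact: latticeM.
pose x := (a + p g) *: v; pose y := (a + p (g + h *m M)) *: v.
have Px : P ord0 x.
  apply/(modelE phys_inj) => //; apply: (@iv_side_interior sg (Mx - d) Mx).
    by move=> r /andP[r1 r2]; apply: Mx2; rewrite r1 ltW.
  by apply/andP; split; lra.
have Py : ~ P ord0 y.
  move=> /(modelE phys_inj)-/(_ (latticeD Gg GhM))/iv_side_sub/Mx1.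
  by rewrite int_coordD qM; lra.
have xE : x \in Ev by rewrite memvZ // memv_line.
have yE : y \in Ev by rewrite memvZ // memv_line.
have nag : ~ agree (lin_image L P) (lin_image L P) x y c.
  by move=> ag; apply: Py; apply/(hc x y xE yE ag).
have /existsNP[i /existsNP[z /not_implyP[zc nz]]] := nag.
rewrite !(lin_imageE LE lam0 sP) in nz.
pose u := lam^-1 *: (x + z).
have yu : lam^-1 *: (y + z) = u + p (m%:~R *: h) *: v.
  have -> : y = x + (p (h *m M)) *: v.
    by rewrite /y /x -scalerDl phys_coordD addrA.
  rewrite /u addrAC scalerDr scalerA pM phys_coordZ; congr (_ + _ *: _).
  by field.
rewrite yu -/u in nz.
have Gmh : Gamma (m%:~R *: h) by exact: latticeZ.
(* Exactly one of the two points compared belongs to [P]; either way [u] is the projection of a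
   shifted lattice point. *)
have [th Gth uE] : exists2 th, Gamma th & u = (a + p th) *: v.
  have [[t [Gt tE _]]|nPu] := pselect (P i u); first by exists t.
  have [[t [Gt tE _]]|nPu'] := pselect (P i (u + p (m%:~R *: h) *: v)).
    exists (t - m%:~R *: h); first exact: latticeB.
    by rewrite phys_coordB addrA scalerBl -tE addrK.
  by exfalso; apply: nz; split.
have GthM : Gamma (m%:~R *: g - th *m M).
  by apply: latticeB; [exact: latticeZ|exact: latticeM].
have qmh : `|m%:~R * q h| * `|mu| <= 2 * eps.
  rewrite -normrM [_ * mu]mulrAC ger0_norm; lra.
(* Membership changes between two internal coordinates at distance [|m q h|], so an endpoint lies
   nearby. *)
have [t te tclose] : exists2 t, t \in endpoints s &
    `|q th + om - t| <= 2 * `|m%:~R * q h|.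
  rewrite uE -scalerDl -addrA -phys_coordD /P /side_model in nz.
  rewrite !(modelE phys_inj) ?(latticeD Gth Gmh) // in nz; last exact: latticeD.
  rewrite int_coordD int_coordZ in nz.
  have e1 : q th + m%:~R * q h + om = q th + om + m%:~R * q h by ring.
  rewrite e1 in nz; set r := q th + om in nz *; set r' := _ + _ in nz.
  have rr : `|r - r'| = `|m%:~R * q h|.
    by rewrite /r' opprD addrA subrr add0r normrN.
  have [sr|nsr] := pselect (iv_side s sg r).
    have [sr'|nsr'] := pselect (iv_side s sg r'); first by exfalso; apply: nz.
    have [t te tc] := iv_side_change sr nsr'; exists t => //.
    by apply: (le_trans tc); rewrite rr; have := normr_ge0 (m%:~R * q h); lra.
  have [sr'|nsr'] := pselect (iv_side s sg r'); last by exfalso; apply: nz; split.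
  have [t te tc] := iv_side_change sr' nsr; exists t => //.
  rewrite [leRHS]distrC rr in tc.
  have := ler_normD (r - r') (r' - t); rewrite subrKA rr; lra.
pose ph := m%:~R *: g - th *m M.
have phB : `|q ph - B t| <= `|m%:~R| * (5 * eps).
  have -> : q ph - B t = m%:~R * ((q g - (Mx - om)) - mu * (q th + om - t)).
    by rewrite int_coordB int_coordZ qM /B; ring.
  rewrite normrM ler_wpM2l // (le_trans (ler_normB _ _)) //.
  have h3 : `|q g - (Mx - om)| <= eps by rewrite ler_norml; apply/andP; split; lra.
  have h4 : `|mu * (q th + om - t)| <= 4 * eps.
    rewrite normrM mulrC; apply: le_trans (_ : 2 * `|m%:~R * q h| * `|mu| <= _).
      by rewrite ler_wpM2r.
    by rewrite -mulrA; lra.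
  by lra.
have phS : ph \in S.
  apply: hS => //.
    have pz : p z = lam * (a + p th) - (a + p g).
      have : p u = a + p th by rewrite uE phys_coordZ phys_coord_slope mulr1.
      rewrite /u phys_coordZ phys_coordD /x phys_coordZ phys_coord_slope mulr1 => <-.
      by field.
    have -> : p ph = m%:~R * ((lam * a - a) - p z).
      by rewrite phys_coordB phys_coordZ pM pz; ring.
    rewrite /Cp normrM ler_wpM2l // (le_trans (ler_normB _ _)) // lerD2l.
    by apply: (le_trans (phys_coord_le _ _ _)); rewrite ler_wpM2l.
  have -> : q ph = B t + (q ph - B t) by ring.
  apply: (le_trans (ler_normD _ _)); rewrite /Cq lerD //.
    by rewrite (big_rem t) //= lerDl sumr_ge0.
  by apply: (le_trans phB); rewrite ler_wpM2l //; lra.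
have := he ph t phS te GthM.
apply/negP; rewrite -ltNge; apply: (le_lt_trans phB).
have : eps * (6 * `|m%:~R|) <= e by rewrite -ler_pdivlMr // mulr_gt0.
by have := mulr_gt0 mn0 eps0; lra.
Qed.

End PseudoSelfAffine.

(** * The conjugate scheme and rational windows *)

Section QuadraticScheme.
Variables (R : realType) (alpha : R) (a b c : int).
Hypothesis alpha_irr : irrational alpha.
Hypothesis qe : quadratic_eq alpha a b c.
Local Notation V := 'rV[R]_2.
Local Notation Gamma := (@int_lattice R 2).
Local Notation v := (slope_vector alpha).
Local Notation q := (int_coord alpha).
Local Notation Ev := (slope_line alpha).
Local Notation k := (conjugate_param alpha a b).
Local Notation p := (phys_coord alpha k).
Local Notation w := (internal_vec alpha k).
Local Notation Ei := (<[internal_vec alpha k]>%VS).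

Let phys_inj := conjugate_param_phys_inj alpha_irr qe.

Lemma conjugate_scheme : cut_and_project_scheme Ev Ei.
Proof.
split; [exact: slope_internal_cap|exact: slope_internal_add|..].
- move=> g h /set_mem Gg /set_mem Gh; rewrite !prvE => /slope_scale_inj.
  exact: (phys_coord_inj phys_inj).
- move=> g h /set_mem Gg /set_mem Gh; rewrite !priE => /(congr1 q).
  rewrite !int_coordZ int_coord_internal !mulr1 => e; apply/eqP.
  rewrite -subr_eq0; apply/eqP/(int_coord_lattice_eq0 alpha_irr).
    exact: latticeB.
  by rewrite int_coordB e subrr.
move=> x /= xE U /nbhs_ballP[e /= e0 he].
have w0 : 0 < `|w| by rewrite normr_gt0 internal_vec_neq0.
have d0 : 0 < e / `|w| by rewrite divr_gt0.
have [g Gg /andP[g1 g2]] := @int_coord_dense R alpha alpha_irr (q x - e / `|w|)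
  (q x + e / `|w|) ltac:(lra).
exists (pri Ev Ei g); split; first by exists g.
apply: he; rewrite -ball_normE /= priE {1}(mem_internal_line xE).
rewrite -scalerBl normrZ -ltr_pdivlMr //.
by rewrite ltr_norml; apply/andP; split; lra.
Qed.

Section RationalUnion.
Variable A : set V.
Hypothesis unionA : rational_interval_union Ev Ei A.
Local Notation W := (fun _ : 'I_1 => A).

Lemma rational_union_window : window Ei W.
Proof.
have [s [s0 ps _ AE]] := rational_interval_unionE unionA.
by have [] := iv_window s0 ps AE.
Qed.

Lemma rational_union_L_Sub : exists L : 'End(V),
  [/\ lin_aut Ev L, expansive Ev L
    & forall P, cp_hull Ev Ei W P -> L_Sub Ev L P].
Proof.
have [s [s0 ps rat AE]] := rational_interval_unionE unionA.
have [winA trA] := iv_window s0 ps AE.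
have [N N0 ratN] := common_denominator rat.
have [lam [phi [psi [lam1 [phiG psiG] psiK [p_phi q_phi] lamN]]]] :=
  unit_scaling alpha_irr qe N0.
have lam1' : 1 < `|lam| by rewrite (lt_le_trans lam1) // ler_norm.
have [L [Laut Lexp LE]] := slope_line_scaling alpha lam1'.
exists L; split=> // P /(hull_side_model phys_inj s0 ps trA).
move=> [a' [om [sg [-> _]]]].
exact: (side_model_L_Sub phys_inj alpha_irr s0 ps N0 lam1 ratN phiG psiG psiK p_phi q_phi
  lamN LE).
Qed.

Variable tau : pattern R 2 1 -> torus R 2.
Hypothesis tauP : torus_parametrisation Ev Ei W tau.
Variable P : pattern R 2 1.
Hypothesis hullP : cp_hull Ev Ei W P.

Local Notation rational_class :=
  (exists u, tau P = torus_class u /\ rational_pri Ev Ei (pri Ev Ei u)).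

Lemma rational_class_substitution : rational_class ->
  exists (L : 'End(V)) (sigma : pattern R 2 1 -> pattern R 2 1),
    [/\ lin_aut Ev L, expansive Ev L,
        substitution_map Ev L (cp_hull Ev Ei W) sigma & sigma P = P].
Proof.
move=> [u [tu /rational_priE[_ [N1 N10 ru]]]].
have [s [s0 ps rat AE]] := rational_interval_unionE unionA.
have [winA trA] := iv_window s0 ps AE.
have [a' [om [sg [PE approx]]]] := hull_side_model phys_inj s0 ps trA hullP.
have tP := torus_parametrisationE alpha_irr phys_inj s0 ps winA trA tauP hullP approx.
have rat_om : lattice_rational alpha N1 om.
  have /torus_classP Gd : torus_class u = torus_class (a' *: v + om *: w).
    by rewrite -tu.
  have qd : q (u - (a' *: v + om *: w)) = q u - om.
    by rewrite int_coordB int_coordD !int_coordZ int_coord_slope int_coord_internal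
               mulr0 add0r mulr1.
  move: ru; rewrite priE int_coordZ int_coord_internal mulr1 => -[g Gg e].
  exists (g - N1%:~R *: (u - (a' *: v + om *: w))).
    exact: latticeB Gg (latticeZ _ Gd).
  by rewrite int_coordB int_coordZ qd -e -[N1%:~R]/(N1%:R); ring.
(* The offset joins the endpoints, so that a single unit is compatible with the window and with the
   offset. *)
have [|N N0 ratN] := @common_denominator R alpha (om :: endpoints s).
  by move=> r; rewrite inE => /predU1P[->|/rat //]; exists N1.
have ratN' r : r \in endpoints s -> lattice_rational alpha N r.
  by move=> re; apply: ratN; rewrite inE re orbT.
have [lam [phi [psi [lam1 [phiG psiG] psiK [p_phi q_phi] lamN]]]] :=
  unit_scaling alpha_irr qe N0.
have lam1' : 1 < `|lam| by rewrite (lt_le_trans lam1) // ler_norm.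
have [L [Laut Lexp LE]] := slope_line_scaling alpha lam1'.
have [D [t [fixed derived]]] := side_model_fixed phys_inj alpha_irr s0 ps N0 lam1 ratN'
  phiG psiG psiK p_phi q_phi lamN LE a' (ratN _ (mem_head _ _)).
exists L, (fun Q => derive_pattern alpha k D t (lin_image L Q)); split=> //; last first.
  by rewrite PE fixed.
exists (@derive_pattern R alpha k D t 1); split=> //; split.
  move=> _ [Q HQ <-].
  have [a2 [om2 [sg2 [-> _]]]] := hull_side_model phys_inj s0 ps trA HQ.
  by rewrite derived; apply: side_model_hull.
have [c0 c00 hc] := derive_local alpha k D t 1.
exists c0; split=> // Q Q' x y _ _ _ _ /ball_patchP ag; apply/ball_patchP => i z.
by rewrite normr_le0 => /eqP ->; rewrite !addr0; apply: hc.
Qed.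

(** Locality of [S], restricted to the single pattern [L P], is local derivability of [S (L P) = P]
    from [L P]. *)
Lemma substitution_pseudo_self_affine :
  (exists (L : 'End(V)) (sigma : pattern R 2 1 -> pattern R 2 1),
    [/\ lin_aut Ev L, expansive Ev L,
        substitution_map Ev L (cp_hull Ev Ei W) sigma & sigma P = P]) ->
  exists L : 'End(V), [/\ lin_aut Ev L, expansive Ev L & pseudo_self_affine Ev L P].
Proof.
move=> [L [sigma [Laut Lexp [S [[_ [c0 [c00 hS]]] sigE]] fixP]]]; exists L; split=> //.
exists c0; split=> // x y xE yE ag.
have PS : P = S (lin_image L P) by rewrite -sigE.
by rewrite {1 2}PS; apply: hS => //; exists P.
Qed.

Lemma pseudo_self_affine_rational_class :
  (exists L : 'End(V), [/\ lin_aut Ev L, expansive Ev L & pseudo_self_affine Ev L P]) ->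
  rational_class.
Proof.
move=> [L [Laut Lexp der]]; have [lam lam1 LE] := slope_line_aut Laut Lexp.
have [s [s0 ps rat AE]] := rational_interval_unionE unionA.
have [winA trA] := iv_window s0 ps AE.
have [a' [om [sg [PE approx]]]] := hull_side_model phys_inj s0 ps trA hullP.
have tP := torus_parametrisationE alpha_irr phys_inj s0 ps winA trA tauP hullP approx.
have [N N0 ratN] := common_denominator rat.
exists (a' *: v + om *: w); split=> //.
apply/rational_priE; rewrite priE memvZ ?memv_line //; split=> //.
rewrite int_coordZ int_coord_internal mulr1 int_coordD !int_coordZ int_coord_slope.
rewrite int_coord_internal mulr0 add0r mulr1; rewrite PE in der.
exact: (pseudo_self_affine_rational alpha_irr phys_inj s0 ps N0 ratN LE lam1 der).
Qed.

End RationalUnion.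

Lemma rational_interval_union_exists : exists A, rational_interval_union Ev Ei A.
Proof.
exists (\bigcup_(u in [set` [:: (0 : V, w)]]) segment u.1 u.2), [:: (0, w)]; split=> //.
move=> u; rewrite mem_seq1 => /eqP -> /=; split.
- apply/rational_priE; rewrite mem0v; split=> //; exists 1%N => //.
  by exists 0; [exact: lattice0|rewrite int_coord0 mulr0].
- apply/rational_priE; rewrite memv_line; split=> //; exists 1%N => //.
  exists (lattice_vec R 0 1); first by apply/lattice_vecP; exists 0, 1.
  by rewrite int_coord_internal /int_coord !mxE /= mulr0 subr0 mulr1.
by rewrite eq_sym internal_vec_neq0.
Qed.

End QuadraticScheme.

Unset Implicit Arguments.

Theorem theorem3p20 (R : realType) (alpha : R) (alpha_irr : irrational alpha) :
  let Ev := slope_line alpha in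
  ((exists (Ei : {vspace 'rV[R]_2}) (l : nat) (W : 'I_l -> set 'rV[R]_2)
      (L : 'End('rV[R]_2)),
      [/\ cut_and_project_scheme Ev Ei, window Ei W,
          lin_aut Ev L, expansive Ev L
        & forall P, cp_hull Ev Ei W P -> L_sub Ev L P]) ->
   quadratic_irrational alpha) /\
  (quadratic_irrational alpha ->
   exists Ei : {vspace 'rV[R]_2},
     unique (fun F : {vspace 'rV[R]_2} =>
       cut_and_project_scheme Ev F /\
       exists (l : nat) (W : 'I_l -> set 'rV[R]_2) (L : 'End('rV[R]_2)),
         [/\ window F W, lin_aut Ev L, expansive Ev L
           & forall P, cp_hull Ev F W P -> L_Sub Ev L P]) Ei /\
     forall A : set 'rV[R]_2, rational_interval_union Ev Ei A ->
       let W := fun _ : 'I_1 => A in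
       [/\ window Ei W,
           exists L : 'End('rV[R]_2),
             [/\ lin_aut Ev L, expansive Ev L
               & forall P, cp_hull Ev Ei W P -> L_Sub Ev L P]
         & forall tau : pattern R 2 1 -> torus R 2,
             torus_parametrisation Ev Ei W tau ->
           forall P, cp_hull Ev Ei W P ->
             ((exists L : 'End('rV[R]_2),
                 [/\ lin_aut Ev L, expansive Ev L
                   & pseudo_self_affine Ev L P]) <->
              (exists u, tau P = torus_class u /\
                 rational_pri Ev Ei (pri Ev Ei u))) /\
             ((exists (L : 'End('rV[R]_2))
                  (sigma : pattern R 2 1 -> pattern R 2 1),
                 [/\ lin_aut Ev L, expansive Ev L,
                     substitution_map Ev L (cp_hull Ev Ei W) sigma
                   & sigma P = P]) <->
              (exists u, tau P = torus_class u /\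
                 rational_pri Ev Ei (pri Ev Ei u)))]).
Proof.
move=> Ev; split.
  move=> [Ei [l [W [L [cps win Laut Lexp Lsub]]]]].
  have [k EiE pinj] := scheme_line cps; rewrite EiE in win Lsub.
  have [a [b [c [qe _]]]] := sub_scheme_quadratic alpha_irr pinj win Laut Lexp Lsub.
  by apply/(quadratic_irrationalP alpha_irr); exists a, b, c.
move=> /(quadratic_irrationalP alpha_irr)[a [b [c qe]]].
exists <[internal_vec alpha (conjugate_param alpha a b)]>%VS; split; last first.
  move=> A HA W; split.
  - exact: (rational_union_window HA).
  - exact: (rational_union_L_Sub alpha_irr qe HA).
  move=> tau tauP P HP.
  (* The three implications form a cycle, which yields both equivalences. *)
  have h1 := rational_class_substitution alpha_irr qe HA tauP HP.
  have h2 := @substitution_pseudo_self_affine R alpha a b A P.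
  have h3 := pseudo_self_affine_rational_class alpha_irr qe HA tauP HP.
  by split; split=> [H|/h1 H] //; [exact: h3|exact: h2|exact/h3/h2].
split.
  split; first exact: (conjugate_scheme alpha_irr qe).
  have [A HA] := rational_interval_union_exists alpha a b.
  have [L [Laut Lexp Lsub]] := rational_union_L_Sub alpha_irr qe HA.
  exists 1%N, (fun _ => A), L; split=> //; exact: (rational_union_window HA).
move=> F [cps [l [W [L [win Laut Lexp Lsub]]]]].
(* [L_Sub] implies [L_sub], so the necessity argument already determines the parameter of the
   internal line. *)
have [k FE pinj] := scheme_line cps; rewrite FE in win Lsub *.
congr (<[internal_vec alpha _]>%VS); apply/esym/(conjugate_line_unique alpha_irr qe).
apply: (sub_scheme_quadratic alpha_irr pinj win Laut Lexp) => P /Lsub.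
by move=> [P' [dP' [PP' _] [der _]]]; exists P'.
Qed.
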